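(* Given an $n$-node directed graph $G$ and a set $P$ of $p$ demand pairs, one can construct in polynomial time a reachability preserver $H$ of $G,P$ of size $$|E(H)|\le O\left(n^{3/4}p^{1/2}+n^{2-\sqrt2+o(1)}p^{1/\sqrt2}+n\right).$$
   Context: Given a directed graph $G=(V,E)$ and a set of demand pairs $P\subseteq V\times V$, a reachability preserver is a subgraph $H\subseteq G$ such that for every $(s,t)\in P$, there is an $s\leadsto t$ path in $H$ if and only if there is one in $G$. *)

(* Defs.v *)
From HB Require Import structures.
From mathcomp Require Import all_boot all_order all_algebra.
From mathcomp Require Import all_classical all_reals all_analysis.

Set Implicit Arguments.
Unset Strict Implicit.
Unset Printing Implicit Defensive.

(* A directed graph on V is identified with its edge set; a subgraph keeps the
   whole vertex set. *)
Definition reachable (V : finType) (E : {set V * V}) (s t : V) : bool :=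
  connect [rel x y | (x, y) \in E] s t.

Definition reachability_preserver (V : finType) (G P H : {set V * V}) : Prop :=
  H \subset G /\
  forall s t, (s, t) \in P -> (reachable H s t <-> reachable G s t).

(* Random access machine: registers and memory cells hold natural numbers, and
   only memory can be addressed indirectly.  Every instruction and every test
   costs one step.  There is deliberately no multiplication or shift: a value
   then gains at most one bit per step, so unit-cost polynomial time on this
   machine is the same as polynomial time on a Turing machine. *)
Inductive ram_prog : Type :=
| ISkip
| IConst of nat & nat
| IAdd of nat & nat & nat
| ISub of nat & nat & nat
| ILoad of nat & nat
| IStore of nat & nat
| ISeq of ram_prog & ram_prog
| IIf of nat & ram_prog & ram_prog
| IWhile of nat & ram_prog.

Record ram_state := RamState { reg : nat -> nat ; cell : nat -> nat }.

Definition update (f : nat -> nat) (a v : nat) : nat -> nat :=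
  fun b => if b == a then v else f b.

Definition set_reg (s : ram_state) (r v : nat) : ram_state :=
  RamState (update (reg s) r v) (cell s).

Definition set_mem (s : ram_state) (a v : nat) : ram_state :=
  RamState (reg s) (update (cell s) a v).

(* [ram_exec c s k s']: started in s, the program c halts in s' after exactly
   k steps.  [ISub] is truncated subtraction. *)
Inductive ram_exec : ram_prog -> ram_state -> nat -> ram_state -> Prop :=
| ExecSkip s : ram_exec ISkip s 1 s
| ExecConst s r v : ram_exec (IConst r v) s 1 (set_reg s r v)
| ExecAdd s r a b :
    ram_exec (IAdd r a b) s 1 (set_reg s r (reg s a + reg s b))
| ExecSub s r a b :
    ram_exec (ISub r a b) s 1 (set_reg s r (reg s a - reg s b))
| ExecLoad s r a : ram_exec (ILoad r a) s 1 (set_reg s r (cell s (reg s a)))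
| ExecStore s a r : ram_exec (IStore a r) s 1 (set_mem s (reg s a) (reg s r))
| ExecSeq c1 c2 s1 s2 s3 k1 k2 :
    ram_exec c1 s1 k1 s2 -> ram_exec c2 s2 k2 s3 ->
    ram_exec (ISeq c1 c2) s1 (k1 + k2) s3
| ExecIfT r c1 c2 s s' k :
    reg s r != 0 -> ram_exec c1 s k s' -> ram_exec (IIf r c1 c2) s k.+1 s'
| ExecIfF r c1 c2 s s' k :
    reg s r = 0 -> ram_exec c2 s k s' -> ram_exec (IIf r c1 c2) s k.+1 s'
| ExecWhileT r c s1 s2 s3 k1 k2 :
    reg s1 r != 0 -> ram_exec c s1 k1 s2 -> ram_exec (IWhile r c) s2 k2 s3 ->
    ram_exec (IWhile r c) s1 (k1 + k2).+1 s3
| ExecWhileF r c s : reg s r = 0 -> ram_exec (IWhile r c) s 1 s.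

(* The input occupies the cells 0, 1, 2, ... of an otherwise zero memory, with
   all registers zero. *)
Definition ram_init (input : seq nat) : ram_state :=
  RamState (fun _ => 0) (nth 0 input).

(* The output is read from memory cell 0 onwards. *)
Definition ram_outputs_within
    (c : ram_prog) (input : seq nat) (T : nat) (output : seq nat) : Prop :=
  exists k s, [/\ ram_exec c (ram_init input) k s, k <= T &
                  mkseq (cell s) (size output) = output].

Definition polynomially_bounded (T : nat -> nat) : Prop :=
  exists a d, forall N, T N <= a * N ^ d + a.

(* Row-major 0/1 adjacency matrix. *)
Definition adjacency (n : nat) (E : {set 'I_n * 'I_n}) : seq nat :=
  [seq nat_of_bool ((i, j) \in E) | i <- enum 'I_n, j <- enum 'I_n].

Definition encode_graph (n : nat) (E : {set 'I_n * 'I_n}) : seq nat :=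
  n :: adjacency E.

Definition encode_instance (n : nat) (G P : {set 'I_n * 'I_n}) : seq nat :=
  encode_graph G ++ adjacency P.

(* Main.v *)
(**
   The algorithm deletes edges greedily, so its output H is a minimal preserver:
   every edge of H is a cut edge for some demand pair.  The edges inside strong
   components number at most 2n, because an out-tree and an in-tree of each
   component already keep it strongly connected.  Every other edge is assigned to
   one pair that it cuts; let S_i be the set of heads of the edges assigned to
   the pair i.  Ordered by reachability in H, the S_i are chains without bridges:
   if x, y are in S_i, z, y are in S_j and x <= z < y, then i = j.

   For a bridge-free system of n nodes of degree about d and p chains of length l,
   count the rungs, i.e. the segments of a chain q joining a chain p to a chain r.
   The chains leaving p are pairwise disjoint, which gives l^2 d <= n.  If
   n = l^2 d g, ladders (p, r) have about l/g rungs, hence consecutive rungs q, q'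
   at distance g on p and r; read the other way, the short segments of p and r are
   rungs of the ladder (q, q').  So a typical q' meets the short fan of q, a set of
   l d g nodes, about l/g times.  The chains restricted to this fan are again
   bridge-free, and a bound d l^t <= n applied to them gives (l/g)^t <= l g, which
   improves the exponent t to 2 + (t-1)/(t+1).  Iterating, t tends to 1 + sqrt 2,
   unless d < g, which is the case responsible for the term n^(3/4) p^(1/2).
*)
Require Import Defs.
From HB Require Import structures.
From mathcomp Require Import all_boot all_order all_algebra.
From mathcomp Require Import zify ring lra.

Set Implicit Arguments.
Unset Strict Implicit.
Unset Printing Implicit Defensive.

(** * Path systems without bridges *)

(** The lower bounds on crossings, on rungs and on the fan energy all come from one Cauchy-Schwarz
    count of collisions; the uniqueness lemmas turn each collision into an object of the next kind.
    The obstacle is the constants: every round of the iteration worsens them, and the number of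
    rounds grows as the error in the exponent shrinks. So [sparse] keeps a single [A], fixed for all
    rounds, and lets only [C] depend on [t]; for large n, [C] is absorbed by a factor n^(d/2), and
    letting d tend to 0 with n gives the o(1). The limit 1 + sqrt 2 is the fixed point of the map t
    -> 2 + (t-1)/(t+1), that is, the positive root of t^2 = 2t + 1; there 2/(t+1) = 2 - sqrt 2 and
    t/(t+1) = 1/sqrt 2. Bridge-freeness is stated for a preorder, so that it survives restriction to
    a set of nodes, cutting of paths and duplication of nodes. *)

Lemma sum_sq_le (I : finType) (J : {pred I}) (a : I -> nat) :
  (\sum_(i in J) a i) ^ 2 <= #|J| * \sum_(i in J) a i ^ 2.
Proof.
rewrite -(leq_pmul2l (isT : 0 < 2)).
have -> : 2 * (\sum_(i in J) a i) ^ 2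
    = \sum_(i in J) \sum_(j in J) 2 * (a i * a j).
  rewrite -mulnn big_distrlr /= big_distrr /=; apply: eq_bigr => i _.
  by rewrite big_distrr.
have -> : 2 * (#|J| * \sum_(i in J) a i ^ 2)
    = \sum_(i in J) \sum_(j in J) (a i ^ 2 + a j ^ 2).
  under [RHS]eq_bigr => i _ do rewrite big_split sum_nat_const.
  rewrite big_split /= sum_nat_const -big_distrr /=; lia.
by apply: leq_sum => i _; apply: leq_sum => j _; rewrite nat_Cauchy.
Qed.

Lemma card_fibers (A B : finType) (f : A -> B) (X : {set A}) (Y : {set B}) :
  {in X, forall x, f x \in Y} ->
  #|X| = \sum_(y in Y) #|[set x in X | f x == y]|.
Proof.
move=> fXY; rewrite -sum1_card (partition_big f (mem Y)) //=.
by apply: eq_bigr => y _; rewrite -sum1_card; apply: eq_bigl => x; rewrite !inE.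
Qed.

(** Cauchy-Schwarz over the fibers of [f]. It is applied to incidences (by node), to crossings (by
    path) and to rungs (by ladder and block sum). *)
Lemma collision_bound (A B : finType) (f : A -> B) (X : {set A}) (Y : {set B}) :
  {in X, forall x, f x \in Y} ->
  #|X| ^ 2 <= #|Y| * #|[set p in setX X X | f p.1 == f p.2]|.
Proof.
move=> fXY; rewrite (card_fibers fXY).
apply: leq_trans (sum_sq_le _ _) _; rewrite leq_mul2l; apply/orP; right.
rewrite (@card_fibers _ _ (fun p => f p.1) _ Y); last first.
  by move=> p; rewrite !inE -andbA => /and3P[/fXY].
apply: leq_sum => y _; rewrite -mulnn -cardsX; apply: subset_leq_card.
apply/subsetP=> -[a b]; rewrite !inE /= => /andP[/andP[-> /eqP ->] /andP[-> /eqP ->]].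
by rewrite eqxx.
Qed.

Lemma leq_card_inj (A B : finType) (f : A -> B) (X : {set A}) (Y : {set B}) :
  {in X, forall x, f x \in Y} -> {in X &, injective f} -> #|X| <= #|Y|.
Proof.
move=> fXY inj; rewrite -(card_in_imset inj); apply: subset_leq_card.
by apply/subsetP=> _ /imsetP[x xX ->]; exact: fXY.
Qed.

Definition strict (V : finType) (le : rel V) : rel V :=
  fun x y => le x y && ~~ le y x.

Definition nodes (V I : finType) (S : {set V * I}) (i : I) : {set V} :=
  [set v | (v, i) \in S].

Definition paths (V I : finType) (S : {set V * I}) (v : V) : {set I} :=
  [set i | (v, i) \in S].

Lemma card_sum_nodes (V I : finType) (S : {set V * I}) (J : {set I}) :
  {in S, forall u, u.2 \in J} -> #|S| = \sum_(i in J) #|nodes S i|.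
Proof.
move=> supp; rewrite (@card_fibers _ _ snd S J) //; apply: eq_bigr => i _.
have inj : injective (fun v : V => (v, i)) by move=> v w [].
rewrite -[RHS](card_imset _ inj); apply: eq_card => -[v j]; rewrite !inE /=.
apply/andP/imsetP => [[vj /eqP e]|[w wi [-> ->]]].
  by exists v; rewrite ?inE -?e.
by rewrite inE in wi.
Qed.

Record bridge_free (V I : finType) (le : rel V) (S : {set V * I}) : Prop :=
  BridgeFree {
    bf_refl : reflexive le;
    bf_trans : transitive le;
    bf_chain : forall i x y, (x, i) \in S -> (y, i) \in S -> x != y ->
      strict le x y || strict le y x;
    (* The relation [le] is only required to contain the order along the paths;
       for a preserver it is reachability, so [x <= z] need not follow a path. *)
    bf_bridge : forall i j x z y,
      (x, i) \in S -> (y, i) \in S -> (z, j) \in S -> (y, j) \in S ->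
      le x z -> strict le z y -> i = j }.

Section BridgeFree.
Variables (V I : finType) (le : rel V) (S : {set V * I}).
Hypothesis bf : bridge_free le S.
Local Notation lt := (strict le).

Lemma strictW x y : lt x y -> le x y. Proof. by case/andP. Qed.

Lemma strictxx x : lt x x = false.
Proof. by rewrite /strict andbN. Qed.

Lemma le_strict_trans y x z : le x y -> lt y z -> lt x z.
Proof.
move=> xy /andP[yz nzy]; rewrite /strict (bf_trans bf xy yz) /=.
by apply: contra nzy => zx; exact: bf_trans bf _ _ _ zx xy.
Qed.

Lemma strict_trans y x z : lt x y -> lt y z -> lt x z.
Proof. by move=> /strictW; exact: le_strict_trans. Qed.

Lemma strict_neq x y : lt x y -> x != y.
Proof. by apply: contraTneq => ->; rewrite strictxx. Qed.

(** A second common node gives the degenerate bridge with z = x. *)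
Lemma meet_once i j x y : (x, i) \in S -> (y, i) \in S -> (x, j) \in S ->
  (y, j) \in S -> x != y -> i = j.
Proof.
move=> xi yi xj yj /(bf_chain bf xi yi)/orP[] lxy.
  exact: (bf_bridge bf xi yi xj yj (bf_refl bf x) lxy).
exact: (bf_bridge bf yi xi yj xj (bf_refl bf y) lxy).
Qed.

(** This is the disjointness of the paths leaving [p]. If y1 precedes y2 on [p], going from y1 to y2
    and on along q2 to z is a bridge for q1, so q1 = q2; this path would then meet [p] twice. *)
Lemma fan_uniq p q1 q2 y1 y2 z :
  (y1, p) \in S -> (y2, p) \in S -> (y1, q1) \in S -> (z, q1) \in S ->
  (y2, q2) \in S -> (z, q2) \in S -> lt y1 z -> lt y2 z ->
  q1 != p -> q2 != p -> y1 = y2 /\ q1 = q2.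
Proof.
move=> y1p y2p y1q1 zq1 y2q2 zq2 l1 l2 n1 n2.
have [e|ne] := eqVneq y1 y2.
  subst y2; split=> //; exact: (meet_once y1q1 zq1 y2q2 zq2 (strict_neq l1)).
have q12 : q1 = q2.
  case/orP: (bf_chain bf y1p y2p ne) => [/strictW l|/strictW l].
    exact: (bf_bridge bf y1q1 zq1 y2q2 zq2 l l2).
  by apply/esym; exact: (bf_bridge bf y2q2 zq2 y1q1 zq1 l l1).
subst q2; case/eqP: n1; exact: (meet_once y1q1 y2q2 y1p y2p ne).
Qed.

(** The bridge condition is not symmetric under reversal, since its two paths share the later node.
    Here [p] itself is the second path: z <= y1 < y2 with z on q2 and y1 on [p] forces q2 = p. *)
Lemma fan_uniq_rev p q1 q2 y1 y2 z :
  (y1, p) \in S -> (y2, p) \in S -> (y1, q1) \in S -> (z, q1) \in S ->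
  (y2, q2) \in S -> (z, q2) \in S -> lt z y1 -> lt z y2 ->
  q1 != p -> q2 != p -> y1 = y2 /\ q1 = q2.
Proof.
move=> y1p y2p y1q1 zq1 y2q2 zq2 l1 l2 n1 n2.
have [e|ne] := eqVneq y1 y2.
  subst y2; split=> //; apply: (meet_once y1q1 zq1 y2q2 zq2 _).
  by rewrite eq_sym strict_neq.
case/orP: (bf_chain bf y1p y2p ne) => l.
  by case/eqP: n2; exact: (bf_bridge bf zq2 y2q2 y1p y2p (strictW l1) l).
by case/eqP: n1; exact: (bf_bridge bf zq1 y1q1 y2p y1p (strictW l2) l).
Qed.

(** If z' came before z, then y <= y' <= z' < z, and the piece of [r] from z' to z would make a
    bridge for [q]. The case z = z' is excluded by [fan_uniq]. *)
Lemma ladder_mono p r q q' y y' z z' :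
  (y, p) \in S -> (y', p) \in S -> (z, r) \in S -> (z', r) \in S ->
  (y, q) \in S -> (z, q) \in S -> (y', q') \in S -> (z', q') \in S ->
  lt y z -> lt y' z' -> q != p -> q != r -> q' != p -> q' != r ->
  lt y y' -> lt z z'.
Proof.
move=> yp y'p zr z'r yq zq y'q' z'q' yz y'z' qp qr q'p q'r yy'.
have [e|ne] := eqVneq z z'.
  subst z'; have [e _] := fan_uniq yp y'p yq zq y'q' z'q' yz y'z' qp q'p.
  by subst y'; rewrite strictxx in yy'.
case/orP: (bf_chain bf zr z'r ne) => // z'z; case/eqP: qr.
apply: (bf_bridge bf yq zq z'r zr _ z'z).
exact: bf_trans bf _ _ _ (strictW yy') (strictW y'z').
Qed.

Lemma ladder_inj p r q q' y z z' :
  (y, p) \in S -> (z, r) \in S -> (z', r) \in S ->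
  (y, q) \in S -> (z, q) \in S -> (y, q') \in S -> (z', q') \in S ->
  lt y z -> lt y z' -> q != p -> q != r -> q' != p -> q' != r ->
  q = q' /\ z = z'.
Proof.
move=> yp zr z'r yq zq yq' z'q' yz yz' qp qr q'p q'r.
have e : z = z'.
  have [//|ne] := eqVneq z z'.
  case/orP: (bf_chain bf zr z'r ne) => zz'.
    by case/eqP: q'r; exact: (bf_bridge bf yq' z'q' zr z'r (strictW yz) zz').
  by case/eqP: qr; exact: (bf_bridge bf yq zq z'r zr (strictW yz') zz').
by subst z'; split=> //; exact: (meet_once yq zq yq' z'q' (strict_neq yz)).
Qed.

End BridgeFree.

(** * Cutting paths and nodes into pieces of prescribed size *)

Lemma mem_chunk d b k : 0 < d -> (k %/ d == b) = (k \in iota (b * d) d).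
Proof.
by move=> d0; rewrite mem_iota eqn_leq -ltnS ltn_divLR // leq_divRL // mulSn; lia.
Qed.

Section Chunk.
Variables (T : finType) (X : {set T}) (d : nat).
Hypothesis d_gt0 : 0 < d.

(** The pieces follow the enumeration of [X] and not the order along a path: any subset of a chain
    is a chain. *)
Definition chunk (x : T) : nat := index x (enum X) %/ d.

Lemma card_chunkE b :
  #|[set x in X | chunk x == b]| = size [seq k <- iota 0 #|X| | k %/ d == b].
Proof.
have -> : iota 0 #|X| = [seq index x (enum X) | x <- enum X].
  apply: (@eq_from_nth _ 0); first by rewrite size_iota size_map cardE.
  move=> i; rewrite size_iota cardE => iX.
  have [x0 _] : exists x0 : T, True by case: (enum X) iX => // x; exists x.
  by rewrite nth_iota // (nth_map x0) // index_uniq ?enum_uniq.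
rewrite filter_map size_map cardE; congr size.
rewrite /enum_mem -filter_predI /=; apply: eq_filter => x /=.
by rewrite !inE /chunk andbC.
Qed.

Lemma card_chunk_le b : #|[set x in X | chunk x == b]| <= d.
Proof.
rewrite card_chunkE -[leqRHS](size_iota (b * d)); apply: uniq_leq_size.
  by rewrite filter_uniq ?iota_uniq.
by move=> k; rewrite mem_filter mem_chunk // => /andP[].
Qed.

Lemma card_chunk b : b < #|X| %/ d -> #|[set x in X | chunk x == b]| = d.
Proof.
rewrite leq_divRL // => bX.
rewrite card_chunkE -[RHS](size_iota (b * d)); apply/perm_size/uniq_perm.
- by rewrite filter_uniq ?iota_uniq.
- exact: iota_uniq.
move=> k; rewrite mem_filter mem_chunk // !mem_iota.
apply: andb_idr => /andP[_]; rewrite mulSn in bX; lia.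
Qed.

Lemma chunk_lt x : x \in X -> chunk x * d < #|X|.
Proof.
move=> xX; rewrite cardE; apply: leq_ltn_trans (leq_divM _ _) _.
by rewrite index_mem mem_enum.
Qed.

End Chunk.

Section Split.
Variables (V I : finType) (le : rel V) (S : {set V * I}).
Hypothesis bf : bridge_free le S.

Lemma bridge_free_sub (S' : {set V * I}) : S' \subset S -> bridge_free le S'.
Proof.
move=> /subsetP sub; split; first exact: (bf_refl bf).
- exact: (bf_trans bf).
- by move=> i x y /sub xi /sub yi; exact: (bf_chain bf xi yi).
- move=> i j x z y /sub xi /sub yi /sub zj /sub yj; exact: (bf_bridge bf xi yi).
Qed.

(** Two pieces of one path are now different paths, but they make no bridge: the common node y lies
    in only one of them. *)
Lemma bridge_free_split_paths (B : finType) (c : V -> I -> B) :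
  bridge_free le
    [set u : V * (I * B) | ((u.1, u.2.1) \in S) && (c u.1 u.2.1 == u.2.2)].
Proof.
split; first exact: (bf_refl bf).
- exact: (bf_trans bf).
- move=> [i b] x y; rewrite !inE /= => /andP[xi _] /andP[yi _].
  exact: (bf_chain bf xi yi).
move=> [i b] [j b'] x z y; rewrite !inE /=.
move=> /andP[xi _] /andP[yi /eqP <-] /andP[zj _] /andP[yj /eqP <-] xz zy.
by have -> := bf_bridge bf xi yi zj yj xz zy.
Qed.

(** The copies of a node lie below each other, so they are never strictly comparable. A path uses
    only one copy of each node, hence remains a chain. *)
Lemma bridge_free_split_nodes (A : finType) (c : V -> I -> A) :
  bridge_free (fun x y : V * A => le x.1 y.1)
    [set u : (V * A) * I | ((u.1.1, u.2) \in S) && (c u.1.1 u.2 == u.1.2)].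
Proof.
split; first by move=> x; exact: (bf_refl bf _).
- by move=> y x z; apply: (bf_trans bf).
- move=> i [x a] [y b]; rewrite !inE /= => /andP[xi /eqP <-] /andP[yi /eqP <-] ne.
  by apply: (bf_chain bf xi yi); apply: contraNneq ne => ->.
move=> i j [x a] [z b] [y a']; rewrite !inE /=.
move=> /andP[xi _] /andP[yi _] /andP[zj _] /andP[yj _] xz zy.
exact: (bf_bridge bf xi yi zj yj xz zy).
Qed.

End Split.

Record uniform_system (V I : finType) (le : rel V) (S : {set V * I})
    (N : {set V}) (J : {set I}) (L : nat) : Prop := UniformSystem {
  us_bf : bridge_free le S;
  us_supp : {in S, forall u, u.1 \in N /\ u.2 \in J};
  us_card : {in J, forall i, #|nodes S i| = L} }.

(** A path with at least [L] nodes loses fewer than [L] of them as a remainder, hence less than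
    half; this is the factor 2. *)
Lemma uniform_split_paths (V I : finType) (le : rel V) (S : {set V * I})
    (N : {set V}) (L : nat) :
  bridge_free le S -> {in S, forall u, u.1 \in N} -> 0 < L ->
  exists (I' : finType) (S' : {set V * I'}) (J' : {set I'}),
    uniform_system le S' N J' L /\
    \sum_(i | L <= #|nodes S i|) #|nodes S i| <= 2 * (#|J'| * L).
Proof.
move=> bf suppN L0.
pose c v i : 'I_#|V|.+1 := inord (chunk (nodes S i) L v).
pose J' : {set I * 'I_#|V|.+1} := [set i : I * 'I_#|V|.+1 | i.2 < #|nodes S i.1| %/ L].
pose S1 := [set u : V * (I * 'I_#|V|.+1) |
  ((u.1, u.2.1) \in S) && (c u.1 u.2.1 == u.2.2)].
exists _, [set u in S1 | u.2 \in J'], J'.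
have bigV i k : k < #|nodes S i| %/ L -> k < #|V|.+1.
  move=> kl; rewrite ltnS; apply: ltnW; apply: leq_trans kl _.
  exact: leq_trans (leq_div _ _) (max_card _).
have valc v i : (v, i) \in S -> c v i = chunk (nodes S i) L v :> nat.
  move=> vi; rewrite /c inordK // ltnS /chunk.
  apply: leq_trans (leq_div _ _) _; apply: leq_trans (index_size _ _) _.
  by rewrite -cardE max_card.
split; first split.
- apply: (@bridge_free_sub _ _ _ S1); first exact: bridge_free_split_paths.
  by apply/subsetP=> u; rewrite inE => /andP[].
- move=> [v i]; rewrite inE => /andP[]; rewrite inE /= => /andP[/suppN /= vN _].
  by [].
- move=> [i b] iJ; rewrite inE /= in iJ.
  rewrite -(card_chunk L0 iJ); apply: eq_card => v.
  rewrite !inE /= iJ andbT; apply: andb_id2l => vi.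
  by rewrite -val_eqE /= valc.
have -> : #|J'| = \sum_i #|nodes S i| %/ L.
  rewrite -sum1_card.
  transitivity (\sum_(i : I) \sum_(b < #|V|.+1 | b < #|nodes S i| %/ L) 1).
    by rewrite pair_big_dep /=; apply: eq_bigl => -[i b]; rewrite inE.
  apply: eq_bigr => i _.
  have lV : #|nodes S i| %/ L <= #|V|.+1.
    by case E : (_ %/ _) => [//|k]; apply: (@bigV i); rewrite E.
  by rewrite -(big_ord_widen _ (fun=> 1) lV) sum1_card card_ord.
rewrite big_distrl /= big_distrr /= [leqRHS](bigID (fun i => L <= #|nodes S i|)) /=.
apply: leq_trans (leq_addr _ _); apply: leq_sum => i Li.
have := divn_eq #|nodes S i| L; have := ltn_pmod #|nodes S i| L0.
have : 0 < #|nodes S i| %/ L by rewrite divn_gt0.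
nia.
Qed.

(** This turns an average degree into a maximum degree: a node of degree k is replaced by at most
    k/D + 1 copies, and summing over the nodes gives the last bound. *)
Lemma uniform_split_nodes (V I : finType) (le : rel V) (S : {set V * I})
    (N : {set V}) (J : {set I}) (L D : nat) :
  uniform_system le S N J L -> 0 < D ->
  exists (V' : finType) (le' : rel V') (S' : {set V' * I}) (N' : {set V'}),
    [/\ uniform_system le' S' N' J L, forall v, #|paths S' v| <= D &
        #|N'| * D <= #|J| * L + #|N| * D].
Proof.
move=> [bf supp crd] D0.
pose c v i : 'I_#|I|.+1 := inord (chunk (paths S v) D i).
pose S' := [set u : (V * 'I_#|I|.+1) * I |
  ((u.1.1, u.2) \in S) && (c u.1.1 u.2 == u.1.2)].
pose N' := [set x : V * 'I_#|I|.+1 | (x.1 \in N) && (x.2 * D <= #|paths S x.1|)].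
have valc v i : (v, i) \in S -> c v i = chunk (paths S v) D i :> nat.
  move=> vi; rewrite /c inordK // ltnS /chunk.
  apply: leq_trans (leq_div _ _) _; apply: leq_trans (index_size _ _) _.
  by rewrite -cardE max_card.
exists _, (fun x y => le x.1 y.1), S', N'; split.
- split; first exact: bridge_free_split_nodes.
  + move=> [[v a] i]; rewrite !inE /= => /andP[vi /eqP <-].
    have [-> ->] := supp _ vi; split=> //=.
    by rewrite valc // ltnW // chunk_lt // inE.
  + move=> i iJ; rewrite -(crd i iJ).
    rewrite -(card_in_imset (f := fun v => (v, c v i)) (D := nodes S i)).
      apply: eq_card => -[v a]; rewrite !inE /=.
      apply/andP/imsetP => [[vi /eqP <-]|[w wi [-> ->]]].
        by exists v => //; rewrite inE.
      by rewrite inE in wi.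
    by move=> v w _ _ [].
- move=> [v a]; apply: leq_trans (card_chunk_le (paths S v) D0 a).
  apply: subset_leq_card; apply/subsetP=> i; rewrite !inE /= => /andP[vi /eqP <-].
  by rewrite vi valc /=.
have -> : #|J| * L = \sum_(v in N) #|paths S v|.
  transitivity (\sum_(i in J) #|nodes S i|).
    by rewrite (eq_bigr (fun _ => L)) ?sum_nat_const.
  under eq_bigr => i _ do rewrite -sum1dep_card.
  under [RHS]eq_bigr => i _ do rewrite -sum1dep_card.
  rewrite (exchange_big_dep (mem N)) /=; last by move=> i v _ /supp[].
  apply: eq_bigr => v vN; apply: eq_bigl => i.
  by apply: andb_idl => /supp[].
have -> : #|N'| <= \sum_(v in N) (#|paths S v| %/ D).+1 -> #|N'| * D <=
    \sum_(v in N) #|paths S v| + #|N| * D => //.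
  move=> le1; apply: leq_trans (leq_mul le1 (leqnn D)) _.
  rewrite big_distrl /= -sum_nat_const -big_split /=; apply: leq_sum => v _.
  by rewrite mulSn addnC leq_add2r leq_divM.
rewrite -sum1_card.
rewrite (_ : \sum_(x in N') 1
  = \sum_(v in N) \sum_(a < #|I|.+1 | a * D <= #|paths S v|) 1); last first.
  by rewrite pair_big_dep /=; apply: eq_bigl => -[v a]; rewrite inE.
apply: leq_sum => v _.
have lI : (#|paths S v| %/ D).+1 <= #|I|.+1.
  by rewrite ltnS; apply: leq_trans (leq_div _ _) (max_card _).
under eq_bigl => a do rewrite -leq_divRL // -ltnS.
by rewrite -(big_ord_widen _ (fun=> 1) lI) sum1_card card_ord.
Qed.

(** * Counting rungs *)

Lemma addn_eq_mono a b c d : a <= b -> c <= d -> a + c = b + d -> a = b /\ c = d.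
Proof. lia. Qed.

Section Counting.
Variables (V I : finType) (le : rel V) (S : {set V * I}).
Variables (N : {set V}) (J : {set I}) (L : nat).
Hypothesis us : uniform_system le S N J L.
Local Notation lt := (strict le).
Let bf := us_bf us.

Lemma card_incidences : #|S| = #|J| * L.
Proof.
rewrite (@card_sum_nodes _ _ S J); last by move=> u /(us_supp us)[].
by rewrite -sum_nat_const; apply: eq_bigr => i iJ; rewrite (us_card us iJ).
Qed.

(** A triple ((y, q), p) is read as: at the node y, the path q crosses another path p. *)
Definition crossings : {set (V * I) * I} :=
  [set t | [&& t.1 \in S, (t.1.1, t.2) \in S & t.2 != t.1.2]].

(** Two incidences at the same node either coincide or form a crossing. *)
Lemma incidences_le_crossings :
  (#|J| * L) ^ 2 <= #|N| * (#|J| * L + #|crossings|).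
Proof.
rewrite -card_incidences.
apply: leq_trans (@collision_bound _ _ fst S N _) _.
  by move=> u /(us_supp us)[].
rewrite leq_mul2l; apply/orP; right.
set C := [set p in _ | _].
rewrite -(cardsID [set p : (V * I) * (V * I) | p.1 == p.2] C); apply: leq_add.
  apply: (leq_card_inj (f := fst)) => [p|[a b] [c d]]; rewrite !inE /=.
    by rewrite -!andbA => /and3P[].
  by move=> /andP[_ /eqP <-] /andP[_ /eqP <-] ->.
apply: (leq_card_inj (f := fun p => (p.1, p.2.2))).
  move=> [[v i] [w j]]; rewrite !inE /= => /andP[ne /andP[/andP[vi wj] /eqP e]].
  subst w; rewrite vi wj /=; apply: contra ne => /eqP ->; exact: eqxx.
move=> [[v i] [w j]] [[v' i'] [w' j']]; rewrite !inE /=.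
by move=> /andP[_ /andP[_ /eqP ->]] /andP[_ /andP[_ /eqP ->]] [-> -> ->].
Qed.

(** Extend each crossing by one of the L - 1 other nodes z of q. The pair (p, z) and the direction
    of travel then determine the crossing. *)
Lemma crossings_fan : (L - 1) * #|crossings| <= 2 * (#|J| * #|N|).
Proof.
pose X := [set t : ((V * I) * I) * V |
  [&& t.1 \in crossings, (t.2, t.1.1.2) \in S & t.2 != t.1.1.1]].
have -> : (L - 1) * #|crossings| = #|X|.
  rewrite (@card_fibers _ _ fst X crossings); last first.
    by move=> t; rewrite inE => /and3P[].
  rewrite mulnC -sum_nat_const; apply: eq_bigr => -[[y q] p] tC.
  have := tC; rewrite inE /= => /and3P[yq _ _].
  have [_ /= qJ] := us_supp us yq.
  have := cardsD1 y (nodes S q); rewrite (us_card us qJ) inE yq add1n => ->.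
  rewrite subn1 /=.
  have inj : injective (fun z : V => (y, q, p, z)) by move=> v w [].
  rewrite -[LHS](card_imset _ inj).
  apply: eq_card => -[[[y' q'] p'] z]; rewrite [RHS]inE.
  apply/imsetP/andP => [[z' + [-> -> -> ->]]|[]].
    by rewrite !inE /= eqxx => /andP[-> ->]; rewrite inE /= in tC; rewrite tC.
  rewrite inE /= => /and3P[_ zq zy] /eqP[e1 e2 e3]; subst y' q' p'.
  by exists z; rewrite // !inE zy.
apply: leq_trans (_ : #|setX (setX J N) [set: bool]| <= _); last first.
  by rewrite !cardsX cardsT card_bool mulnC.
(* The boolean records whether z comes after y, which decides between [fan_uniq] and
   [fan_uniq_rev]. *)
apply: (leq_card_inj (f := fun t => (t.1.2, t.2, lt t.1.1.1 t.2))).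
  move=> [[[y q] p] z]; rewrite !inE /= andbT.
  by move=> /and3P[/and3P[_ /(us_supp us)[_ /= ->] _] /(us_supp us)[/= -> _]].
move=> [[[y q] p] z] [[[y' q'] p'] z']; rewrite !inE /=.
move=> /and3P[/and3P[yq yp pq] zq zy] /and3P[/and3P[yq' yp' pq'] zq' zy'].
move=> [e1 e2 e3]; subst p' z'; rewrite eq_sym in pq; rewrite eq_sym in pq'.
have [l|/negbTE nl] := boolP (lt y z).
  rewrite l in e3.
  by have [-> ->] := fan_uniq bf yp yp' yq zq yq' zq' l (esym e3) pq pq'.
rewrite nl in e3.
have l : lt z y by have := bf_chain bf zq yq zy; rewrite nl orbF.
have l' : lt z y' by have := bf_chain bf zq' yq' zy'; rewrite -e3 orbF.
by have [-> ->] := fan_uniq_rev bf yp yp' yq zq yq' zq' l l' pq pq'.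
Qed.

Variable D : nat.
Hypothesis degD : forall v, #|paths S v| <= D.

(* The segment of [q] from [y] to [z] in the tuple [((y, q, p), (z, q, r))] is a
   rung of the ladder between [p] and [r]. *)
Definition rungs : {set ((V * I) * I) * ((V * I) * I)} :=
  [set t | [&& t.1 \in crossings, t.2 \in crossings, t.1.1.2 == t.2.1.2
    & lt t.1.1.1 t.2.1.1]].

(** Collisions are pairs of crossings on the same path q. At equal nodes there are at most [D] per
    crossing; at distinct nodes the pair or its swap is a rung. *)
Lemma crossings_le_rungs :
  #|crossings| ^ 2 <= #|J| * (#|crossings| * D + 2 * #|rungs|).
Proof.
apply: leq_trans (@collision_bound _ _ (fun t => t.1.2) crossings J _) _.
  by move=> t; rewrite inE => /and3P[/(us_supp us)[]].
rewrite leq_mul2l; apply/orP; right.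
set C := [set p in _ | _].
rewrite -(cardsID [set t | t.1.1.1 == t.2.1.1] C); apply: leq_add.
  rewrite (@card_fibers _ _ fst _ crossings); last first.
    by move=> t; rewrite !inE -!andbA => /and3P[-> -> /andP[-> _]].
  rewrite -sum_nat_const; apply: leq_sum => -[[y q] p] _.
  apply: leq_trans (degD y).
  apply: (leq_card_inj (f := fun t => t.2.2)).
    move=> [[[y1 q1] p1] [[y2 q2] p2]]; rewrite !inE /= -!andbA.
    by move=> /and5P[_ _ _ _ /and5P[h _ _ /eqP e1 /eqP[e2 _ _]]]; subst.
  move=> [[[y1 q1] p1] [[y2 q2] p2]] [[[y1' q1'] p1'] [[y2' q2'] p2']].
  rewrite !inE /= -!andbA.
  move=> /and5P[_ _ _ _ /and5P[_ _ /eqP e1 /eqP e2 /eqP[e3 e4 e5]]].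
  move=> /and5P[_ _ _ _ /and5P[_ _ /eqP e1' /eqP e2' /eqP[e3' e4' e5']]].
  by move=> /= e; subst.
rewrite mul2n -addnn -(cardsID rungs (C :\: _)); apply: leq_add.
  by apply: subset_leq_card; apply/subsetP=> t; rewrite inE => /andP[].
apply: (leq_card_inj (f := fun t => (t.2, t.1))); last first.
  by move=> [a b] [c d] _ _ [-> ->].
move=> [[[y1 q1] p1] [[y2 q2] p2]]; rewrite !inE /= -!andbA.
move=> /andP[nl /and5P[ne yq yp pq /and4P[yq2 yp2 pq2 /eqP e]]]; subst q2.
rewrite yq yp pq yq2 yp2 pq2 eqxx /= in nl *.
by have := bf_chain bf yq yq2 ne; rewrite (negbTE nl).
Qed.

Variable g : nat.
Hypothesis g_gt0 : 0 < g.

Definition pos (p : I) (x : V) : nat := #|[set y in nodes S p | lt y x]|.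

Lemma pos_mono p x y : (x, p) \in S -> lt x y -> pos p x < pos p y.
Proof.
move=> xp xy; apply: proper_card; apply/properP; split.
  apply/subsetP=> z; rewrite !inE => /andP[-> zx].
  exact: (strict_trans bf zx xy).
by exists x; rewrite !inE xp ?xy ?strictxx.
Qed.

Lemma pos_inj p : {in nodes S p &, injective (pos p)}.
Proof.
move=> x y; rewrite !inE => xp yp e; apply/eqP/negPn/negP => ne.
by case/orP: (bf_chain bf xp yp ne) => /(pos_mono _); [move/(_ _ xp)|move/(_ _ yp)];
  rewrite e ltnn.
Qed.

Lemma pos_lt p x : (x, p) \in S -> pos p x < L.
Proof.
move=> xp; have [_ pJ] := us_supp us xp; rewrite -(us_card us pJ).
apply: proper_card; apply/properP; split.
  by apply/subsetP=> y; rewrite inE => /andP[].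
by exists x; rewrite !inE ?strictxx ?andbF.
Qed.

Definition block (p : I) (x : V) : nat := pos p x %/ g.

Lemma block_mono p x y : (x, p) \in S -> lt x y -> block p x <= block p y.
Proof. by move=> xp /(pos_mono xp)/ltnW; exact: leq_div2r. Qed.

Lemma card_block p b : #|[set x in nodes S p | block p x == b]| <= g.
Proof.
rewrite -[leqRHS]card_ord -cardsT.
apply: (leq_card_inj (f := fun x => Ordinal (ltn_pmod (pos p x) g_gt0))) => //.
move=> x y; rewrite inE => /andP[xp /eqP bx]; rewrite inE => /andP[yp /eqP yb].
move=> /(congr1 val) /= e; apply: (pos_inj xp yp).
by rewrite (divn_eq (pos p x) g) (divn_eq (pos p y) g) e -!/(block _ _) bx yb.
Qed.

(** Shortness of the segment of p is measured by equality of blocks instead of distance, because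
    equal blocks are what a collision of rungs delivers. *)
Definition fan (q : I) : {set V} :=
  [set x | [exists y, [exists p, [&& (y, q) \in S, (y, p) \in S, (x, p) \in S,
     lt y x, block p y == block p x & p != q]]]].

(** There are [L] choices of y on q, [D] of a path through y, and [g] of a node in the block of
    y. *)
Lemma card_fan q : q \in J -> #|fan q| <= L * D * g.
Proof.
move=> qJ.
pose X := [set t : (V * I) * V | [&& (t.1.1, q) \in S, t.1 \in S, (t.2, t.1.2) \in S
   & block t.1.2 t.1.1 == block t.1.2 t.2]].
apply: (@leq_trans #|X|).
  apply: (@leq_trans #|[set t.2 | t in X]|); last exact: leq_imset_card.
  apply: subset_leq_card; apply/subsetP=> x; rewrite inE.
  move=> /existsP[y /existsP[p /and5P[yq yp xp _ /andP[b _]]]].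
  by apply/imsetP; exists (y, p, x); rewrite // inE /= yq yp xp.
pose Y := [set u in S | (u.1, q) \in S].
rewrite (@card_fibers _ _ fst X Y); last first.
  by move=> t; rewrite !inE => /and4P[-> ->].
apply: (@leq_trans (#|Y| * g)).
  rewrite -sum_nat_const; apply: leq_sum => -[y p] _.
  apply: leq_trans (card_block p (block p y)).
  apply: (leq_card_inj (f := snd)) => [[[y' p'] x]|[[y' p'] x] [[y2 p2] x2]].
    rewrite !inE /= => /andP[/and4P[_ _ xp /eqP b] /eqP[e1 e2]]; subst.
    by rewrite xp b eqxx.
  by rewrite !inE /= => /andP[_ /eqP[-> ->]] /andP[_ /eqP[-> ->]] ->.
rewrite leq_mul2r; apply/orP; right.
rewrite (@card_fibers _ _ fst Y (nodes S q)); last first.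
  by move=> u; rewrite !inE => /andP[].
rewrite -(us_card us qJ) -sum_nat_const; apply: leq_sum => y _.
apply: leq_trans (degD y); apply: (leq_card_inj (f := snd)).
  by move=> [v i]; rewrite !inE /= => /andP[/andP[vi _] /eqP <-].
move=> [v i] [w j]; rewrite !inE /=.
by move=> /andP[_ /eqP ->] /andP[_ /eqP ->] ->.
Qed.

Definition fan_energy : nat :=
  \sum_(q in J) \sum_(q' in J) #|nodes S q' :&: fan q| ^ 2.

(* Along one ladder the rungs are ordered the same way at both ends, so two rungs
   [q], [q'] with equal sums of block numbers lie in equal blocks at both ends.
   The short segments of [p] and [r] between them are then rungs of the ladder
   between [q] and [q'], that is, two nodes of [q'] in the fan of [q]. *)
Lemma rungs_le_fan_energy :
  #|rungs| ^ 2 <= #|J| ^ 2 * (2 * (L %/ g)).+1 * (#|rungs| + 2 * fan_energy).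
Proof.
(* Block numbers are at most L / g, so the sum of two of them takes K + 1 values. *)
pose K := 2 * (L %/ g).
pose sg (t : ((V * I) * I) * ((V * I) * I)) :=
  block t.1.2 t.1.1.1 + block t.2.2 t.2.1.1.
have sgK t : t \in rungs -> sg t < K.+1.
  rewrite !inE => /and4P[/and3P[_ h1 _] /and3P[_ h2 _] _ _].
  rewrite ltnS /K mul2n -addnn; apply: leq_add; apply: leq_div2r;
  exact/ltnW/pos_lt.
pose f t : I * I * 'I_K.+1 := (t.1.2, t.2.2, inord (sg t)).
apply: leq_trans (@collision_bound _ _ f rungs (setX (setX J J) [set: 'I_K.+1]) _) _.
  move=> t; rewrite !inE /= => /and4P[/and3P[_ h1 _] /and3P[_ h2 _] _ _].
  by have [_ ->] := us_supp us h1; have [_ ->] := us_supp us h2.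
rewrite !cardsX cardsT card_ord mulnn leq_mul2l; apply/orP; right.
set C := [set p in _ | _].
pose cy (t : ((V * I) * I) * ((V * I) * I)) := t.1.1.1.
have CP t t' : (t, t') \in C -> [/\ t \in rungs, t' \in rungs, t'.1.2 = t.1.2,
    t'.2.2 = t.2.2 & sg t = sg t'].
  rewrite [in _ \in C]inE => /andP[]; rewrite in_setX => /andP[tR tR'].
  move=> /eqP[-> -> e3]; split=> //.
  by move/(congr1 val): e3; rewrite /= !inordK ?sgK.
(* Collisions with a common foot are trivial by [ladder_inj]; the others occur in two orders, whence
   the factor 2. *)
rewrite -(cardsID [set p | cy p.1 == cy p.2] C); apply: leq_add.
  apply: (leq_card_inj (f := fst)).
    by move=> [t t']; rewrite inE => /andP[/CP[]].
  have key t t' : (t, t') \in C :&: [set p | cy p.1 == cy p.2] -> t = t'.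
    rewrite inE => /andP[/CP[]].
    case: t => [[[y q] p] [[z q1] r]]; case: t' => [[[y' q'] p'] [[z' q1'] r']].
    rewrite !inE /= -!andbA /cy /=.
    move=> /and5P[yq yp pq zq /and4P[zr rq /eqP e yz]].
    move=> /and5P[yq' yp' pq' zq' /and4P[zr' rq' /eqP e' yz']] e1 e2 _ /eqP e3.
    subst; rewrite eq_sym in pq; rewrite eq_sym in pq'.
    rewrite eq_sym in rq; rewrite eq_sym in rq'.
    by have [-> ->] := ladder_inj bf yp zr zr' yq zq yq' zq' yz yz' pq rq pq' rq'.
  by move=> [t t'] [s s'] /key -> /key -> /= ->.
set C1 := C :\: _.
pose CL := [set p in C | lt (cy p.1) (cy p.2)].
have CLle : #|CL| <= fan_energy.
  pose X := [set t : (I * I) * (V * V) |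
    [&& t.1.1 \in J, t.1.2 \in J, t.2.1 \in nodes S t.1.2 :&: fan t.1.1
     & t.2.2 \in nodes S t.1.2 :&: fan t.1.1]].
  have -> : fan_energy = #|X|.
    rewrite (@card_fibers _ _ fst X (setX J J)); last first.
      by move=> t; rewrite !inE => /and4P[-> ->].
    rewrite /fan_energy pair_big /=; apply: eq_big => [[q q']|[q q'] /andP[/= qJ qJ']].
      by rewrite inE.
    have inj : injective (fun u : V * V => ((q, q'), u)) by move=> u v [].
    rewrite -mulnn -cardsX -[LHS](card_imset _ inj).
    apply: eq_card => -[[q1 q1'] [a b]]; rewrite [RHS]inE.
    apply/imsetP/andP => [[[a' b']]|[]].
      by rewrite in_setX => /andP[/= h1 h2] [-> -> -> ->]; rewrite inE eqxx /= qJ qJ' h1 h2.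
    rewrite inE /= => /and4P[_ _ h1 h2] /eqP[e1 e2]; subst.
    by exists (a, b) => //; rewrite in_setX; apply/andP.
  (* The image is (q, q', y', z'). Since p leaves q and reaches y', [fan_uniq] recovers y and p;
     likewise z' gives back z and r. *)
  apply: (leq_card_inj (f := fun t => ((t.1.1.1.2, t.2.1.1.2), (cy t.2, t.2.2.1.1)))).
    move=> [t t']; rewrite inE => /andP[/CP[]].
    case: t => [[[y q] p] [[z q1] r]]; case: t' => [[[y' q'] p'] [[z' q1'] r']].
    rewrite !inE /= -!andbA /cy /=.
    move=> /and5P[yq yp pq zq /and4P[zr rq /eqP e yz]].
    move=> /and5P[yq' yp' pq' zq' /and4P[zr' rq' /eqP e' yz']] e1 e2 e3 yy'.
    subst.
    have [_ ->] := us_supp us yq; have [_ ->] := us_supp us yq'.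
    rewrite yq' zq' /=.
    have zz' : lt z z'.
      rewrite eq_sym in pq; rewrite eq_sym in pq'.
      rewrite eq_sym in rq; rewrite eq_sym in rq'.
      exact: (ladder_mono bf yp yp' zr zr' yq zq yq' zq' yz yz' pq rq pq' rq').
    have b1 := block_mono yp yy'; have b2 := block_mono zr zz'.
    have [ey ez] := addn_eq_mono b1 b2 e3.
    apply/andP; split; apply/existsP.
      exists y; apply/existsP; exists p; rewrite yq yp yp' yy' pq andbT /=.
      exact/eqP.
    exists z; apply/existsP; exists r; rewrite zq zr zr' zz' rq andbT /=.
    exact/eqP.
  move=> [t t'] [s s'] tC sC.
  move: tC; rewrite inE => /andP[/CP[]].
  case: t => [[[y q] p] [[z q1] r]]; case: t' => [[[y' q'] p'] [[z' q1'] r']].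
  rewrite !inE /= -!andbA /cy /=.
  move=> /and5P[yq yp pq zq /and4P[zr rq /eqP e yz]].
  move=> /and5P[yq' yp' pq' zq' /and4P[zr' rq' /eqP e' yz']] e1 e2 e3 yy'.
  move: sC; rewrite inE => /andP[/CP[]].
  case: s => [[[sy sq] sp] [[sz sq1] sr]]; case: s' => [[[sy' sq'] sp'] [[sz' sq1'] sr']].
  rewrite !inE /= -!andbA /cy /=.
  move=> /and5P[syq syp spq szq /and4P[szr srq /eqP se syz]].
  move=> /and5P[syq' syp' spq' szq' /and4P[szr' srq' /eqP se' syz']] se1 se2 se3 syy'.
  move=> [f1 f2 f3 f4]; subst.
  have [-> ->] := fan_uniq bf yq syq yp yp' syp syp' yy' syy' pq spq.
  have zz' : lt z sz'.
    rewrite eq_sym in pq; rewrite eq_sym in pq'.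
    rewrite eq_sym in rq; rewrite eq_sym in rq'.
    exact: (ladder_mono bf yp yp' zr zr' yq zq yq' zq' yz yz' pq rq pq' rq').
  have szz' : lt sz sz'.
    rewrite eq_sym in spq; rewrite eq_sym in spq'.
    rewrite eq_sym in srq; rewrite eq_sym in srq'.
    exact: (ladder_mono bf syp syp' szr szr' syq szq syq' szq' syz syz' spq srq spq' srq').
  by have [-> ->] := fan_uniq bf zq szq zr zr' szr szr' zz' szz' rq srq.
apply: (@leq_trans (2 * #|CL|)); last by rewrite leq_mul2l CLle orbT.
rewrite mul2n -addnn -(cardsID CL C1); apply: leq_add.
  by apply: subset_leq_card; apply/subsetP=> t; rewrite inE => /andP[].
apply: (leq_card_inj (f := fun t => (t.2, t.1))); last first.
  by move=> [a b] [c d] _ _ [-> ->].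
move=> [t t']; rewrite in_setD => /andP[nCL]; rewrite in_setD => /andP[ne tC].
rewrite inE /= in ne; rewrite inE tC /= in nCL.
rewrite inE /=; apply/andP; split.
  move: tC; rewrite [in (t, t') \in C]inE in_setX => /andP[/andP[tR tR'] /eqP e].
  by rewrite [in (t', t) \in C]inE in_setX; apply/andP; split; [apply/andP|apply/eqP].
have [tR tR' e _ _] := CP _ _ tC; move: tR tR'; rewrite !inE.
move=> /and4P[/and3P[_ h1 _] _ _ _] /and4P[/and3P[_ h2 _] _ _ _].
by rewrite e in h2; have := bf_chain bf h1 h2 ne; rewrite (negbTE nCL).
Qed.

End Counting.

(** * Minimal preservers *)

Section Reach.
Variable V : finType.
Implicit Types (E H : {set V * V}) (x y u v : V).

Lemma reachable_refl E x : reachable E x x.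
Proof. exact: connect0. Qed.

Lemma reachable_trans E : transitive (reachable E).
Proof. by move=> y x z; exact: connect_trans. Qed.

Lemma reachable_edge E x y : (x, y) \in E -> reachable E x y.
Proof. by move=> xy; exact: connect1. Qed.

Lemma reachable_sub E H x y : (forall a b, (a, b) \in E -> reachable H a b) ->
  reachable E x y -> reachable H x y.
Proof. by move=> sub; apply: connect_sub => a b; exact: sub. Qed.

Lemma reachable_mono E H x y : E \subset H -> reachable E x y -> reachable H x y.
Proof. by move=> /subsetP sub; apply: reachable_sub => a b /sub/reachable_edge. Qed.

Lemma cut_edge_ends H x y u v : reachable H x y ->
  ~~ reachable (H :\ (u, v)) x y -> reachable H x u /\ reachable H v y.
Proof.
move=> /connectP[p]; elim: p x => [|a p IH] x /=.
  by move=> _ ->; rewrite reachable_refl.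
move=> /andP[xa pth] yE nr.
have ay : reachable H a y by apply/connectP; exists p.
have [e|ne] := eqVneq (x, a) (u, v).
  by case: e ay => -> ->; rewrite reachable_refl.
have [|au vy] := IH a pth yE.
  apply: contra nr => ay'; apply: (reachable_trans _ ay').
  by apply: reachable_edge; rewrite !inE ne.
by split=> //; apply: (reachable_trans (reachable_edge xa) au).
Qed.

End Reach.

Section Minimal.
Variables (V : finType) (P H : {set V * V}).
Implicit Types (x y z u v : V) (e i j : V * V).

Definition cuts e i : bool :=
  [&& i \in P, reachable H i.1 i.2 & ~~ reachable (H :\ e) i.1 i.2].

Hypothesis minH : forall e, e \in H -> exists i, cuts e i.

Definition crossing_edges : {set V * V} := [set e in H | ~~ reachable H e.2 e.1].

Definition assign e : V * V := odflt e [pick i | cuts e i].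

Lemma assignP e : e \in H -> cuts e (assign e).
Proof.
rewrite /assign => /minH[i ei]; case: pickP => [//|/(_ i)].
by rewrite ei.
Qed.

Definition cut_system : {set V * (V * V)} :=
  [set (e.2, assign e) | e in crossing_edges].

Lemma cut_systemP v i : (v, i) \in cut_system ->
  exists u, [/\ (u, v) \in H, ~~ reachable H v u, assign (u, v) = i & cuts (u, v) i].
Proof.
case/imsetP=> -[u w]; rewrite inE /= => /andP[eH nr] [-> ->].
by exists u; split=> //; exact: assignP.
Qed.

(** Removing e' destroys every path of the pair, in particular any that goes through e. So e' cuts
    either the part before u, and v' reaches u, or the part after v, and v reaches u'. *)
Lemma cuts_order u v u' v' i : cuts (u, v) i -> cuts (u', v') i ->
  (u, v) \in H -> (u, v) != (u', v') ->
  reachable H v u' \/ reachable H v' u.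
Proof.
move=> /and3P[_ r c] /and3P[_ _ c'] eH ne.
have [su vt] := cut_edge_ends r c; have [su' vt'] := cut_edge_ends r c'.
have [h1|h1] := boolP (reachable (H :\ (u', v')) i.1 u); last first.
  by right; have [_ ->] := cut_edge_ends su h1.
have [h2|h2] := boolP (reachable (H :\ (u', v')) v i.2); last first.
  by left; have [->] := cut_edge_ends vt h2.
case/negP: c'; apply: (reachable_trans h1); apply: reachable_trans h2.
by apply: reachable_edge; rewrite !inE ne.
Qed.

(** Of two edges with the same head that cut the same pair, one would have its tail reachable from
    that head, and so would lie inside a strong component. *)
Lemma card_cut_system : #|cut_system| = #|crossing_edges|.
Proof.
apply: card_in_imset => -[u v] [u' v']; rewrite !inE /= => /andP[eH nr] /andP[eH' nr'].
move=> [vv aa]; subst v'; apply/eqP/negPn/negP => ne.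
have c := assignP eH; have c' := assignP eH'; rewrite -aa in c'.
by case: (cuts_order c c' eH ne) => h; [case/negP: nr'|case/negP: nr].
Qed.

(** Let (w, y) and (w', y) be the edges into y assigned to i and j. If i and j differ, the route
    from the source of i through x, z, w' and y to its target avoids (w, y), although (w, y) cuts i:
    a segment that used it would yield a path from y to z, to w' or to w, all of which are
    excluded. *)
Lemma cut_system_bridge_free : bridge_free (reachable H) cut_system.
Proof.
have tr := @reachable_trans V H.
split; first exact: reachable_refl.
- exact: tr.
- move=> i v v' /cut_systemP[u [eH nr _ c]] /cut_systemP[u' [eH' nr' _ c']] ne.
  have ne' : (u, v) != (u', v') by apply: contra ne => /eqP[_ ->].
  rewrite /strict.
  case: (cuts_order c c' eH ne') => h; apply/orP; [left|right].
    rewrite (tr _ _ _ h (reachable_edge eH')) /=; apply: contra nr' => h'.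
    exact: (tr _ _ _ h' h).
  rewrite (tr _ _ _ h (reachable_edge eH)) /=; apply: contra nr => h'.
  exact: (tr _ _ _ h' h).
move=> i j x z y xi yi zj yj xz /andP[zy nyz].
have [ux [exH nrx _ cx]] := cut_systemP xi.
have [w [eH nr ai c]] := cut_systemP yi.
have [uz [ezH nrz _ cz]] := cut_systemP zj.
have [w' [eH' nr' aj c']] := cut_systemP yj.
have [//|ij] := eqVneq i j.
have ww : (w, y) != (w', y) by apply: contra ij => /eqP e; rewrite -ai -aj e.
(* Both the edge into z and (w', y) cut j; in the opposite order y would reach z. *)
have zw' : reachable H z w'.
  have ne : (uz, z) != (w', y).
    by apply: contra nyz => /eqP[_ ->]; exact: reachable_refl.
  case: (cuts_order cz c' ezH ne) => // h; case/negP: nyz.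
  exact: (tr _ _ _ h (reachable_edge ezH)).
have [iP r cc] := and3P c; have [_ yt] := cut_edge_ends r cc; case/negP: cc.
have [_ _ ccx] := and3P cx; have [sux xt] := cut_edge_ends r ccx.
have sx : reachable (H :\ (w, y)) i.1 x.
  apply/negPn/negP => h; have sx := tr _ _ _ sux (reachable_edge exH).
  have [_ yx] := cut_edge_ends sx h; case/negP: nyz; exact: (tr _ _ _ yx xz).
have xw' : reachable (H :\ (w, y)) x w'.
  apply/negPn/negP => h.
  by have [_ yw'] := cut_edge_ends (tr _ _ _ xz zw') h; case/negP: nr'.
have w'y : reachable (H :\ (w, y)) w' y.
  by apply: reachable_edge; rewrite !inE eq_sym ww.
have yt' : reachable (H :\ (w, y)) y i.2.
  by apply/negPn/negP => h; have [yw _] := cut_edge_ends yt h; case/negP: nr.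
apply: (reachable_trans sx); apply: (reachable_trans xw').
exact: (reachable_trans w'y).
Qed.

End Minimal.

(** Take for [f v] a predecessor closer to the root. As [r] is constant along edges, the predecessor
    has the same root, and induction on the distance applies. *)
Lemma spanning_forest (T : finType) (E : rel T) (r : T -> T) :
  (forall v, connect E (r v) v) -> (forall a b, E a b -> r a = r b) ->
  exists f : T -> T, forall v, connect [rel x y | E x y && (x == f y)] (r v) v.
Proof.
move=> rE Er.
pose Q v k := [exists p : k.-tuple T, path E (r v) p && (last (r v) p == v)].
have exQ v : exists k, Q v k.
  have /connectP[p pth e] := rE v; exists (size p).
  by apply/existsP; exists (in_tuple p); rewrite pth -e /=.
pose d v := ex_minn (exQ v).
pose f v := odflt v [pick x | E x v && (d x < d v)].
exists f => v; have [k] := ubnP (d v); elim: k v => // k IH v dk.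
have : Q v (d v) by rewrite /d; case: ex_minnP.
move=> /existsP[[p /= /eqP sp] /andP[pth /eqP pv]].
case: (lastP p) sp pth pv => [_ _ /= -> //|p1 x].
rewrite size_rcons rcons_path last_rcons => sp /andP[pth Ex] xv; subst x.
pose y := last (r v) p1.
have ry : r y = r v by exact: Er.
have dy : d y < d v.
  rewrite -sp /d; case: ex_minnP => m _ min; rewrite ltnS; apply: min.
  by apply/existsP; exists (in_tuple p1); rewrite /= ry pth eqxx.
have [Ef df] : E (f v) v /\ d (f v) < d v.
  rewrite /f; case: pickP => [x /andP[]//|/(_ y)]; by rewrite Ex dy.
have cf := IH (f v) (leq_trans df dk).
rewrite -(Er _ _ Ef); apply: (connect_trans cf); apply: connect1.
by rewrite /= Ef eqxx.
Qed.

(** * Edges inside strong components *)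

Section Inner.
Variables (V : finType) (P H : {set V * V}).
Hypothesis minH : forall e, e \in H -> exists i, cuts P H e i.

(* An edge inside a strong component that lies neither on the chosen out-tree
   nor on the chosen in-tree of the component is redundant. *)
Lemma card_inner_edges : #|[set e in H | reachable H e.2 e.1]| <= 2 * #|V|.
Proof.
pose E : rel V := [rel a b | ((a, b) \in H) && reachable H b a].
pose scc v x := reachable H v x && reachable H x v.
pose r v := odflt v [pick x | scc v x].
have rP v : scc v (r v).
  rewrite /r; case: pickP => [//|/(_ v)]; by rewrite /scc reachable_refl.
have sccr a b : scc a b -> r a = r b.
  move=> /andP[ab ba]; have e : scc a =1 scc b.
    move=> x; apply/andP/andP => -[h1 h2]; split.
    + exact: (reachable_trans ba h1).
    + exact: (reachable_trans h2 ab).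
    + exact: (reachable_trans ab h1).
    + exact: (reachable_trans h2 ba).
  rewrite /r (eq_pick e); case: pickP => [//|/(_ b)].
  by rewrite /scc reachable_refl.
have conE x y : reachable H x y -> reachable H y x -> connect E x y.
  move=> /connectP[p]; elim: p x => [|a p IH] x /=; first by move=> _ ->.
  move=> /andP[xa pth] yE yx.
  have ay : reachable H a y by apply/connectP; exists p.
  have xa' : reachable H x a by exact: reachable_edge.
  apply: (@connect_trans _ _ a); last exact: IH (reachable_trans yx xa').
  by apply: connect1; apply/andP; split=> //; exact: (reachable_trans ay yx).
have Er a b : E a b -> r a = r b.
  by move=> /andP[ab ba]; apply: sccr; rewrite /scc ba andbT; exact: reachable_edge.
have [f fP] : exists f, forall v, connect [rel x y | E x y && (x == f y)] (r v) v.
  by apply: spanning_forest => // v; have /andP[? ?] := rP v; exact: conE.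
(* The in-tree is a spanning forest of the reversed graph. *)
have [g gP] : exists g, forall v, connect [rel x y | E y x && (x == g y)] (r v) v.
  apply: (@spanning_forest _ [rel x y | E y x]) => [v|a b /= /Er//].
  by rewrite connect_rev /=; have /andP[? ?] := rP v; exact: conE.
apply: (@leq_trans #|[set (f v, v) | v in V] :|: [set (v, g v) | v in V]|).
  apply: subset_leq_card; apply/subsetP=> -[a b]; rewrite !inE /= => /andP[eH ba].
  apply/negPn/negP; rewrite negb_or => /andP[nf ng].
  have [i /and3P[_ ri ci]] := minH eH; case/negP: ci.
  apply: reachable_sub ri => x y xy.
  have [e|ne] := eqVneq (x, y) (a, b); last first.
    by apply: reachable_edge; rewrite !inE ne.
  case: e => -> ->.
  have ab : reachable H a b by exact: reachable_edge.
  have rab : r a = r b by apply: sccr; rewrite /scc ab.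
  (* Detour around (a, b): from a up the in-tree to the root of the component, then down the
     out-tree to b. *)
  apply: (@reachable_trans _ _ (r a)).
    have := gP a; rewrite connect_rev /=; apply: connect_sub => u v /=.
    move=> /andP[/andP[uv _] /eqP e]; apply: connect1; rewrite /= !inE uv andbT.
    by apply: contraNneq ng => -[<- <-]; rewrite e; apply/imsetP; exists u.
  rewrite rab; have := fP b; apply: connect_sub => u v /=.
  move=> /andP[/andP[uv _] /eqP e]; apply: connect1; rewrite /= !inE uv andbT.
  by apply: contraNneq nf => -[<- <-]; rewrite e; apply/imsetP; exists v.
apply: (leq_trans (leq_card_setU _ _)); rewrite mul2n -addnn.
by apply: leq_add; exact: leq_imset_card.
Qed.

End Inner.

(** * The greedy algorithm on the random access machine *)

Local Notation "c1 ;; c2" := (ISeq c1 c2) (at level 90, right associativity).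

Definition runs (c : ram_prog) (s : ram_state) (T : nat) (Q : ram_state -> Prop) :=
  exists k s', [/\ ram_exec c s k s', k <= T & Q s'].

Lemma runs_post c s T (Q Q' : ram_state -> Prop) : (forall s', Q s' -> Q' s') ->
  runs c s T Q -> runs c s T Q'.
Proof. by move=> QQ [k [s' [e kT q]]]; exists k, s'; split=> //; exact: QQ. Qed.

Lemma runs_seq c1 c2 s T1 T2 Q1 Q : runs c1 s T1 Q1 ->
  (forall s', Q1 s' -> runs c2 s' T2 Q) -> runs (c1 ;; c2) s (T1 + T2) Q.
Proof.
move=> [k1 [s1 [e1 kT1 q1]]] /(_ _ q1)[k2 [s2 [e2 kT2 q2]]].
by exists (k1 + k2), s2; split=> //; [exact: ExecSeq e1 e2 | exact: leq_add].
Qed.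

Fixpoint loop_free (c : ram_prog) : bool :=
  match c with
  | ISeq c1 c2 => loop_free c1 && loop_free c2
  | IIf _ c1 c2 => loop_free c1 && loop_free c2
  | IWhile _ _ => false
  | _ => true
  end.

(** Only an upper bound is needed, so a conditional is charged for both branches. *)
Fixpoint cost (c : ram_prog) : nat :=
  match c with
  | ISeq c1 c2 => cost c1 + cost c2
  | IIf _ c1 c2 => (cost c1 + cost c2).+1
  | _ => 1
  end.

Fixpoint eval (c : ram_prog) (s : ram_state) : ram_state :=
  match c with
  | ISkip => s
  | IConst r v => set_reg s r v
  | IAdd r a b => set_reg s r (reg s a + reg s b)
  | ISub r a b => set_reg s r (reg s a - reg s b)
  | ILoad r a => set_reg s r (cell s (reg s a))
  | IStore a r => set_mem s (reg s a) (reg s r)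
  | ISeq c1 c2 => eval c2 (eval c1 s)
  | IIf r c1 c2 => if reg s r == 0 then eval c2 s else eval c1 s
  | IWhile _ _ => s
  end.

Lemma runs_eval c s (Q : ram_state -> Prop) :
  loop_free c -> Q (eval c s) -> runs c s (cost c) Q.
Proof.
move=> lf q; suff [k kT e] : exists2 k, k <= cost c & ram_exec c s k (eval c s).
  by exists k, (eval c s).
elim: c s lf {q} => /=; try by move=> *; exists 1 => //; constructor.
- move=> c1 IH1 c2 IH2 s /andP[/(IH1 s)[k1 h1 e1] /(IH2 (eval c1 s))[k2 h2 e2]].
  by exists (k1 + k2); [exact: leq_add | exact: ExecSeq e1 e2].
- move=> r c1 IH1 c2 IH2 s /andP[/(IH1 s)[k1 h1 e1] /(IH2 s)[k2 h2 e2]].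
  have [r0|r0] := eqVneq (reg s r) 0.
    by exists k2.+1; [rewrite ltnS; apply: leq_trans h2 (leq_addl _ _)|exact: ExecIfF].
  by exists k1.+1; [rewrite ltnS; apply: leq_trans h1 (leq_addr _ _)|exact: ExecIfT].
Qed.

(* Register 1 holds the constant 1 throughout. *)
Definition Loop (r : nat) (c : ram_prog) : ram_prog := IWhile r (c ;; ISub r r 1).

(** The invariant is indexed by the number of iterations left; [Inv k] speaks of the state after the
    decrement that [Loop] appends to the body. *)
Lemma runs_loop r c T (Inv : nat -> ram_state -> Prop) :
  (forall k s, Inv k s -> reg s r = k) ->
  (forall k s, Inv k.+1 s -> runs c s T (fun s' =>
     Inv k (set_reg s' r (reg s' r - reg s' 1)))) ->
  forall k s, Inv k s -> runs (Loop r c) s (k * (T + 2)).+1 (Inv 0).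
Proof.
move=> Invr step; elim=> [|k IH] s I.
  by exists 1, s; split=> //; apply: ExecWhileF; exact: Invr.
have [k1 [s1 [e1 h1 I1]]] := step _ _ I.
have [k2 [s2 [e2 h2 I2]]] := IH _ I1.
exists (k1 + 1 + k2).+1, s2; split=> //; last by rewrite mulSn; lia.
apply: ExecWhileT e2; first by rewrite (Invr _ _ I).
by apply: (ExecSeq e1); constructor.
Qed.

Definition keeps (L : seq nat) (s0 s : ram_state) : Prop :=
  forall r, r \notin L -> reg s r = reg s0 r.

Lemma keeps_trans L s1 s0 s : keeps L s0 s1 -> keeps L s1 s -> keeps L s0 s.
Proof. by move=> k1 k2 r rL; rewrite k2 // k1. Qed.

Lemma keeps_sub L L' s0 s : {subset L <= L'} -> keeps L s0 s -> keeps L' s0 s.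
Proof. by move=> sub k r rL; apply: k; apply: contra rL; exact: sub. Qed.

Lemma keeps_set L s0 s r v : r \in L -> keeps L s0 s -> keeps L s0 (set_reg s r v).
Proof.
move=> rL k r' r'L; rewrite /= /update; case: eqP => [e|_]; last exact: k.
by rewrite e rL in r'L.
Qed.

(** Register 20 is always zero, so adding it copies a register. *)
Definition Move (r a : nat) : ram_prog := IAdd r a 20.
Definition Incr (r : nat) : ram_prog := IAdd r r 1.

(* Register conventions: 0 holds n, 1 holds 1, 20 holds 0, 2 holds the base
   address of the scratch array of marks, 21 the base address of the demands. *)
Definition ready (n : nat) (s : ram_state) : Prop :=
  [/\ reg s 0 = n, reg s 1 = 1, reg s 2 = (2 * (n * n)).+1,
      reg s 20 = 0 & reg s 21 = (n * n).+1].

Lemma ready_keeps n L s0 s : all (fun r => r \notin L) [:: 0; 1; 2; 20; 21] ->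
  keeps L s0 s -> ready n s0 -> ready n s.
Proof.
move=> /and5P[h0 h1 h2 h20 /andP[h21 _]] k [e0 e1 e2 e20 e21].
by split; rewrite k.
Qed.

Definition Clear : ram_prog :=
  (Move 9 2 ;; Move 6 0) ;; Loop 6 (IStore 9 20 ;; Incr 9) ;; IStore 19 1.

Section Phases.
Variable n : nat.
Local Notation B := (2 * (n * n)).+1.

Lemma runs_clear i s0 : ready n s0 -> reg s0 19 = B + i -> i < n ->
  runs Clear s0 (2 + ((n * 4).+1 + 1)) (fun s =>
    [/\ keeps [:: 6; 9] s0 s, forall a, a < B -> cell s a = cell s0 a
      & forall w, w < n -> cell s (B + w) = (w == i)]).
Proof.
move=> rd e19 ltin; have [e0 e1 e2 e20 e21] := rd.
pose Inv k s := [/\ keeps [:: 6; 9] s0 s, reg s 6 = k,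
  exists2 j, j + k = n & reg s 9 = B + j /\ (forall w, w < j -> cell s (B + w) = 0)
  & forall a, a < B -> cell s a = cell s0 a].
apply: (@runs_seq _ _ _ _ _ (Inv n)).
  apply: runs_eval => //; split=> //.
  - by do 2! apply: keeps_set => //.
  - by rewrite /= /update /= e0 e20 addn0.
  - by exists 0 => //; split=> //; rewrite /= /update /= e2 e20.
move=> s I; apply: (@runs_seq _ _ _ _ _ (Inv 0)).
  apply: (@runs_loop 6 (IStore 9 20 ;; Incr 9) 2 Inv) I; first by move=> k s' [].
  move=> k s' [ks e6 [j jk [e9 z]] fr]; apply: runs_eval => //; split.
  - by do 2! apply: keeps_set => //.
  - by rewrite /= /update /= e6 (ks 1) // e1 subn1.
  - exists j.+1; first by rewrite addSnnS.
    split; first by rewrite /= /update /= e9 (ks 1) // e1; lia.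
    move=> w; rewrite ltnS leq_eqVlt /= /update e9 (ks 20) // e20 eqn_add2l.
    by case: eqP => //= _ /z.
  - move=> a aB; rewrite /= /update e9 -fr //; case: eqP => // e; lia.
move=> s1 [ks e6 [j]]; rewrite addn0 => -> [e9 z] fr; apply: runs_eval => //; split=> //.
- move=> a aB; rewrite /= /update (ks 19) // e19 -fr //; case: eqP => // e; lia.
- move=> w wn; rewrite /= /update (ks 19) // e19 (ks 1) // e1 eqn_add2l z //;
  by case: eqP.
Qed.

Definition mark (s : ram_state) (w : nat) : bool := cell s (B + w) != 0.
Definition edge (s : ram_state) (u v : nat) : bool := cell s (u * n + v).+1 != 0.

Lemma cell_index_lt u v : u < n -> v < n -> u * n + v < n * n.
Proof.
move=> un vn; apply: (@leq_trans (u.+1 * n)); first by rewrite mulSn addnC ltn_add2r.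
by rewrite leq_mul2r un orbT.
Qed.

Lemma cell_index_lt_base u v : u < n -> v < n -> (u * n + v).+1 < B.
Proof. by move=> un vn; have := cell_index_lt un vn; rewrite ltnS; lia. Qed.

(** Register 7 addresses the current matrix entry, 8 the mark of its tail and 9 the mark of its
    head. *)
Definition Probe : ram_prog :=
  ILoad 10 8 ;; ILoad 11 7 ;; IIf 10 (IIf 11 (IStore 9 1) ISkip) ISkip ;;
  Incr 7 ;; Incr 9.

Definition Row : ram_prog := (Move 9 2 ;; Move 6 0) ;; Loop 6 Probe ;; Incr 8.

Definition Relax : ram_prog := (Move 7 1 ;; Move 8 2 ;; Move 5 0) ;; Loop 5 Row.

Definition Rounds : ram_prog := Move 4 0 ;; Loop 4 Relax.

Section Marks.
Variable Q : nat -> Prop.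

(** [Q] stands for reachability from the source: it is an upper bound for the marks that every pass
    maintains. *)
Definition closed_marks (s : ram_state) : Prop :=
  (forall u v, u < n -> v < n -> Q u -> edge s u v -> Q v) /\
  (forall w, w < n -> mark s w -> Q w).

Lemma runs_row u s0 : ready n s0 -> closed_marks s0 -> u < n ->
  reg s0 7 = (u * n).+1 -> reg s0 8 = B + u ->
  runs Row s0 (2 + ((n * (cost Probe + 2)).+1 + 1)) (fun s =>
    [/\ keeps [:: 6; 7; 8; 9; 10; 11] s0 s,
        (reg s 7 = (u.+1 * n).+1) /\ (reg s 8 = B + u.+1),
        forall a, a < B -> cell s a = cell s0 a,
        (forall w, w < n -> mark s0 w -> mark s w) /\
        (forall w, w < n -> mark s w -> Q w)
      & forall v, v < n -> mark s0 u -> edge s0 u v -> mark s v]).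
Proof.
move=> rd [closed sound] un e7 e8; have [e0 e1 e2 e20 e21] := rd.
pose Inv k s := [/\ keeps [:: 6; 7; 9; 10; 11] s0 s,
  reg s 6 = k /\ (forall a, a < B -> cell s a = cell s0 a),
  exists2 j, j + k = n & [/\ reg s 9 = B + j, reg s 7 = (u * n + j).+1
    & forall v, v < j -> mark s0 u -> edge s0 u v -> mark s v],
  forall w, w < n -> mark s0 w -> mark s w
  & forall w, w < n -> mark s w -> Q w].
apply: (@runs_seq _ _ _ _ _ (Inv n)).
  apply: runs_eval => //; split=> //.
  - by do 2! apply: keeps_set => //.
  - by split; rewrite // /= /update /= e0 e20 addn0.
  - by exists 0 => //; rewrite /= /update /= e2 e20 e7 !addn0.
move=> s I; apply: (@runs_seq _ _ _ _ _ (Inv 0)).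
  apply: (@runs_loop 6 Probe _ Inv) I; first by move=> k s' [_ []].
  move=> k s' [ks [e6 fr] [j jk [e9 e7' done]] mono snd]; apply: runs_eval => //.
  have jn : j < n by lia.
  have e8' : reg s' 8 = B + u by rewrite (ks 8).
  have e1' : reg s' 1 = 1 by rewrite (ks 1).
  have edgeE : edge s' u j = edge s0 u j by rewrite /edge fr ?cell_index_lt_base.
  have -> : eval Probe s' = set_reg (set_reg
      (let s2 := set_reg (set_reg s' 10 (cell s' (B + u))) 11 (cell s' (u * n + j).+1) in
       if mark s' u && edge s' u j then set_mem s2 (B + j) 1 else s2)
      7 (u * n + j).+2) 9 (B + j).+1.
    rewrite /Probe /= /update /= e8' e7' /mark /edge.
    case: (cell s' (B + u) =P 0) => [_|_] /=.
      by rewrite /set_reg /= /update /= e7' e9 e1' !addn1.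
    case: (cell s' (u * n + j).+1 =P 0) => [_|_] /=.
      by rewrite /set_reg /= /update /= e7' e9 e1' !addn1.
    by rewrite /set_reg /set_mem /= /update /= e7' e9 e1' !addn1.
  set s2 := set_reg (set_reg s' 10 _) 11 _; cbv zeta.
  have ks2 : keeps [:: 6; 7; 9; 10; 11] s0 s2 by do 2! apply: keeps_set => //.
  set b := mark s' u && edge s' u j.
  set s3 := (if b then _ else _).
  have ks3 : keeps [:: 6; 7; 9; 10; 11] s0 s3 by rewrite /s3; case: ifP.
  have c3 a : cell s3 a = if b && (a == B + j) then 1 else cell s' a.
    by rewrite /s3; case: ifP.
  have e63 : reg s3 6 = k.+1 by rewrite /s3; case: ifP.
  have e13 : reg s3 1 = 1 by rewrite ks3.
  have m3 w : mark s3 w = (b && (w == j)) || mark s' w.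
    by rewrite /mark c3 eqn_add2l; case: (b && _).
  split.
  - by do 3! apply: keeps_set => //.
  - split=> [|a aB]; first by rewrite /= /update /= e63 e13 subn1.
    rewrite /= c3 -fr //; case: (a =P B + j) => [e|_]; last by rewrite andbF.
    by move: aB; rewrite e ltnNge leq_addr.
  - exists j.+1; first by rewrite addSnnS.
    split; [by rewrite /= /update /= addnS|by rewrite /= /update /= addnS|].
    move=> v; rewrite ltnS leq_eqVlt => /orP[/eqP -> mu ed|vj mu ed].
      by rewrite -[mark _ _]/(mark s3 j) m3 /b edgeE ed mono // eqxx.
    by rewrite -[mark _ _]/(mark s3 v) m3 (done v vj mu ed) orbT.
  - by move=> w wn mw; rewrite -[mark _ _]/(mark s3 w) m3 mono ?orbT.
  - move=> w wn; rewrite -[mark _ _]/(mark s3 w) m3 => /orP[/andP[/andP[mu ed] /eqP ->]|].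
      by apply: (closed u); rewrite -?edgeE //; exact: snd.
    exact: snd.
move=> s1 [ks [e6 fr] [j]]; rewrite addn0 => -> [e9 e7' done] mono snd.
apply: runs_eval => //; split=> //.
- apply: keeps_set => //; apply: keeps_sub ks => r.
  by rewrite !inE => /or4P[->|->|->|/orP[]->]; rewrite ?orbT.
- by rewrite /= /update /= e7' (ks 8) // e8 (ks 1) // e1 mulSn addnC addn1 addnS.
Qed.

Lemma edge_frame s s0 u v : (forall a, a < B -> cell s a = cell s0 a) ->
  u < n -> v < n -> edge s u v = edge s0 u v.
Proof. by move=> fr un vn; rewrite /edge fr // cell_index_lt_base. Qed.

Lemma closed_frame s s0 : (forall a, a < B -> cell s a = cell s0 a) ->
  closed_marks s0 -> (forall w, w < n -> mark s w -> Q w) -> closed_marks s.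
Proof.
move=> fr [cl _] snd; split=> // u v un vn; rewrite (edge_frame fr) //.
exact: cl.
Qed.

Definition row_time : nat := 2 + ((n * (cost Probe + 2)).+1 + 1).

Lemma runs_relax s0 : ready n s0 -> closed_marks s0 ->
  runs Relax s0 (3 + (n * (row_time + 2)).+1) (fun s =>
    [/\ keeps [:: 5; 6; 7; 8; 9; 10; 11] s0 s,
        forall a, a < B -> cell s a = cell s0 a,
        forall w, w < n -> mark s0 w -> mark s w,
        closed_marks s
      & forall u v, u < n -> v < n -> mark s0 u -> edge s0 u v -> mark s v]).
Proof.
move=> rd cl; have [e0 e1 e2 e20 e21] := rd.
pose Inv k s := [/\ keeps [:: 5; 6; 7; 8; 9; 10; 11] s0 s,
  reg s 5 = k /\ (forall a, a < B -> cell s a = cell s0 a),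
  exists2 j, j + k = n & [/\ reg s 7 = (j * n).+1, reg s 8 = B + j
    & forall u v, u < j -> v < n -> mark s0 u -> edge s0 u v -> mark s v],
  forall w, w < n -> mark s0 w -> mark s w
  & closed_marks s].
apply: (@runs_seq _ _ _ _ _ (Inv n)).
  apply: runs_eval => //; split=> //.
  - by do 3! apply: keeps_set => //.
  - by split; rewrite // /= /update /= e0 e20 addn0.
  - by exists 0 => //; rewrite /= /update /= e1 e2 e20 !addn0.
move=> s I; apply: (@runs_post _ _ _ (Inv 0)).
  move=> s1 [ks [_ fr] [j]]; rewrite addn0 => -> [_ _ done] mono cl1; split=> //.
apply: (@runs_loop 5 Row _ Inv) I; first by move=> k s' [_ []].
move=> k s' [ks [e5 fr] [j jk [e7 e8 done]] mono cl1].
have jn : j < n by lia.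
have rd' : ready n s' by apply: ready_keeps ks rd.
apply: runs_post (runs_row rd' cl1 jn e7 e8).
move=> s1 [k1 [e7' e8'] fr1 [mono1 snd1] step1].
have fr01 a : a < B -> cell s1 a = cell s0 a by move=> aB; rewrite fr1 // fr.
split=> //.
- apply: keeps_set => //; apply: keeps_trans ks _; apply: keeps_sub k1 => r rL.
  by rewrite inE rL orbT.
- by split=> //; rewrite /= /update /= (k1 5) // e5 (k1 1) // (ks 1) // e1 subn1.
- exists j.+1; first by rewrite addSnnS.
  split; rewrite // => u v; rewrite ltnS leq_eqVlt => /orP[/eqP ->|uj] vn mu ed.
    by apply: step1; rewrite ?(edge_frame fr) //; exact: mono.
  by apply: mono1 => //; exact: done uj vn mu ed.
- by move=> w wn mw; apply: mono1 => //; exact: mono.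
- exact: (@closed_frame _ s0 fr01 cl).
Qed.

(** The lower bound for the marks after [j] passes. A pass works in place and may already propagate
    marks it has just set, so the marks are only known to lie between [level] and [Q]. *)
Fixpoint level (s0 : ram_state) (j w : nat) : Prop :=
  match j with
  | 0 => mark s0 w
  | j'.+1 => exists u, [/\ u < n, level s0 j' u & (u == w) || edge s0 u w]
  end.

Definition relax_time : nat := 3 + (n * (row_time + 2)).+1.

Lemma runs_rounds s0 : ready n s0 -> closed_marks s0 ->
  runs Rounds s0 (1 + (n * (relax_time + 2)).+1) (fun s =>
    [/\ keeps [:: 4; 5; 6; 7; 8; 9; 10; 11] s0 s,
        forall a, a < B -> cell s a = cell s0 a,
        closed_marks s & forall w, w < n -> level s0 n w -> mark s w]).
Proof.
move=> rd cl; have [e0 e1 e2 e20 e21] := rd.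
pose Inv k s := [/\ keeps [:: 4; 5; 6; 7; 8; 9; 10; 11] s0 s, reg s 4 = k,
  forall a, a < B -> cell s a = cell s0 a, closed_marks s
  & exists2 j, j + k = n & forall w, w < n -> level s0 j w -> mark s w].
apply: (@runs_seq _ _ _ _ _ (Inv n)).
  apply: runs_eval => //; split=> //.
  - by apply: keeps_set.
  - by rewrite /= /update /= e0 e20 addn0.
  - by exists 0.
move=> s I; apply: (@runs_post _ _ _ (Inv 0)).
  by move=> s1 [ks _ fr cl1 [j]]; rewrite addn0 => -> done; split.
apply: (@runs_loop 4 Relax _ Inv) I; first by move=> k s' [].
move=> k s' [ks e4 fr cl1 [j jk done]].
have rd' : ready n s' by apply: ready_keeps ks rd.
apply: runs_post (runs_relax rd' cl1).
move=> s1 [k1 fr1 mono1 cl2 step1].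
have fr01 a : a < B -> cell s1 a = cell s0 a by move=> aB; rewrite fr1 // fr.
split=> //.
- apply: keeps_set => //; apply: keeps_trans ks _; apply: keeps_sub k1 => r rL.
  by rewrite inE rL orbT.
- by rewrite /= /update /= (k1 4) // e4 (k1 1) // (ks 1) // e1 subn1.
- exists j.+1; first by rewrite addSnnS.
  move=> w wn /= [u [un lu /orP[/eqP uw|ed]]].
    by apply: mono1 => //; rewrite -uw; exact: done.
  by apply: (step1 u w un wn); [exact: done un lu | rewrite (edge_frame fr)].
Qed.

End Marks.

Definition rounds_time : nat := 1 + (n * (relax_time + 2)).+1.

Definition edges (s : ram_state) : {set 'I_n * 'I_n} :=
  [set e : 'I_n * 'I_n | edge s e.1 e.2].

Lemma level_path s0 (i : 'I_n) (p : seq 'I_n) (j : nat) : mark s0 i ->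
  path [rel x y | (x, y) \in edges s0] i p -> size p <= j -> level s0 j (last i p).
Proof.
move=> mi; elim/last_ind: p j => [|p x IH] j.
  move=> _ _ /=; elim: j => //= j IHj; exists i; split=> //.
  by rewrite eqxx.
rewrite rcons_path size_rcons last_rcons => /andP[pth ex].
case: j => // j sj; exists (last i p); split=> //; first exact: IH.
by rewrite /= inE /= in ex; rewrite ex orbT.
Qed.

Lemma runs_mark_reachable (i : 'I_n) s0 : ready n s0 -> reg s0 19 = B + i ->
  runs (Clear ;; Rounds) s0 (2 + ((n * 4).+1 + 1) + rounds_time) (fun s =>
    [/\ keeps [:: 4; 5; 6; 7; 8; 9; 10; 11] s0 s,
        forall a, a < B -> cell s a = cell s0 a
      & forall o : 'I_n, mark s o = reachable (edges s0) i o]).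
Proof.
move=> rd e19; apply: runs_seq (runs_clear rd e19 (ltn_ord i)) _.
move=> s [ks fr cl].
have rd' : ready n s by apply: ready_keeps ks rd.
pose Q w := exists2 o : 'I_n, val o = w & reachable (edges s0) i o.
have eE : edges s = edges s0.
  by apply/setP=> e; rewrite !inE (edge_frame fr).
have clQ : closed_marks Q s.
  split=> [u v un vn [o ou ro] ed|w wn]; last first.
    rewrite /mark cl //; case: (w =P i) => // -> _; exists i => //.
    exact: connect0.
  exists (Ordinal vn) => //; apply: (connect_trans ro); apply: connect1.
  by rewrite /= inE /= ou -(edge_frame fr).
apply: runs_post (runs_rounds rd' clQ) => s1 [k1 fr1 [_ snd] done]; split.
- apply: (@keeps_trans _ s).
    by apply: keeps_sub ks => r; rewrite !inE => /orP[]->; rewrite ?orbT.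
  by [].
- by move=> a aB; rewrite fr1 // fr.
move=> o; apply/idP/idP => [mo|].
  by have [o' /val_inj <-] := snd o (ltn_ord o) mo.
(* A simple path has fewer than n edges, so n passes reach its end. *)
move=> /connectP[p pth oE]; case/shortenP: pth oE => p' pth' up _ oE.
rewrite oE; apply: done; first exact: ltn_ord.
apply: level_path; first by rewrite /mark cl // eqxx.
  by rewrite eE.
by have := max_card (mem (i :: p')); rewrite (card_uniqP up) card_ord /=; apply: ltnW.
Qed.

Definition demand (s : ram_state) (u v : nat) : bool :=
  cell s (n * n + (u * n + v)).+1 != 0.

Definition demands (s : ram_state) : {set 'I_n * 'I_n} :=
  [set e : 'I_n * 'I_n | demand s e.1 e.2].

Lemma demand_frame s s0 u v : (forall a, a < B -> cell s a = cell s0 a) ->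
  u < n -> v < n -> demand s u v = demand s0 u v.
Proof.
move=> fr un vn; rewrite /demand fr //.
by have := cell_index_lt un vn; rewrite ltnS mul2n -addnn ltn_add2l.
Qed.

(** Register 12 walks through the demand matrix over successive calls, one row per source, while 13
    accumulates the count. *)
Definition Tally : ram_prog := (Move 9 2 ;; Move 6 0) ;;
  Loop 6 (ILoad 10 12 ;; ILoad 11 9 ;; IIf 10 (IIf 11 (Incr 13) ISkip) ISkip ;;
          Incr 12 ;; Incr 9).

Definition tally_time : nat := 2 + (n * (9 + 2)).+1.

Lemma runs_tally i s0 : ready n s0 -> reg s0 12 = (n * n + i * n).+1 ->
  runs Tally s0 tally_time (fun s =>
    [/\ keeps [:: 6; 9; 10; 11; 12; 13] s0 s, cell s = cell s0,
        reg s 12 = (n * n + i.+1 * n).+1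
      & reg s 13 = reg s0 13 + \sum_(0 <= t < n) (demand s0 i t && mark s0 t)]).
Proof.
move=> rd e12; have [e0 e1 e2 e20 e21] := rd.
pose Inv k s := [/\ keeps [:: 6; 9; 10; 11; 12; 13] s0 s, reg s 6 = k, cell s = cell s0
  & exists2 j, j + k = n & [/\ reg s 9 = B + j, reg s 12 = (n * n + (i * n + j)).+1
    & reg s 13 = reg s0 13 + \sum_(0 <= t < j) (demand s0 i t && mark s0 t)]].
apply: (@runs_seq _ _ _ _ _ (Inv n)).
  apply: runs_eval => //; split=> //.
  - by do 2! apply: keeps_set => //.
  - by rewrite /= /update /= e0 e20 addn0.
  - exists 0 => //; rewrite big_geq // /= /update /= e2 e20 e12 !addn0.
    by split.
move=> s I; apply: (@runs_post _ _ _ (Inv 0)).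
  move=> s1 [ks _ cs [j]]; rewrite addn0 => -> [_ e12' e13']; split=> //.
  by rewrite e12' mulSn (addnC n).
apply: (@runs_loop 6 _ 9 Inv) I; first by move=> k s' [].
move=> k s' [ks e6 cs [j jk [e9 e12' e13']]]; apply: runs_eval => //.
have e1' : reg s' 1 = 1 by rewrite (ks 1).
rewrite /=; set s2 := (if _ then _ else _).
have [k2 c2 e132] : [/\ keeps [:: 10; 11; 13] s' s2, cell s2 = cell s'
    & reg s2 13 = reg s' 13 + (demand s0 i j && mark s0 j)].
  rewrite /s2 /= /update /= e12' e9 /demand /mark -cs.
  case: eqP => _ /=.
    by rewrite /= addn0; split=> //; do 2! apply: keeps_set => //.
  case: eqP => _ /=.
    by rewrite /= addn0; split=> //; do 2! apply: keeps_set => //.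
  by rewrite /= /update /= e1'; split=> //; do 3! apply: keeps_set => //.
split.
- do 3! apply: keeps_set => //; apply: keeps_trans ks _; apply: keeps_sub k2 => r.
  by rewrite !inE => /or3P[]->; rewrite ?orbT.
- by rewrite /= /update /= (k2 6) // e6 (k2 1) // e1' subn1.
- by rewrite /= c2.
- exists j.+1; first by rewrite addSnnS.
  rewrite /= /update /= (k2 9) // e9 (k2 1) // e1' (k2 12) // e12' !addn1 !addnS.
  by split=> //; rewrite big_nat_recr //= e132 e13' addnA.
Qed.

Definition reach_index (E : {set 'I_n * 'I_n}) (u v : nat) : bool :=
  [exists a : 'I_n, [exists b : 'I_n, [&& a == u :> nat, b == v :> nat & reachable E a b]]].

Lemma reach_indexE (E : {set 'I_n * 'I_n}) (a b : 'I_n) :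
  reach_index E a b = reachable E a b.
Proof.
apply/existsP/idP => [[a' /existsP[b' /and3P[/eqP/val_inj -> /eqP/val_inj ->]]] //|r].
by exists a; apply/existsP; exists b; rewrite !eqxx.
Qed.

(** Deleting edges can only lose pairs, so comparing this number with its value for the input graph
    tells whether a deletion is harmless. *)
Definition served (D E : {set 'I_n * 'I_n}) : nat :=
  #|[set e in D | reachable E e.1 e.2]|.

Definition CountServed : ram_prog :=
  (IConst 13 0 ;; Move 12 21 ;; Move 19 2 ;; Move 3 0) ;;
  Loop 3 ((Clear ;; Rounds) ;; Tally ;; Incr 19).

Definition search_time : nat := 2 + ((n * 4).+1 + 1) + rounds_time.

Definition count_time : nat := 4 + (n * (search_time + (tally_time + 1) + 2)).+1.

Lemma served_sum s0 :
  \sum_(0 <= u < n) \sum_(0 <= t < n) (demand s0 u t && reach_index (edges s0) u t)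
  = served (demands s0) (edges s0).
Proof.
rewrite big_mkord /served -sum1_card [RHS]big_mkcond /=.
under eq_bigr => u _ do rewrite big_mkord.
rewrite pair_bigA /=; apply: eq_bigr => -[u t] _ /=.
by rewrite !inE /= reach_indexE; case: (_ && _).
Qed.

Lemma runs_count_served s0 : ready n s0 -> runs CountServed s0 count_time (fun s =>
    [/\ keeps [:: 3; 4; 5; 6; 7; 8; 9; 10; 11; 12; 13; 19] s0 s,
        forall a, a < B -> cell s a = cell s0 a
      & reg s 13 = served (demands s0) (edges s0)]).
Proof.
move=> rd; have [e0 e1 e2 e20 e21] := rd.
pose F u t : nat := demand s0 u t && reach_index (edges s0) u t.
pose L := [:: 3; 4; 5; 6; 7; 8; 9; 10; 11; 12; 13; 19].
pose Inv k s := [/\ keeps L s0 s, reg s 3 = k, forall a, a < B -> cell s a = cell s0 a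
  & exists2 j, j + k = n & [/\ reg s 19 = B + j, reg s 12 = (n * n + j * n).+1
    & reg s 13 = \sum_(0 <= u < j) \sum_(0 <= t < n) F u t]].
apply: (@runs_seq _ _ _ _ _ (Inv n)).
  apply: runs_eval => //; split=> //.
  - by do 4! apply: keeps_set => //.
  - by rewrite /= /update /= e0 e20 addn0.
  - by exists 0 => //; rewrite big_geq // /= /update /= e2 e20 e21 !addn0.
move=> s I; apply: (@runs_post _ _ _ (Inv 0)).
  move=> s1 [ks _ fr [j]]; rewrite addn0 => -> [_ _ e13]; split=> //.
  by rewrite e13 served_sum.
apply: (@runs_loop 3 _ (search_time + (tally_time + 1)) Inv) I; first by move=> k s' [].
move=> k s' [ks e3 fr [j jk [e19 e12 e13]]].
have jn : j < n by lia.
have rd' : ready n s' by apply: ready_keeps ks rd.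
apply: runs_seq (@runs_mark_reachable (Ordinal jn) s' rd' e19) _.
move=> s1 [k1 fr1 m1].
have rd1 : ready n s1 by apply: ready_keeps k1 rd'.
have e121 : reg s1 12 = (n * n + j * n).+1 by rewrite (k1 12).
apply: runs_seq (runs_tally rd1 e121) _.
move=> s2 [k2 c2 e122 e132]; apply: runs_eval => //.
have ks2 : keeps L s0 s2.
  apply: keeps_trans ks _; apply: (@keeps_trans _ s1).
    by apply: keeps_sub k1 => r; rewrite !inE => /or4P[->|->|->|/or4P[->|->|->|/orP[]->]];
       rewrite ?orbT.
  by apply: keeps_sub k2 => r; rewrite !inE => /or4P[->|->|->|/or3P[]->]; rewrite ?orbT.
have fr01 a : a < B -> cell s1 a = cell s0 a by move=> aB; rewrite fr1 // fr.
have eE : edges s' = edges s0 by apply/setP=> e; rewrite !inE (edge_frame fr).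
split.
- by do 2! apply: keeps_set => //.
- by rewrite /= /update /= (k2 3) // (k1 3) // e3 (k2 1) // (k1 1) // (ks 1) // e1 subn1.
- by move=> a aB; rewrite /= c2 fr01.
- exists j.+1; first by rewrite addSnnS.
  rewrite /= /update /= (k2 19) // (k1 19) // e19 (k2 1) // (k1 1) // (ks 1) // e1.
  rewrite addn1 addnS; split=> //.
  rewrite big_nat_recr //= e132 (k1 13) // e13; congr (_ + _).
  rewrite [LHS]big_mkord [RHS]big_mkord; apply: eq_bigr => t _.
  by rewrite /F (demand_frame fr01) // m1 eE -reach_indexE.
Qed.

End Phases.

(** * The deletion loop *)

Section Greedy.
Variable n : nat.
Local Notation B := (2 * (n * n)).+1.

(** For lack of a multiplication, n^2 is the result of n additions. Register 21 starts at 1 since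
    cell 0 holds n, and register 2 receives 2(n^2 + 1) - 1, the first free cell after the two
    matrices. *)
Definition Setup : ram_prog :=
  (IConst 1 1 ;; ILoad 0 20 ;; IConst 21 1 ;; Move 6 0) ;; Loop 6 (IAdd 21 21 0) ;;
  IAdd 2 21 21 ;; ISub 2 2 1.

Lemma runs_setup s0 : (forall r, reg s0 r = 0) -> cell s0 0 = n ->
  runs Setup s0 (4 + ((n * (1 + 2)).+1 + 2)) (fun s => ready n s /\ cell s = cell s0).
Proof.
move=> r0 c0.
pose Inv k s := [/\ [/\ reg s 0 = n, reg s 1 = 1 & reg s 20 = 0], reg s 6 = k,
  cell s = cell s0 & exists2 j, j + k = n & reg s 21 = (j * n).+1].
apply: (@runs_seq _ _ _ _ _ (Inv n)).
  apply: runs_eval => //; split; rewrite /= /update /= ?r0 ?c0 ?addn0 //.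
  by exists 0.
move=> s I; apply: (@runs_seq _ _ _ _ _ (Inv 0)).
  apply: (@runs_loop 6 _ 1 Inv) I; first by move=> k s' [].
  move=> k s' [[e0 e1 e20] e6 cs [j jk e21]]; apply: runs_eval => //; split=> //.
    by rewrite /= /update /= e6 e1 subn1.
  exists j.+1; first by rewrite addSnnS.
  by rewrite /= /update /= e21 e0 mulSn addSn addnC.
move=> s1 [[e0 e1 e20] _ cs [j]]; rewrite addn0 => -> e21; apply: runs_eval => //.
split=> //; split; rewrite /= /update /= ?e0 ?e1 ?e20 ?e21 //.
by rewrite subn1 mul2n -addnn addnS addSn.
Qed.

(** Register 18 saves the entry that 17 addresses, and 14 holds the count for the input graph. As
    the count cannot grow and subtraction truncates, register 10 is nonzero exactly when a pair was
    lost; then the entry is restored. *)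
Definition Delete : ram_prog :=
  (ILoad 18 17 ;; IStore 17 20) ;; CountServed ;;
  (ISub 10 14 13 ;; IIf 10 (IStore 17 18) ISkip ;; Incr 17).

Definition delete_time : nat := 2 + (count_time n + 5).

Lemma cell_index_inj u v i j : v < n -> j < n ->
  (u * n + v == i * n + j) = (u == i) && (v == j).
Proof.
move=> vn jn; apply/eqP/andP => [e|[/eqP -> /eqP ->] //].
by have := edivn_eq u vn; rewrite e edivn_eq // => -[-> ->].
Qed.

Lemma edges_update (i j : 'I_n) (b : bool) s s1 :
  (forall a, a < B -> cell s1 a = if (a == (i * n + j).+1) && b then 0 else cell s a) ->
  edges n s1 = (if b then edges n s :\ (i, j) else edges n s)
  /\ demands n s1 = demands n s.
Proof.
move=> h; split; apply/setP=> -[u v].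
  rewrite inE /= /edge h ?cell_index_lt_base // eqSS cell_index_inj //.
  case: b h => h; rewrite ?andbF ?inE // andbT xpair_eqE -!val_eqE /=.
  by case: (_ && _).
rewrite !inE /demand h; last first.
  by have := cell_index_lt (ltn_ord u) (ltn_ord v); rewrite ltnS mul2n -addnn ltn_add2l.
rewrite eqSS (_ : (n * n + _ == _) = false) //; apply: gtn_eqF.
exact: (leq_trans (cell_index_lt (ltn_ord i) (ltn_ord j)) (leq_addr _ _)).
Qed.

Lemma served_mono (D E E' : {set 'I_n * 'I_n}) : E \subset E' ->
  served D E <= served D E'.
Proof.
move=> sub; apply: subset_leq_card; apply/subsetP=> e; rewrite !inE => /andP[-> /=].
exact: reachable_mono.
Qed.

(** The cells must be exactly 0 or 1 because they are the output. Minimality is claimed only for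
    entries already examined. *)
Definition greedy_inv (D G : {set 'I_n * 'I_n}) (q : nat) (s : ram_state) : Prop :=
  [/\ ready n s, reg s 14 = served D G /\ reg s 17 = q.+1,
      cell s 0 = n /\ demands n s = D,
      forall e : 'I_n * 'I_n, cell s (e.1 * n + e.2).+1 = (e \in edges n s)
    & [/\ edges n s \subset G, served D (edges n s) = served D G
      & forall e : 'I_n * 'I_n, e \in edges n s -> e.1 * n + e.2 < q ->
          served D (edges n s :\ e) < served D G]].

Definition greedy_regs := [:: 3; 4; 5; 6; 7; 8; 9; 10; 11; 12; 13; 17; 18; 19].

Lemma runs_delete D G (i j : 'I_n) s0 : greedy_inv D G (i * n + j) s0 ->
  runs Delete s0 delete_time (fun s =>
    keeps greedy_regs s0 s /\ greedy_inv D G (i * n + j).+1 s).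
Proof.
move=> [rd [e14 e17] [c0 dD] bin [sub sat min]].
have [e0 e1 e2 e20 e21] := rd.
set q := i * n + j in e17 min *; set E := edges n s0 in sub sat min.
have qB : q.+1 < B by exact: cell_index_lt_base.
pose s1 := eval (ILoad 18 17 ;; IStore 17 20) s0.
have k1 : keeps [:: 18] s0 s1 by apply: keeps_set.
have c1 a : cell s1 a = if a == q.+1 then 0 else cell s0 a.
  by rewrite /s1 /= /update /= e17 e20.
have rd1 : ready n s1 by apply: ready_keeps k1 rd.
have [eE1 eD1] : edges n s1 = E :\ (i, j) /\ demands n s1 = demands n s0.
  by apply: (@edges_update i j true) => a _; rewrite c1 andbT.
apply: (@runs_seq _ _ _ _ _ (fun s => s = s1)); first exact: runs_eval.
move=> _ ->; apply: runs_seq (runs_count_served rd1) _ => s2 [k2 fr2 e13].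
have e182 : reg s2 18 = cell s0 q.+1 by rewrite (k2 18) // /s1 /= /update /= e17.
pose b := served D G - served D (E :\ (i, j)) == 0.
have e132 : reg s2 13 = served D (E :\ (i, j)) by rewrite e13 eE1 eD1 dD.
apply: runs_eval => //.
rewrite /=; set s3 := (if _ then _ else _).
have t10 : update (reg s2) 10 (reg s2 14 - reg s2 13) 10 == 0 = b.
  by rewrite /update /= e132 (k2 14) // (k1 14) // e14.
have k3 : keeps [:: 10] s2 s3.
  by rewrite /s3; case: ifP => _; rewrite /=; apply: keeps_set.
have c3 a : a < B -> cell s3 a = if (a == q.+1) && b then 0 else cell s0 a.
  move=> aB; rewrite /s3 t10; case: ifP => _ /=.
    by rewrite fr2 // c1 andbT.
  rewrite andbF /update /= e182 (k2 17) // (k1 17) // e17 fr2 // c1.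
  by case: eqP => // ->.
have ks : keeps greedy_regs s0 s3.
  apply: (@keeps_trans _ s1).
    by apply: keeps_sub k1 => r; rewrite !inE => /eqP ->.
  apply: (@keeps_trans _ s2).
    apply: keeps_sub k2 => r; rewrite !inE.
    by move=> /or4P[->|->|->|/or4P[->|->|->|/or4P[->|->|->|/or3P[]->]]]; rewrite ?orbT.
  by apply: keeps_sub k3 => r; rewrite !inE => /eqP ->.
have rd3 : ready n s3 by apply: ready_keeps ks rd.
set s4 := set_reg s3 17 _.
have ks4 : keeps greedy_regs s0 s4 by apply: keeps_set.
have c4 a : a < B -> cell s4 a = if (a == q.+1) && b then 0 else cell s0 a.
  exact: c3.
split=> //.
have [eE4 eD4] := edges_update c4; rewrite -/E in eE4.
split.
- by apply: ready_keeps ks4 rd.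
- rewrite (ks4 14) // e14; split=> //.
  by rewrite /= /update /= (k3 17) // (k2 17) // (k1 17) // e17 (k3 1) // (k2 1) //
    (k1 1) // e1 addn1.
- by rewrite c4 //= c0 eD4 dD.
- move=> [u v]; rewrite c4 ?cell_index_lt_base // eE4 eqSS cell_index_inj //=.
  rewrite -[(u * n + v).+1]/(((u, v).1 * n + (u, v).2).+1) bin -/E.
  case: (b) => //; rewrite ?andbF // andbT !inE xpair_eqE -!val_eqE /=.
  by case: (_ && _).
rewrite eE4; have [bT|bF] := boolP b.
  have subE : E :\ (i, j) \subset G by apply: subset_trans sub; exact: subsetDl.
  have satE : served D (E :\ (i, j)) = served D G.
    by apply/eqP; rewrite eqn_leq served_mono // -subn_eq0.
  split=> // e; rewrite in_setD1 => /andP[ne eE]; rewrite ltnS leq_eqVlt.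
  case: e ne eE => u v ne eE; rewrite cell_index_inj //= => /orP[uv|lt].
    by case/negP: ne; rewrite xpair_eqE.
  (* An edge found indispensable earlier stays so in the smaller graph. *)
  apply: (leq_ltn_trans _ (min _ eE lt)); apply: served_mono.
  by apply: setSD; exact: subsetDl.
split=> // -[u v] eE; rewrite ltnS leq_eqVlt cell_index_inj //= => /orP[|lt].
  by case/andP=> /eqP/val_inj -> /eqP/val_inj ->; rewrite -subn_gt0 lt0n.
exact: min.
Qed.

Definition Greedy : ram_prog :=
  Setup ;; CountServed ;; (Move 14 13 ;; Move 17 1 ;; Move 15 0) ;;
  Loop 15 (Move 16 0 ;; Loop 16 Delete).

Definition greedy_time : nat :=
  (4 + ((n * (1 + 2)).+1 + 2)) +
  (count_time n + (3 + (n * (1 + (n * (delete_time + 2)).+1 + 2)).+1)).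

Lemma runs_greedy (G D : {set 'I_n * 'I_n}) s0 : (forall r, reg s0 r = 0) ->
  cell s0 0 = n ->
  (forall e : 'I_n * 'I_n, cell s0 (e.1 * n + e.2).+1 = (e \in G)) ->
  (forall e : 'I_n * 'I_n, cell s0 (n * n + (e.1 * n + e.2)).+1 = (e \in D)) ->
  runs Greedy s0 greedy_time (greedy_inv D G (n * n)).
Proof.
move=> r0 c0 cG cD; apply: runs_seq (runs_setup r0 c0) _ => s1 [rd1 c1].
have eG : edges n s1 = G.
  by apply/setP=> e; rewrite inE /edge c1 cG; case: (e \in G).
have eD : demands n s1 = D.
  by apply/setP=> e; rewrite inE /demand c1 cD; case: (e \in D).
apply: runs_seq (runs_count_served rd1) _ => s2 [k2 fr2 e13].
have rd2 : ready n s2 by apply: ready_keeps k2 rd1.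
have [e0 e1 e2 e20 e21] := rd2.
pose Inv k s := [/\ greedy_inv D G ((n - k) * n) s, reg s 15 = k & k <= n].
apply: (@runs_seq _ _ _ _ _ (Inv n)).
  have fr u v : (forall a, a < B -> cell s2 a = cell s1 a) -> u < n -> v < n ->
    edge n s2 u v = edge n s1 u v by move=> fr un vn; exact: edge_frame.
  apply: runs_eval => //; set s3 := eval _ _.
  have k3 : keeps [:: 14; 15; 17] s2 s3 by do 3! apply: keeps_set => //.
  have c3 : cell s3 = cell s2 by [].
  have eG3 : edges n s3 = G.
    by rewrite -eG; apply/setP=> e; rewrite !inE /edge c3 -!/(edge _ _ _ _) fr.
  have eD3 : demands n s3 = D.
    rewrite -eD; apply/setP=> e; rewrite !inE /demand c3 -!/(demand _ _ _ _).
    exact: (demand_frame fr2).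
  split; rewrite ?leqnn // ?subnn.
    split.
    - by apply: ready_keeps k3 rd2.
    - by rewrite /= /update /= e20 !addn0 e13 eG eD e1 mul0n.
    - by rewrite c3 fr2 // c1 c0 eD3.
    - by move=> e; rewrite c3 eG3 fr2 ?cell_index_lt_base // c1 cG.
    - by rewrite eG3; split=> //; rewrite mul0n.
  by rewrite /= /update /= e0 e20 addn0.
move=> s I; apply: (@runs_post _ _ _ (Inv 0)).
  by move=> s' [gi _ _]; rewrite subn0 in gi.
apply: (@runs_loop 15 _ _ Inv) I; first by move=> k s' [].
move=> k s' [gi e15 kn]; have n0 : 0 < n by apply: leq_ltn_trans kn.
have [rd' _ _ _ _] := gi; have [e0' e1' _ e20' _] := rd'.
have in_ : n - k.+1 < n by rewrite subnSK // leq_subr.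
pose i := Ordinal in_.
pose Inv2 l t := [/\ greedy_inv D G (i * n + (n - l)) t, reg t 16 = l, reg t 15 = k.+1
  & l <= n].
apply: (@runs_seq _ _ _ _ _ (Inv2 n)).
  apply: runs_eval => //; split=> //.
    by rewrite subnn addn0.
  by rewrite /= /update /= e0' e20' addn0.
move=> t It; apply: (@runs_post _ _ _ (Inv2 0)).
  move=> t' [gi' e16 e15' _]; rewrite subn0 in gi'.
  have [rdt _ _ _ _] := gi'; have [_ e1t _ _ _] := rdt.
  split; [|by rewrite /= /update /= e15' e1t subn1|exact: ltnW].
  have e : (n - k) * n = i * n + n by rewrite -[n - k]subnSK // mulSn addnC.
  by rewrite e; move: gi'; apply.
apply: (@runs_loop 16 _ _ Inv2) It; first by move=> l t' [].
move=> l t' [gi' e16 e15' ln].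
have jn : n - l.+1 < n by rewrite subnSK // leq_subr.
apply: runs_post (@runs_delete D G i (Ordinal jn) t' gi') => t2 [kt gi2].
have [rdt _ _ _ _] := gi'; have [_ e1t _ _ _] := rdt.
split; last exact: ltnW.
- have e : i * n + (n - l) = (i * n + (n - l.+1)).+1 by rewrite -addnS subnSK.
  by rewrite e; move: gi2; apply.
- by rewrite /= /update /= (kt 16) // e16 (kt 1) // e1t subn1.
- by rewrite /= /update /= (kt 15).
Qed.

End Greedy.

(** * Encodings and running time *)

Lemma nth_allpairs (A B : Type) (a0 : A) (b0 : B) (f : A -> B -> nat)
    (s : seq A) (t : seq B) i j : i < size s -> j < size t ->
  nth 0 [seq f x y | x <- s, y <- t] (i * size t + j) = f (nth a0 s i) (nth b0 t j).
Proof.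
elim: s i => // x s IH [|i] /= si tj.
  by rewrite nth_cat size_map tj (nth_map b0).
rewrite nth_cat size_map mulSn -addnA ltnNge leq_addr /= addKn.
exact: IH.
Qed.

Lemma size_adjacency n (E : {set 'I_n * 'I_n}) : size (adjacency E) = n * n.
Proof. by rewrite size_allpairs size_enum_ord. Qed.

Lemma nth_adjacency n (E : {set 'I_n * 'I_n}) (i j : 'I_n) :
  nth 0 (adjacency E) (i * n + j) = ((i, j) \in E).
Proof.
have := @nth_allpairs _ _ i j (fun i j => nat_of_bool ((i, j) \in E))
  (enum 'I_n) (enum 'I_n) i j.
by rewrite size_enum_ord !nth_ord_enum => ->.
Qed.

Lemma encode_graph_cells n (H : {set 'I_n * 'I_n}) (c : nat -> nat) :
  c 0 = n -> (forall e : 'I_n * 'I_n, c (e.1 * n + e.2).+1 = (e \in H)) ->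
  mkseq c (size (encode_graph H)) = encode_graph H.
Proof.
move=> c0 cH; apply: (@eq_from_nth _ 0); first by rewrite size_mkseq.
move=> [|a]; rewrite size_mkseq => h; rewrite nth_mkseq //=.
move: h; rewrite /= size_adjacency ltnS => an.
have n0 : 0 < n by case: (n) an.
have i1 : a %/ n < n by rewrite ltn_divLR.
have i2 : a %% n < n by rewrite ltn_mod.
rewrite (divn_eq a n) -[a %/ n]/(val (Ordinal i1)) -[a %% n]/(val (Ordinal i2)).
by rewrite nth_adjacency (cH (Ordinal i1, Ordinal i2)).
Qed.

(** Every loop costs a factor n: two for a pass, one for the passes, one for the sources and two for
    the entries to be deleted. *)
Lemma greedy_time_le n : greedy_time n <= 134 * n.+1 ^ 6.
Proof.
pose x := n.+1; have x1 : 0 < x by []; have nx : n <= x by exact: leqnSn.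
have row : row_time n <= 15 * x by rewrite /row_time /=; lia.
have relax : relax_time n <= 21 * x ^ 2.
  rewrite /relax_time; have : n * (row_time n + 2) <= x * (17 * x) by apply: leq_mul; lia.
  rewrite -mulnn; nia.
have rounds : rounds_time n <= 25 * x ^ 3.
  rewrite /rounds_time; have : n * (relax_time n + 2) <= x * (23 * x ^ 2).
    by apply: leq_mul => //; rewrite -mulnn in relax *; nia.
  have -> : x * (23 * x ^ 2) = 23 * x ^ 3 by rewrite expnS; lia.
  have : 0 < x ^ 3 by rewrite expn_gt0.
  lia.
have pw k l : k <= l -> x ^ k <= x ^ l by exact: leq_pexp2l.
have x4 : x * x ^ 3 = x ^ 4 by rewrite expnS.
have x6 : x * (x * x ^ 4) = x ^ 6 by rewrite -!expnS.
have [l1 l2 l3] : [/\ x ^ 1 <= x ^ 3, x ^ 0 <= x ^ 3 & x ^ 0 <= x ^ 4].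
  by split; exact: pw.
have [l4 l5 l6] : [/\ x ^ 1 <= x ^ 6, x ^ 4 <= x ^ 6 & x ^ 0 <= x ^ 1].
  by split; exact: pw.
rewrite expn0 expn1 in l1 l2 l3 l4 l6.
have tally : tally_time n <= 14 * x by rewrite /tally_time; lia.
have search : search_time n <= 33 * x ^ 3 by rewrite /search_time; lia.
have count : count_time n <= 55 * x ^ 4.
  rewrite /count_time.
  have : n * (search_time n + (tally_time n + 1) + 2) <= x * (50 * x ^ 3).
    by apply: leq_mul => //; lia.
  by rewrite mulnCA x4; lia.
have del : n * (delete_time n + 2) <= x * (64 * x ^ 4).
  by apply: leq_mul => //; rewrite /delete_time; lia.
have loop : n * (1 + (n * (delete_time n + 2)).+1 + 2) <= x * (x * (68 * x ^ 4)).
  apply: leq_mul => //; have : x * (68 * x ^ 4) = x * (64 * x ^ 4) + 4 * (x * x ^ 4).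
    by lia.
  have : 1 * 1 <= x * x ^ 4 by apply: leq_mul.
  lia.
rewrite /greedy_time -/x.
have -> : 134 * x ^ 6 = x * (x * (68 * x ^ 4)) + 66 * x ^ 6.
  by rewrite -x6; lia.
lia.
Qed.

(** The input has N = 2n^2 + 1 cells, so (n + 1)^2 <= 2N and 134 (n + 1)^6 <= 134 * 8 * N^3. *)
Definition run_time (N : nat) : nat := 1072 * N ^ 3 + 1072.

Lemma greedy_time_le_size n (G P : {set 'I_n * 'I_n}) :
  greedy_time n <= run_time (size (encode_instance G P)).
Proof.
apply: leq_trans (greedy_time_le n) _; rewrite size_cat /= !size_adjacency.
rewrite /run_time; apply: leq_trans (leq_addr _ _).
rewrite -[6]/(2 * 3) expnM; set N := _ + _.
have h : n.+1 ^ 2 <= 2 * N by rewrite /N -mulnn; nia.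
have : (n.+1 ^ 2) ^ 3 <= (2 * N) ^ 3 by rewrite leq_exp2r.
by rewrite expnMn; lia.
Qed.

Lemma greedy_preserver n (G P : {set 'I_n * 'I_n}) :
  exists H : {set 'I_n * 'I_n},
  [/\ ram_outputs_within Greedy (encode_instance G P)
        (run_time (size (encode_instance G P))) (encode_graph H),
      reachability_preserver G P H
    & forall e, e \in H -> exists i, cuts P H e i].
Proof.
have cG (e : 'I_n * 'I_n) :
    cell (ram_init (encode_instance G P)) (e.1 * n + e.2).+1 = (e \in G).
  case: e => i j; rewrite /= nth_cat size_adjacency cell_index_lt //.
  exact: nth_adjacency.
have cP (e : 'I_n * 'I_n) :
    cell (ram_init (encode_instance G P)) (n * n + (e.1 * n + e.2)).+1 = (e \in P).
  case: e => i j; rewrite /= nth_cat size_adjacency ltnNge leq_addr /= addKn.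
  exact: nth_adjacency.
have [k [s [ex kT [_ _ [c0 _] bin [sub sat min]]]]] :=
  @runs_greedy n G P (ram_init (encode_instance G P)) (fun=> erefl) erefl cG cP.
exists (edges n s); split.
- exists k, s; split=> //; first exact: leq_trans kT (greedy_time_le_size G P).
  exact: encode_graph_cells.
- split=> // u v uvP; split; first exact: reachable_mono.
  move=> r; have : (u, v) \in [set e in P | reachable G e.1 e.2] by rewrite inE uvP.
  (* The served pairs of the output are among those of the input and equally many. *)
  have <- : [set e in P | reachable (edges n s) e.1 e.2]
      = [set e in P | reachable G e.1 e.2].
    apply/eqP; rewrite eqEcard -/(served P G) -/(served P (edges n s)) sat leqnn andbT.
    apply/subsetP=> e; rewrite !inE => /andP[-> /=]; exact: reachable_mono.
  by rewrite inE => /andP[].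
move=> e eH; have := min e eH.
have -> : e.1 * n + e.2 < n * n by exact: cell_index_lt.
move=> /(_ isT); rewrite -sat ltnNge => lt.
have [/existsP[i ci]|no] := boolP [exists i, cuts P (edges n s) e i]; first by exists i.
case/negP: lt; apply: subset_leq_card; apply/subsetP=> i; rewrite !inE => /andP[iP r].
rewrite iP /=; apply: contraNT no => nr; apply/existsP; exists i.
by apply/and3P.
Qed.

From mathcomp Require Import reals exp.
Import Order.TTheory GRing.Theory Num.Theory.

(** * The density bound *)

(** The largest k with 2^k a <= f already suffices. This reduces a sum of squares to sums of f over
    the paths above a threshold, which [sparse] controls. *)
Lemma sq_le_dyadic (f a K : nat) : f < 2 ^ K * a ->
  f ^ 2 <= a * f + \sum_(k < K | 2 ^ k * a <= f) 2 * (2 ^ k * a) * f.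
Proof.
rewrite -mulnn -big_distrl /= -mulnDl leq_mul2r => fK; apply/orP; right.
rewrite big_mkcond /=.
elim: K fK => [|K IH] fK; first by rewrite big_ord0 addn0; lia.
rewrite big_ord_recr /=; case: ifP => h; last first.
  by rewrite addn0; apply: IH; rewrite ltnNge h.
rewrite addnA; apply: leq_trans (leq_addl _ _).
by rewrite expnS in fK; lia.
Qed.

(** The number of dyadic scales enters [log_term_le] to the eighth power. *)
Lemma exp8_le k : k ^ 8 <= 8 ^ 8 * 2 ^ k.
Proof.
pose j := k %/ 8.
have kj : k <= 8 * j.+1.
  by rewrite /j; have := divn_eq k 8; have := ltn_pmod k (isT : 0 < 8); lia.
apply: (@leq_trans ((8 * j.+1) ^ 8)); first by rewrite leq_exp2r.
rewrite expnMn leq_mul2l; apply/orP; right.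
apply: (@leq_trans ((2 ^ j) ^ 8)); first by rewrite leq_exp2r // ltn_expl.
by rewrite -expnM leq_exp2l // leq_divM.
Qed.

Local Open Scope ring_scope.

Section Sparse.
Variable R : realType.
Implicit Types A t C : R.

(* With [m = #|J| * L] incidences, average degree [d = m / n] and [L] nodes on
   every path, this reads [d <= A + A^2 sqrt n / L + C n / L^t]. *)
Definition sparse A t C : Prop :=
  forall (V I : finType) (le : rel V) (S : {set V * I}) (N : {set V})
    (J : {set I}) (L : nat),
  uniform_system le S N J L -> (2 <= L)%N ->
  (#|J| * L)%:R <= A * #|N|%:R + A ^+ 2 * (#|N|%:R * Num.sqrt #|N|%:R) / L%:R
    + C * #|N|%:R ^+ 2 / L%:R `^ t.

Section Energy.
Variables (A t C : R).
Hypotheses (A0 : 0 <= A) (C0 : 0 <= C) (t2 : 2 <= t) (spA : sparse A t C).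
Variables (V I : finType) (le : rel V) (S : {set V * I}) (bf : bridge_free le S).
Variables (D L : nat) (Z : {set V}) (nu : R).
Hypothesis degD : forall v, (#|paths S v| <= D)%N.
Hypothesis nodesL : forall q, (#|nodes S q| <= L)%N.
Hypothesis Znu : #|Z|%:R <= nu.

(** The paths are restricted to [Z] and cut into pieces of [l] nodes, to which the density bound
    applies. *)
Lemma heavy_le (l : nat) : (2 <= l)%N ->
  (\sum_(q | l <= #|nodes S q :&: Z|) #|nodes S q :&: Z|)%N%:R
  <= 2 * (A * nu + A ^+ 2 * (nu * Num.sqrt nu) / l%:R + C * nu ^+ 2 / l%:R `^ t).
Proof.
move=> l2; pose SZ := [set u in S | u.1 \in Z].
have nu0 : 0 <= nu by apply: le_trans Znu.
have bfZ : bridge_free le SZ.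
  by apply: (bridge_free_sub bf); apply/subsetP=> u; rewrite inE => /andP[].
have suppZ : {in SZ, forall u, u.1 \in Z} by move=> u; rewrite inE => /andP[].
have [I' [S' [J' [us le1]]]] := uniform_split_paths bfZ suppZ (ltnW l2).
have nE q : nodes SZ q = nodes S q :&: Z by apply/setP=> v; rewrite !inE.
have := spA us l2; move: le1.
rewrite (eq_bigl (fun q => (l <= #|nodes S q :&: Z|)%N)); last by move=> q; rewrite nE.
under eq_bigr => q _ do rewrite nE.
rewrite -(ler_nat R) natrM => le1 le2; apply: (le_trans le1).
apply: ler_pM => //; apply: (le_trans le2).
have l0 : 0 < l%:R :> R by rewrite ltr0n ltnW.
apply: lerD; [apply: lerD|].
- by rewrite ler_wpM2l.
- rewrite ler_pM2r ?invr_gt0 // ler_wpM2l ?sqr_ge0 //.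
  by apply: ler_pM => //; rewrite ?sqrtr_ge0 // ler_wsqrtr.
- rewrite ler_pM2r ?invr_gt0 ?powR_gt0 // ler_wpM2l //.
  by rewrite lerXn2r // nnegrE.
Qed.

(** [Z] will be a fan. Intersections below [a] give the first term. On the dyadic scales above, the
    three terms of the density bound respectively grow geometrically, stay constant (hence the
    factor [K]) and decay geometrically. *)
Lemma energy_le (a K : nat) : (2 <= a)%N -> (L < 2 ^ K * a)%N ->
  (\sum_q #|nodes S q :&: Z| ^ 2)%N%:R
  <= a%:R * nu * D%:R + 4 * A * nu * (2 ^ K * a)%N%:R
    + 4 * A ^+ 2 * (nu * Num.sqrt nu) * K%:R + 8 * C * nu ^+ 2 * a%:R `^ (1 - t).
Proof.
move=> a2 LK; pose f q := #|nodes S q :&: Z|.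
have nu0 : 0 <= nu by apply: le_trans Znu.
have a0 : 0 < a%:R :> R by rewrite ltr0n ltnW.
have fL q : (f q < 2 ^ K * a)%N.
  by apply: leq_ltn_trans LK; apply: leq_trans (nodesL q); rewrite subset_leq_card ?subsetIl.
have le1 : (\sum_q f q ^ 2 <= a * \sum_q f q
   + \sum_(k < K) 2 * (2 ^ k * a) * \sum_(q | 2 ^ k * a <= f q) f q)%N.
  rewrite big_distrr /=.
  under [X in (_ <= _ + X)%N]eq_bigr => k _ do rewrite big_distrr /= big_mkcond.
  rewrite exchange_big -big_split /=; apply: leq_sum => q _.
  by rewrite -big_mkcond; exact: sq_le_dyadic.
have le2 : (\sum_q f q <= #|Z| * D)%N.
  have -> : (\sum_q f q = \sum_(v in Z) #|paths S v|)%N.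
    rewrite /f; under eq_bigr => q _ do rewrite -sum1_card.
    under [RHS]eq_bigr => v _ do rewrite -sum1_card.
    rewrite (exchange_big_dep (mem Z)) /=; last by move=> q v _; rewrite inE => /andP[].
    by apply: eq_bigr => v vZ; apply: eq_bigl => q; rewrite !inE vZ andbT.
  by rewrite -sum_nat_const; apply: leq_sum => v _; exact: degD.
rewrite -(ler_nat R) natrD natrM in le1; apply: (le_trans le1).
rewrite -!addrA; apply: lerD.
  rewrite -mulrA ler_wpM2l //; apply: (le_trans (y := (#|Z| * D)%:R)).
    by rewrite ler_nat.
  by rewrite natrM ler_wpM2r.
pose b k : R := (2 ^ k * a)%:R.
have b0 k : 0 < b k by rewrite ltr0n muln_gt0 expn_gt0 (ltnW a2).
have tail : \sum_(k < K) b k * b k `^ (- t) <= 2 * a%:R `^ (1 - t).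
  have term k : b k * b k `^ (- t) <= a%:R `^ (1 - t) * 2^-1 ^+ k.
    have -> : b k * b k `^ (- t) = b k `^ (1 - t).
      rewrite powRD; last by rewrite (gt_eqF (b0 k)) implybT.
      by rewrite powRr1 // ltW.
    rewrite /b natrM mulrC powRM // ler_wpM2l ?powR_ge0 //.
    rewrite natrX -powR_mulrn // -powRrM mulrC powRrM powR_mulrn ?powR_ge0 //.
    (* Here t >= 2 makes the terms at least halve from one scale to the next. *)
    have t1 : 1 - t <= -1 by have h := t2; lra.
    rewrite lerXn2r ?nnegrE ?powR_ge0 ?invr_ge0 //.
    by rewrite -(powR_inv1 (ler0n R 2)) ler_powR ?ler1n.
  apply: (@le_trans _ _ (\sum_(k < K) a%:R `^ (1 - t) * 2^-1 ^+ k)).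
    by apply: ler_sum => k _; exact: term.
  rewrite -big_distrr /= mulrC ler_wpM2r ?powR_ge0 //.
  have -> : \sum_(k < K) (2^-1 : R) ^+ k = 2 - 2 * 2^-1 ^+ K.
    elim: K {LK fL le1} => [|k IH]; first by rewrite big_ord0 expr0; lra.
    rewrite big_ord_recr /= IH exprS; lra.
  by rewrite lerBlDr lerDl mulr_ge0 // exprn_ge0 // invr_ge0.
have pow2 : \sum_(k < K) b k <= (2 ^ K * a)%:R.
  rewrite /b -natr_sum ler_nat -big_distrl /= leq_mul2r; apply/orP; right.
  elim: K {LK fL le1 tail} => [|k IH]; first by rewrite big_ord0.
  by rewrite big_ord_recr /= expnS; lia.
rewrite natr_sum.
have term (k : 'I_K) : true ->
    (2 * (2 ^ k * a) * \sum_(q | 2 ^ k * a <= f q) f q)%N%:R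
    <= 4 * A * nu * b k + 4 * A ^+ 2 * (nu * Num.sqrt nu)
      + 4 * C * nu ^+ 2 * (b k * b k `^ (- t)).
  move=> _; rewrite natrM.
  have ka : (2 <= 2 ^ k * a)%N.
    by apply: leq_trans a2 _; rewrite leq_pmull // expn_gt0.
  apply: le_trans (ler_wpM2l (ler0n _ _) (heavy_le ka)) _.
  rewrite natrM -/(b k) powRN -/(b k).
  have bn : b k != 0 by rewrite gt_eqF.
  have btn : b k `^ t != 0 by rewrite gt_eqF // powR_gt0.
rewrite le_eqVlt; apply/orP; left; apply/eqP; field.
  by rewrite btn (gt_eqF a0) pnatr_eq0 -lt0n expn_gt0.
apply: (le_trans (ler_sum _ term)).
rewrite !big_split /= -!big_distrr /= sumr_const card_ord -mulr_natr.
rewrite -addrA; apply: lerD; first by rewrite ler_wpM2l // !mulr_ge0.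
apply: lerD; first by rewrite mul1r -[_ *+ K]mulr_natr !mulrA.
rewrite mul1r (_ : 8 * C * nu ^+ 2 * a%:R `^ (1 - t)
  = 4 * C * nu ^+ 2 * (2 * a%:R `^ (1 - t))); last by ring.
by rewrite ler_wpM2l // !mulr_ge0 // exprn_ge0.
Qed.

End Energy.
End Sparse.

Lemma card_incidences_le (V I : finType) (le : rel V) (S : {set V * I})
    (N : {set V}) (J : {set I}) (L D : nat) :
  uniform_system le S N J L -> (forall v, #|paths S v| <= D)%N ->
  (#|J| * L <= #|N| * D)%N.
Proof.
move=> us degD; rewrite -(card_incidences us) (@card_fibers _ _ fst S N).
  rewrite -sum_nat_const; apply: leq_sum => v _; apply: leq_trans (degD v).
  apply: (leq_card_inj (f := snd)) => [[w i]|[w i] [w' i']]; rewrite !inE /=.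
    by move=> /andP[wi /eqP <-].
  by move=> /andP[_ /eqP ->] /andP[_ /eqP ->] ->.
by move=> u /(us_supp us)[].
Qed.

(** * Numerical inequalities behind one improvement of the exponent *)

Section Reals.
Variable R : realType.

(** With d >= 8, the coinciding incidences account for at most half of the collisions. *)
Lemma crossings_ge (n p l d Q : R) : 0 < n -> 0 <= p -> 8 <= d -> 0 <= l ->
  n * d <= 4 * (p * l) -> (p * l) ^+ 2 <= n * (p * l + Q) -> p * l * d <= 8 * Q.
Proof.
move=> n0 p0 d8 l0 nd h; have m0 : 0 <= p * l by rewrite mulr_ge0.
have h1 : n * (p * l) <= (p * l) ^+ 2 / 2.
  by rewrite expr2 ler_pdivlMr // mulrAC ler_wpM2r //; nra.
rewrite -(ler_pM2l n0).
have h2 : (n * d) * (p * l) <= 4 * (p * l) ^+ 2.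
  by rewrite expr2 [leRHS]mulrA ler_wpM2r.
by have := h; rewrite mulrDr => h3; lra.
Qed.

Lemma fan_ineq (n p l d Q : R) : 0 < p -> 0 < d -> 2 <= l ->
  p * l * d <= 8 * Q -> (l - 1) * Q <= 2 * (p * n) -> l ^+ 2 * d <= 32 * n.
Proof.
move=> p0 d0 l2 hQ h; rewrite -(ler_pM2l p0).
have h1 : (l - 1) * (p * l * d) <= (l - 1) * (8 * Q) by rewrite ler_wpM2l //; lra.
have h2 : p * (l ^+ 2 * d) <= 2 * ((l - 1) * (p * l * d)).
  have -> : 2 * ((l - 1) * (p * l * d)) = p * (l * d) * (2 * (l - 1)) by ring.
  have -> : p * (l ^+ 2 * d) = p * (l * d) * l by ring.
  by rewrite ler_wpM2l ?mulr_ge0 //; lra.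
by lra.
Qed.

(** With l >= 16, pairs of crossings at the same node account for at most half of the collisions. *)
Lemma rungs_ge (p l d Q W : R) : 0 < p -> 0 < d -> 16 <= l ->
  p * l * d <= 8 * Q -> Q ^+ 2 <= p * (Q * d + 2 * W) ->
  p * l ^+ 2 * d ^+ 2 <= 256 * W.
Proof.
move=> p0 d0 l16 hQ h.
have h0 : 0 <= p * d by rewrite mulr_ge0 // ltW.
have h1 : 2 * (p * d) <= Q.
  have : p * d * 16 <= p * l * d by rewrite [leRHS]mulrAC ler_wpM2l.
  lra.
have Q0 : 0 <= Q by lra.
have h2 : Q * (Q - p * d) <= 2 * (p * W) by move: h; rewrite mulrDr expr2; lra.
have h3 : Q * (Q / 2) <= Q * (Q - p * d) by rewrite ler_wpM2l //; lra.
have h4 : (p * l * d) ^+ 2 <= (8 * Q) ^+ 2.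
  by rewrite lerXn2r ?nnegrE //; [rewrite !mulr_ge0 // ?ltW //; lra|lra].
rewrite -(ler_pM2l p0).
have -> : p * (p * l ^+ 2 * d ^+ 2) = (p * l * d) ^+ 2 by ring.
have : (8 * Q) ^+ 2 = 128 * (Q * (Q / 2)) by field.
lra.
Qed.

(** As K <= 3l/g and W >= p l^2 d^2 / 256, the constant 1536 = 6 * 256 gives 2 p^2 K <= W, so the
    trivial collisions are at most half. *)
Lemma energy_ge (p l d g K W F : R) : 0 < p -> 0 < l -> 0 < d -> 0 < g ->
  0 < K -> K * g <= 3 * l -> 1536 * p <= g * (l * d ^+ 2) ->
  p * l ^+ 2 * d ^+ 2 <= 256 * W -> W ^+ 2 <= p ^+ 2 * K * (W + 2 * F) ->
  p * (l ^+ 2 * d ^+ 2) <= 512 * F.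
Proof.
move=> p0 l0 d0 g0 K0 Kg hg hW h.
have W0 : 0 < W.
  have : 0 < p * l ^+ 2 * d ^+ 2 by rewrite !mulr_gt0 // exprn_gt0.
  lra.
have c : 2 * (p ^+ 2 * K) <= W.
  have h1 : g * (2 * (p ^+ 2 * K)) <= 6 * (p ^+ 2 * l).
    have -> : g * (2 * (p ^+ 2 * K)) = 2 * p ^+ 2 * (K * g) by ring.
    have -> : 6 * (p ^+ 2 * l) = 2 * p ^+ 2 * (3 * l) by ring.
    by rewrite ler_wpM2l // mulr_ge0 // sqr_ge0.
  have h2 : (1536 * p) * (p * l) <= (g * (l * d ^+ 2)) * (p * l).
    by rewrite ler_wpM2r // mulr_ge0 // ltW.
  have h3 : g * (p * l ^+ 2 * d ^+ 2) <= g * (256 * W) by rewrite ler_wpM2l // ltW.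
  rewrite -(ler_pM2l g0); apply: (le_trans h1).
  have e1 : (1536 * p) * (p * l) = 1536 * (p ^+ 2 * l) by ring.
  have e2 : (g * (l * d ^+ 2)) * (p * l) = g * (p * l ^+ 2 * d ^+ 2) by ring.
  lra.
have F0 : 0 <= W + 2 * F.
  have : 0 <= p ^+ 2 * K * (W + 2 * F) by apply: le_trans h; rewrite sqr_ge0.
  by rewrite pmulr_rge0 // mulr_gt0 // exprn_gt0.
have h1 : p ^+ 2 * K * (W + 2 * F) <= W / 2 * (W + 2 * F).
  by rewrite ler_wpM2r //; lra.
have : W <= 2 * F.
  have : W * W <= W * ((W + 2 * F) / 2) by rewrite -expr2; lra.
  by rewrite ler_pM2l //; lra.
by rewrite mulrA; lra.
Qed.

(** The hypothesis reduces to l d <= B^2 k^2 g^3, and g <= d gives l <= B^2 k^2 g^2. Since 2^k =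
    O(g), k^8 is O(g), so the fourth power loses only one more factor g. *)
Lemma log_term_le (A : R) : 0 < A -> exists2 c : R, 0 < c &
  forall (l d g a nu : R) (k : nat), 1 <= l -> 1 <= g -> g <= d ->
  nu = l * d * g -> 2 ^+ k * a <= 2 * l -> l <= 4096 * g * a ->
  l ^+ 2 * d ^+ 2 <= 2048 * (4 * A ^+ 2 * (nu * Num.sqrt nu) * k%:R) ->
  l ^+ 4 <= c * g ^+ 9.
Proof.
move=> A0; pose B : R := 8192 * A ^+ 2.
have B0 : 0 < B by rewrite mulr_gt0 // exprn_gt0.
exists (B ^+ 8 * (8 ^+ 8 * 8192)).
  by rewrite !mulr_gt0 ?exprn_gt0.
move=> l d g a nu k l1 g1 gd nuE ka la h.
have l0 : 0 < l by exact: lt_le_trans l1.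
have g0 : 0 < g by exact: lt_le_trans g1.
have d0 : 0 < d by exact: lt_le_trans gd.
have nu0 : 0 < nu by rewrite nuE !mulr_gt0.
have s2 : Num.sqrt nu ^+ 2 = nu by rewrite sqr_sqrtr // ltW.
have s0 : 0 < Num.sqrt nu by rewrite sqrtr_gt0.
have h1 : (l * d) ^+ 2 <= (l * d * g) * (B * k%:R * Num.sqrt nu).
  rewrite exprMn; apply: (le_trans h); rewrite /B nuE le_eqVlt; apply/orP; left.
  by apply/eqP; ring.
have ld0 : 0 < l * d by rewrite mulr_gt0.
have h2 : l * d <= g * (B * k%:R * Num.sqrt nu).
  by rewrite -(ler_pM2l ld0) -expr2 [leRHS]mulrA.
have h3 : (l * d) ^+ 2 <= (g * (B * k%:R * Num.sqrt nu)) ^+ 2.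
  by rewrite lerXn2r // nnegrE ?(ltW ld0) //; apply: (le_trans (ltW ld0) h2).
have h4 : (l * d) ^+ 2 <= (l * d) * (g ^+ 3 * B ^+ 2 * k%:R ^+ 2).
  apply: (le_trans h3); rewrite !exprMn s2 nuE le_eqVlt; apply/orP; left.
  by apply/eqP; ring.
have h5 : l * d <= g ^+ 3 * B ^+ 2 * k%:R ^+ 2 by rewrite -(ler_pM2l ld0) -expr2.
have h6 : l * g <= (g ^+ 2 * B ^+ 2 * k%:R ^+ 2) * g.
  apply: (le_trans (y := l * d)); first by rewrite ler_wpM2l // ltW.
  apply: (le_trans h5); rewrite le_eqVlt; apply/orP; left; apply/eqP; ring.
have h7 : l <= g ^+ 2 * B ^+ 2 * k%:R ^+ 2 by rewrite -(ler_pM2r g0).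
have h8 : l ^+ 4 <= (g ^+ 2 * B ^+ 2 * k%:R ^+ 2) ^+ 4.
  by rewrite lerXn2r // nnegrE ?(ltW l0) //; apply: (le_trans (ltW l0) h7).
apply: (le_trans h8).
have -> : (g ^+ 2 * B ^+ 2 * k%:R ^+ 2) ^+ 4 = g ^+ 8 * B ^+ 8 * k%:R ^+ 8 by ring.
have a0 : 0 < a.
  have : 0 < 4096 * g * a by exact: lt_le_trans la.
  by rewrite pmulr_rgt0 // mulr_gt0.
have h9 : 2 ^+ k <= 8192 * g.
  rewrite -(ler_pM2r a0); apply: (le_trans ka).
  have -> : 8192 * g * a = 2 * (4096 * g * a) by ring.
  by rewrite ler_pM2l.
have h10 : k%:R ^+ 8 <= 8 ^+ 8 * (8192 * g) :> R.
  apply: (le_trans (y := 8 ^+ 8 * 2 ^+ k)).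
    by have := exp8_le k; rewrite -(ler_nat R) natrM !natrX.
  by rewrite ler_wpM2l // exprn_ge0.
have -> : B ^+ 8 * (8 ^+ 8 * 8192) * g ^+ 9 =
   g ^+ 8 * B ^+ 8 * (8 ^+ 8 * (8192 * g)) by ring.
by rewrite ler_wpM2l // mulr_ge0 // exprn_ge0 // ltW.
Qed.

(** The factors (l d)^2 cancel, leaving a^(t-1) = O(g^2), while l/g is O(a). *)
Lemma power_term_le (C t : R) : 0 < C -> 2 <= t -> exists2 c : R, 0 < c &
  forall l d g a nu : R, 1 <= l -> 1 <= g -> 0 < d -> 0 < a ->
  nu = l * d * g -> l <= 4096 * g * a ->
  l ^+ 2 * d ^+ 2 <= 2048 * (8 * C * nu ^+ 2 * a `^ (1 - t)) ->
  l `^ (t - 1) <= c * g `^ (t + 1).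
Proof.
move=> C0 t2; have t10 : 0 <= t - 1 by lra.
exists (16384 * C * 4096 `^ (t - 1)).
  by rewrite !mulr_gt0 // powR_gt0.
move=> l d g a nu l1 g1 d0 a0 nuE la h.
have l0 : 0 < l by exact: lt_le_trans l1.
have g0 : 0 < g by exact: lt_le_trans g1.
have ld0 : 0 < l ^+ 2 * d ^+ 2 by rewrite mulr_gt0 // exprn_gt0.
have h1 : 1 <= 16384 * C * g ^+ 2 * a `^ (1 - t).
  rewrite -(ler_pM2l ld0) mulr1; apply: (le_trans h).
  by rewrite nuE le_eqVlt; apply/orP; left; apply/eqP; ring.
have at0 : 0 < a `^ (t - 1) by rewrite powR_gt0.
have h2 : a `^ (t - 1) <= 16384 * C * g ^+ 2.
  have := h1; rewrite (_ : 1 - t = - (t - 1)); last by ring.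
  by rewrite powRN ler_pdivlMr // mul1r.
apply: (le_trans (y := (4096 * g * a) `^ (t - 1))).
  by rewrite ge0_ler_powR ?nnegrE ?mulr_ge0 // ltW.
have gg : g `^ (t + 1) = g `^ (t - 1) * g ^+ 2.
  rewrite -(powR_mulrn _ (ltW g0)) -powRD; last by rewrite (gt_eqF g0) implybT.
  by congr powR; ring.
rewrite powRM ?mulr_ge0 ?(ltW g0) ?(ltW a0) // powRM ?(ltW g0) // gg.
have -> : 16384 * C * 4096 `^ (t - 1) * (g `^ (t - 1) * g ^+ 2) =
  4096 `^ (t - 1) * g `^ (t - 1) * (16384 * C * g ^+ 2) by ring.
by rewrite ler_wpM2l // mulr_ge0 // powR_ge0.
Qed.

Lemma root4_le (c l g s : R) : 0 < c -> 1 <= l -> 1 <= g -> 9 * s <= 4 ->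
  l ^+ 4 <= c * g ^+ 9 -> l `^ s <= c `^ (9^-1) * g.
Proof.
move=> c0 l1 g1 s49 h.
have l0 : 0 <= l by lra.
have g0 : 0 <= g by lra.
apply: (le_trans (y := (l ^+ 4) `^ (9^-1))).
  rewrite -powR_mulrn // -powRrM ler_powR //; lra.
apply: (le_trans (y := (c * g ^+ 9) `^ (9^-1))).
  by rewrite ge0_ler_powR ?nnegrE ?invr_ge0 ?mulr_ge0 ?exprn_ge0 // ltW.
rewrite powRM ?(ltW c0) ?exprn_ge0 // -(powR_mulrn 9) // -powRrM divff ?pnatr_eq0 //.
by rewrite powRr1.
Qed.

Lemma root_le (c t l g : R) : 0 < c -> 2 <= t -> 1 <= l -> 1 <= g ->
  l `^ (t - 1) <= c * g `^ (t + 1) ->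
  l `^ ((t - 1) / (t + 1)) <= c `^ ((t + 1)^-1) * g.
Proof.
move=> c0 t2 l1 g1 h.
have g0 : 0 <= g by lra.
have t10 : 0 < t + 1 by lra.
rewrite powRrM.
apply: (le_trans (y := (c * g `^ (t + 1)) `^ ((t + 1)^-1))).
  rewrite ge0_ler_powR ?nnegrE ?powR_ge0 ?mulr_ge0 ?powR_ge0 //; last exact: ltW.
  by rewrite invr_ge0 ltW.
by rewrite powRM ?powR_ge0 ?(ltW c0) // -powRrM divff ?gt_eqF // powRr1.
Qed.

End Reals.

Section Step.
Variable R : realType.

(* The scale [g] makes [2 p^2 K <= W] for [K <= 3 L / g] block pairs per ladder
   and [W >= p L^2 D^2 / 256] rungs, so ladders have about [L / g] rungs. *)
Lemma gap_scale (n p L D : nat) : (0 < L)%N -> (0 < D)%N ->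
  (p * L <= n * D)%N -> (L ^ 2 * D <= 32 * n)%N ->
  exists g : nat, [/\ (0 < g)%N, (1536 * p <= g * (L * D ^ 2))%N
    & (g * (L ^ 2 * D) <= 3072 * n)%N].
Proof.
move=> L0 D0 pn h; have LD0 : (0 < L * D ^ 2)%N by rewrite muln_gt0 L0 expn_gt0 D0.
exists ((1536 * p) %/ (L * D ^ 2)).+1; split=> //; first exact/ltnW/ltn_ceil.
set q := (_ %/ _)%N.
have h1 : (q * (L * D ^ 2) <= 1536 * p)%N by exact: leq_divM.
have h2 : (q * (L ^ 2 * D) <= 1536 * n)%N.
  rewrite -(leq_pmul2r D0).
  have -> : (q * (L ^ 2 * D) * D = q * (L * D ^ 2) * L)%N by rewrite !expnS; lia.
  apply: (@leq_trans (1536 * p * L)); first by rewrite leq_mul2r h1 orbT.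
  by rewrite -!mulnA leq_mul2l pn.
by rewrite mulSn; lia.
Qed.

(** [a] is the threshold for light intersections. The factor 2048 = 4 * 512 makes their contribution
    at most a quarter of the energy. *)
Lemma scale_bounds (L g : nat) : (0 < g)%N -> let a := (L %/ (2048 * g))%N in
  [/\ (a * (2048 * g) <= L)%N, (a < 2)%N -> (L <= 4096 * g)%N
    & (2 <= a)%N -> (L <= 4096 * g * a)%N].
Proof.
move=> g0 a; have h : (L < a.+1 * (2048 * g))%N by rewrite /a ltn_ceil // muln_gt0.
have e : (4096 * g = 2 * (2048 * g))%N by rewrite mulnA.
split; first exact: leq_divM.
  move=> a2; rewrite e; apply: leq_trans (ltnW h) _.
  by rewrite leq_mul2r a2 orbT.
move=> a2; apply: leq_trans (ltnW h) _; rewrite e mulnAC leq_mul2r.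
by apply/orP; right; rewrite -addn1 mul2n -addnn leq_add2l ltnW.
Qed.

Lemma window_count (L g : nat) : (g <= L)%N -> ((2 * (L %/ g)).+1 * g <= 3 * L)%N.
Proof. by move=> gL; have := leq_divM L g; nia. Qed.

(** The first of the four terms is at most a quarter of the left side, so one of the other three is
    at least a quarter. *)
Lemma energy_trichotomy (A l d g a T1 T2 T3 nu : R) : 1 <= l -> 1 <= d -> 1 <= g ->
  a * (2048 * g) <= l -> nu = l * d * g -> T1 <= 2 * l ->
  0 < A ->
  l ^+ 2 * d ^+ 2 <= 512 * (a * nu * d + 4 * A * nu * T1 + T2 + T3) ->
  [\/ d <= 16384 * A * g, l ^+ 2 * d ^+ 2 <= 2048 * T2
    | l ^+ 2 * d ^+ 2 <= 2048 * T3].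
Proof.
move=> l1 d1 g1 ag nuE T1l A0 h.
have ld0 : 0 < l * d ^+ 2 by rewrite mulr_gt0 ?exprn_gt0 ?(lt_le_trans ltr01).
have h1 : 2048 * (a * nu * d) <= l ^+ 2 * d ^+ 2.
  have -> : 2048 * (a * nu * d) = (l * d ^+ 2) * (a * (2048 * g)) by rewrite nuE; ring.
  have -> : l ^+ 2 * d ^+ 2 = (l * d ^+ 2) * l by ring.
  by rewrite ler_pM2l.
have [h2|h2] := lerP (l ^+ 2 * d ^+ 2) (2048 * T2); first by constructor 2.
have [h3|h3] := lerP (l ^+ 2 * d ^+ 2) (2048 * T3); first by constructor 3.
constructor 1.
have h4 : l ^+ 2 * d ^+ 2 <= 2048 * (4 * A * nu * T1) by lra.
have [l0 d0 g0] : [/\ 0 <= l, 0 <= d & 0 <= g] by split; apply: le_trans ler01 _.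
have nu0 : 0 <= 4 * A * nu by rewrite nuE !mulr_ge0 // ltW.
have h5 : 4 * A * nu * T1 <= 4 * A * nu * (2 * l) by rewrite ler_wpM2l.
have l2d : 0 < l ^+ 2 * d by rewrite mulr_gt0 ?exprn_gt0 ?(lt_le_trans ltr01).
rewrite -(ler_pM2l l2d).
have -> : l ^+ 2 * d * d = l ^+ 2 * d ^+ 2 by ring.
have -> : l ^+ 2 * d * (16384 * A * g) = 2048 * (4 * A * nu * (2 * l)).
  by rewrite nuE; ring.
by apply: (le_trans h4); rewrite ler_pM2l.
Qed.

Lemma step_core (A t C : R) : 8 <= A -> 0 < C -> 2 <= t -> 5 * t <= 13 ->
  sparse A t C -> exists2 c : R, 0 < c &
  forall (V I : finType) (le : rel V) (S : {set V * I}) (N : {set V})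
    (J : {set I}) (L D : nat),
  uniform_system le S N J L -> (2 <= L)%N -> (forall v, #|paths S v| <= D)%N ->
  (0 < #|J|)%N -> (#|N| * D <= 4 * (#|J| * L))%N -> A <= D%:R ->
  exists g : R, [/\ 1 <= g, g * (L%:R ^+ 2 * D%:R) <= 3072 * #|N|%:R
    & D%:R <= 16384 * A * g \/ L%:R `^ ((t - 1) / (t + 1)) <= c * g].
Proof.
move=> A8 C0 t2 t13 spA.
have A0 : 0 < A by exact: lt_le_trans A8.
have [c1 c10 H1] := log_term_le A0.
have [c2 c20 H2] := power_term_le C0 t2.
have p1 : 0 < c1 `^ (9^-1) by rewrite powR_gt0.
have p2 : 0 < c2 `^ ((t + 1)^-1) by rewrite powR_gt0.
set s := (t - 1) / (t + 1).
have t1 : 0 < t + 1 by clear - t2; lra.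
have s1 : s <= 1 by rewrite ler_pdivrMr //; clear; lra.
(* This is where 5t <= 13 is used: it lets the bound l^4 = O(g^9) of the logarithmic term imply l^s
   = O(g). *)
have s49 : 9 * s <= 4 by rewrite mulrA ler_pdivrMr //; clear - t13; lra.
have [c3 c30 c3E] : exists2 c3 : R, 0 < c3 & c3 = 4096%:R.
  by exists 4096%:R; rewrite // ltr0n.
exists (c3 + c1 `^ (9^-1) + c2 `^ ((t + 1)^-1)); first by rewrite !addr_gt0.
move=> V I le S N J L D us L2 degD J0 hD AD.
have D8 : 8 <= D%:R :> R by exact: le_trans AD.
have D0R : 0 < D%:R :> R by exact: lt_le_trans D8.
have D0 : (0 < D)%N by rewrite -(ltr_nat R).
have L0 : (0 < L)%N by exact: ltnW.
have mn := card_incidences_le us degD.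
have n0 : (0 < #|N|)%N.
  rewrite lt0n; apply: contraTneq mn => ->.
  by rewrite mul0n -ltnNge muln_gt0 J0 L0.
set Q := #|crossings S|.
have l2R : 2 <= L%:R :> R by rewrite ler_nat.
have p0R : 0 < #|J|%:R :> R by rewrite ltr0n.
have n0R : 0 < #|N|%:R :> R by rewrite ltr0n.
have hQ : #|J|%:R * L%:R * D%:R <= 8 * Q%:R :> R.
  apply: (crossings_ge n0R (ltW p0R) D8 (ler0n _ _)).
    by rewrite -!natrM ler_nat.
  by have := incidences_le_crossings us; rewrite -(ler_nat R) natrX !(natrM, natrD).
have hL : L%:R ^+ 2 * D%:R <= 32 * #|N|%:R :> R.
  apply: (fan_ineq p0R D0R l2R hQ).
  have := crossings_fan us; rewrite -(ler_nat R) !natrM.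
  by rewrite natrB // ltnW.
have hLn : (L ^ 2 * D <= 32 * #|N|)%N by rewrite -(ler_nat R) natrM natrX (natrM _ 32).
have [g [g0 g1 g2]] := gap_scale L0 D0 mn hLn.
have g1R : 1 <= g%:R :> R by rewrite ler1n.
exists g%:R; split=> //.
  by have := g2; rewrite -(ler_nat R) natrM (natrM _ (L ^ 2)) natrX natrM.
have lL : L%:R `^ s <= L%:R.
  rewrite -[leRHS](powRr1 (ler0n _ _)) ler_powR //.
  by rewrite ler1n.
(* Since s <= 1, all degenerate cases with L = O(g) fall under the second alternative. *)
have small : L%:R <= 4096 * g%:R :> R -> L%:R `^ s <=
    (c3 + c1 `^ (9^-1) + c2 `^ ((t + 1)^-1)) * g%:R.
  move=> h; apply: (le_trans lL); apply: (le_trans h).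
  rewrite -c3E ler_pM2r ?(lt_le_trans ltr01) //.
  by rewrite -addrA lerDl addr_ge0 // ltW.
have [gL|Lg] := leqP g L; last first.
  right; apply: small; rewrite -natrM ler_nat; apply: leq_trans (ltnW Lg) _.
  exact: leq_pmull.
have [L16|L16] := ltnP L 16.
  right; apply: small; rewrite -natrM ler_nat; apply: leq_trans (ltnW L16) _.
  by apply: leq_trans (leq_pmulr _ g0).
have l16R : 16 <= L%:R :> R by rewrite ler_nat.
have [aL1 aL2 aL3] := scale_bounds L g0.
have aL : (L %/ (2048 * g) <= L)%N by exact: leq_div.
set a := (L %/ (2048 * g))%N in aL aL1 aL2 aL3.
clearbody a.
have [a2|a2] := ltnP a 2.
  by right; apply: small; rewrite -natrM ler_nat; exact: aL2.
have ag : a%:R * (2048 * g%:R) <= L%:R :> R by rewrite -!natrM ler_nat.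
have ga : L%:R <= 4096 * g%:R * a%:R :> R by rewrite -!natrM ler_nat; exact: aL3.
have a0 : (0 < a)%N by exact: ltnW.
pose K1 := (trunc_log 2 (L %/ a)).+1.
have LK : (L < 2 ^ K1 * a)%N by rewrite -ltn_divLR // trunc_log_ltn.
have KL : (2 ^ K1 * a <= 2 * L)%N.
  rewrite expnS -mulnA leq_mul2l /= -leq_divRL //.
  by apply: trunc_logP => //; rewrite divn_gt0.
pose K := (2 * (L %/ g)).+1.
have hK : (K * g <= 3 * L)%N by exact: window_count.
have hW := rungs_ge p0R D0R l16R hQ (W := #|rungs le S|%:R).
have {}hW : #|J|%:R * L%:R ^+ 2 * D%:R ^+ 2 <= 256 * #|rungs le S|%:R :> R.
  by apply: hW; have := crossings_le_rungs us degD;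
    rewrite -(ler_nat R) natrX !(natrM, natrD).
have l0R : 0 < L%:R :> R by rewrite ltr0n.
have g0R : 0 < g%:R :> R by rewrite ltr0n.
have hF : #|J|%:R * (L%:R ^+ 2 * D%:R ^+ 2)
    <= 512 * (fan_energy le S J g)%:R :> R.
  apply: (energy_ge p0R l0R D0R g0R (K := K%:R)) hW _.
  - by rewrite ltr0n.
  - by rewrite -!natrM ler_nat.
  - by rewrite -natrX -!natrM ler_nat.
  - have := rungs_le_fan_energy us g.
    by rewrite -(ler_nat R) natrX natrM natrM natrX natrD (natrM _ 2).
pose nu : R := L%:R * D%:R * g%:R.
have nodesL q : (#|nodes S q| <= L)%N.
  have [qJ|qJ] := boolP (q \in J); first by rewrite (us_card us qJ).
  rewrite (_ : nodes S q = set0) ?cards0 //; apply/setP=> v; rewrite !inE.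
  by apply: contraNF qJ => /(us_supp us)[].
have hE : (fan_energy le S J g)%:R <= #|J|%:R * (a%:R * nu * D%:R
    + 4 * A * nu * (2 ^ K1 * a)%N%:R
    + 4 * A ^+ 2 * (nu * Num.sqrt nu) * K1%:R + 8 * C * nu ^+ 2 * a%:R `^ (1 - t)).
  rewrite /fan_energy natr_sum mulr_natl -sumr_const.
  apply: ler_sum => q qJ.
  have fnu : #|fan le S g q|%:R <= nu.
    by rewrite /nu -!natrM ler_nat; exact: (card_fan us degD g0 qJ).
  apply: le_trans (energy_le (ltW A0) (ltW C0) t2 spA (us_bf us) degD nodesL fnu a2 LK).
  by rewrite ler_nat [leqLHS]big_mkcond; apply: leq_sum => q' _; case: ifP.
have h512 : L%:R ^+ 2 * D%:R ^+ 2 <= 512 * (a%:R * nu * D%:R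
    + 4 * A * nu * (2 ^ K1 * a)%N%:R
    + 4 * A ^+ 2 * (nu * Num.sqrt nu) * K1%:R + 8 * C * nu ^+ 2 * a%:R `^ (1 - t)).
  rewrite -(ler_pM2l p0R); apply: (le_trans hF).
  by rewrite [leRHS]mulrCA ler_wpM2l.
have l1R : 1 <= L%:R :> R by rewrite ler1n.
have d1R : 1 <= D%:R :> R by rewrite ler1n.
have KLR : (2 ^ K1 * a)%N%:R <= 2 * L%:R :> R by rewrite -natrM ler_nat.
have a0R : 0 < a%:R :> R by rewrite ltr0n.
have [|h|h] := energy_trichotomy l1R d1R g1R ag (erefl nu) KLR A0 h512.
- by left.
(* The logarithmic term is handled only for g <= D; otherwise D < g is the first alternative. *)
- have [gd|dg] := lerP g%:R (D%:R : R); last first.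
    left; apply: (le_trans (ltW dg)); rewrite ler_peMl // ?ler0n //.
    by apply: mulr_ege1 => //; [rewrite ler1n|apply: le_trans A8; rewrite ler1n].
  have KL2 : 2 ^+ K1 * a%:R <= 2 * L%:R :> R by rewrite -natrX -natrM.
  right; have := H1 _ _ _ _ _ K1 l1R g1R gd (erefl nu) KL2 ga h.
  move=> /(root4_le c10 l1R g1R s49) h4; apply: (le_trans h4).
  by rewrite ler_pM2r // -addrA addrCA lerDl addr_ge0 ?(ltW c30) ?(ltW p2).
- right; have := H2 _ _ _ _ _ l1R g1R D0R a0R (erefl nu) ga h.
  move=> /(root_le c20 t2 l1R g1R) h4; apply: (le_trans h4).
  by rewrite ler_pM2r // lerDr addr_ge0 // ltW.
Qed.

End Step.

(** * Iterating the improvement *)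

Section Iterate.
Variable R : realType.
Implicit Types A t C : R.

Lemma base_ineq (n m p l Q : R) : 0 < n -> 0 < p -> 2 <= l -> m = p * l ->
  m ^+ 2 <= n * (m + Q) -> (l - 1) * Q <= 2 * (p * n) ->
  m <= n + 4 * n ^+ 2 / l ^+ 2.
Proof.
move=> n0 p0 l2 mE h1 h2.
have l0 : 0 < l by lra.
have m0 : 0 < m by rewrite mE mulr_gt0.
have l10 : 0 < l - 1 by lra.
rewrite -lerBlDl ler_pdivlMr ?exprn_gt0 //.
rewrite -(ler_pM2l m0).
have h3 : (l - 1) * (m * (m - n)) <= 2 * (p * n ^+ 2).
  have e1 : m * (m - n) <= n * Q by move: h1; rewrite mulrDr mulrBr expr2; lra.
  have e2 : (l - 1) * (m * (m - n)) <= (l - 1) * (n * Q) by rewrite ler_pM2l.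
  have e3 : n * ((l - 1) * Q) <= n * (2 * (p * n)) by rewrite ler_pM2l.
  have -> : 2 * (p * n ^+ 2) = n * (2 * (p * n)) by ring.
  by apply: (le_trans e2); rewrite mulrCA.
have [mn|nm] := lerP m n.
  apply: (le_trans (y := 0)); last by rewrite !mulr_ge0 ?exprn_ge0 // ltW.
  by rewrite pmulr_rle0 // pmulr_lle0 ?exprn_gt0 // subr_le0.
have x0 : 0 <= m * (m - n) by rewrite mulr_ge0 ?subr_ge0 // ltW.
have h4 : l * (m * (m - n)) <= 2 * ((l - 1) * (m * (m - n))).
  by rewrite [leRHS]mulrA ler_wpM2r //; lra.
have h5 : l * (l * (m * (m - n))) <= l * (4 * (p * n ^+ 2)).
  by rewrite ler_pM2l //; lra.
have -> : m * ((m - n) * l ^+ 2) = l * (l * (m * (m - n))) by ring.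
have -> : m * (4 * n ^+ 2) = l * (4 * (p * n ^+ 2)) by rewrite mE; ring.
exact: h5.
Qed.

Lemma system_nonempty (V I : finType) (le : rel V) (S : {set V * I})
    (N : {set V}) (J : {set I}) (L : nat) :
  uniform_system le S N J L -> (0 < L)%N -> (0 < #|J|)%N -> (0 < #|N|)%N.
Proof.
move=> us L0 /card_gt0P[i iJ]; move: L0; rewrite -(us_card us iJ).
move=> /card_gt0P[v]; rewrite inE => /(us_supp us)[/= vN _].
by apply/card_gt0P; exists v.
Qed.

(** The start t = 2 comes from disjointness of the fans alone, without rungs. *)
Lemma sparse_base A : 1 <= A -> sparse A 2 4.
Proof.
move=> A1 V I le S N J L us L2.
have A0 : 0 <= A by exact: le_trans A1.
have [p0|p0] := posnP #|J|.
  by rewrite p0 mul0n !addr_ge0 ?mulr_ge0 ?invr_ge0 ?powR_ge0 ?sqrtr_ge0 ?exprn_ge0.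
have n0 := system_nonempty us (ltnW L2) p0.
rewrite powR_mulrn // natrM.
have h : #|J|%:R * L%:R <= #|N|%:R + 4 * #|N|%:R ^+ 2 / L%:R ^+ 2 :> R.
  apply: (@base_ineq _ _ #|J|%:R _ #|crossings S|%:R) => //; rewrite ?ltr0n ?ler_nat //.
    have := incidences_le_crossings us.
    by rewrite -(ler_nat R) natrX !natrM natrD !natrM.
  have := crossings_fan us; rewrite -(ler_nat R) !natrM.
  by rewrite natrB // ltnW.
apply: (le_trans h); apply: lerD => //.
apply: ler_wpDr; last by rewrite ler_peMl.
by rewrite !mulr_ge0 ?invr_ge0 ?sqrtr_ge0 ?exprn_ge0.
Qed.

Lemma split_degree (n p L : nat) : (0 < n)%N -> (n <= p * L)%N ->
  exists D, [/\ (0 < D)%N, (p * L < D * n)%N & (D * n <= 2 * (p * L))%N].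
Proof.
move=> n0 h; exists ((p * L) %/ n).+1; split=> //; first exact: ltn_ceil.
by rewrite mulSn mul2n -addnn leq_add // leq_divM.
Qed.

(* The factor [16384 * 3072] comes from [D <= 16384 A g] and
   [g L^2 D <= 3072 n] in [step_core]: only the constant [C] may depend on [t]. *)
Lemma sparse_step A t C : 8 <= A ->
  8 * (16384 * 3072) * A <= A ^+ 4 -> 0 < C -> 2 <= t -> 5 * t <= 13 ->
  sparse A t C ->
  exists2 C', 0 < C' & sparse A (2 + (t - 1) / (t + 1)) C'.
Proof.
move=> A8 A4 C0 t2 t13 spA.
have A0 : 0 < A by exact: lt_le_trans A8.
have [c c0 H] := step_core A8 C0 t2 t13 spA.
set s := (t - 1) / (t + 1) in H *.
have [k k0 kE] : exists2 k : R, 0 < k & k = 3072%:R.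
  by exists 3072%:R; rewrite // ltr0n.
have [k' k'0 k'E] : exists2 k : R, 0 < k & k = 16384%:R.
  by exists 16384%:R; rewrite // ltr0n.
rewrite -kE -k'E in A4 H; exists (4 * k * c); first by rewrite !mulr_gt0.
move=> V I le S N J L us L2.
have L0 : (0 < L)%N by exact: ltnW.
have [n0R T20 T30] : [/\ 0 <= A * #|N|%:R,
    0 <= A ^+ 2 * (#|N|%:R * Num.sqrt #|N|%:R) / L%:R
    & 0 <= 4 * k * c * #|N|%:R ^+ 2 / L%:R `^ (2 + s)].
  split; rewrite !mulr_ge0 ?invr_ge0 ?powR_ge0 ?sqrtr_ge0 ?exprn_ge0 //;
  exact: ltW.
have [p0|p0] := posnP #|J|; first by rewrite p0 mul0n !addr_ge0.
have n0 := system_nonempty us L0 p0.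
have [small|big] := lerP (#|J| * L)%:R (A * #|N|%:R : R).
  by rewrite -addrA; apply: ler_wpDr => //; rewrite addr_ge0.
have nm : (#|N| <= #|J| * L)%N.
  rewrite -(ler_nat R); apply: le_trans (ltW big).
  by rewrite ler_peMl //; apply: le_trans A8; rewrite ler1n.
have [D [D0 mD Dm]] := split_degree n0 nm.
have AD : A <= D%:R.
  have n0' : 0 < #|N|%:R :> R by rewrite ltr0n.
  rewrite -(ler_pM2r n0'); apply: (le_trans (ltW big)).
  by rewrite -natrM ler_nat ltnW.
(* Since m < D n, bounding the degree by D at most doubles the nodes; D n <= 2m keeps the new
   average degree within a constant of D. *)
have [V' [le' [S' [N' [us' degD hN]]]]] := uniform_split_nodes us D0.
have N2 : (#|N'| <= 2 * #|N|)%N.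
  rewrite -(leq_pmul2r D0); apply: (leq_trans hN).
  rewrite (mulnC #|N|) -mulnA (mulnC #|N|) mul2n -addnn leq_add2r; exact: ltnW.
have hD : (#|N'| * D <= 4 * (#|J| * L))%N.
  apply: (leq_trans hN); apply: (@leq_trans (#|J| * L + 2 * (#|J| * L))).
    by rewrite leq_add2l mulnC.
  by rewrite -mulSn leq_mul2r orbT.
have mn := card_incidences_le us' degD.
have [g [g1 gL hg]] := H _ _ _ _ _ _ _ _ us' L2 degD p0 hD AD.
have l0 : 0 < L%:R :> R by rewrite ltr0n.
have d0 : 0 < D%:R :> R by rewrite ltr0n.
have mnR : (#|J| * L)%:R <= #|N'|%:R * D%:R :> R by rewrite -natrM ler_nat.
have N2R : #|N'|%:R <= 2 * #|N|%:R :> R by rewrite -natrM ler_nat.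
set n : R := #|N'|%:R in mnR N2R gL.
set n1 : R := #|N|%:R in N2R n0R T20 T30 *.
have nn0 : 0 <= n by rewrite /n.
have n10 : 0 <= n1 by rewrite /n1.
case: hg => hg.
  suff h : (#|J| * L)%:R <= A ^+ 2 * (n1 * Num.sqrt n1) / L%:R.
    by rewrite -addrA; apply: ler_wpDl => //; apply: ler_wpDr.
  rewrite ler_pdivlMr //; apply: (le_trans (y := n * D%:R * L%:R)).
    by rewrite ler_pM2r.
  rewrite -(ler_pXn2r (n := 2)) // ?nnegrE; last first.
  - by rewrite !mulr_ge0 ?sqrtr_ge0 ?exprn_ge0 // ltW.
  - by rewrite !mulr_ge0 // ltW.
  have e1 : D%:R * (L%:R ^+ 2 * D%:R) <= k' * A * k * n.
    apply: (le_trans (y := k' * A * g * (L%:R ^+ 2 * D%:R))).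
      by rewrite ler_pM2r // mulr_gt0 // exprn_gt0.
    by rewrite -!(mulrA (k' * A)) ler_pM2l // mulr_gt0.
  have -> : (n * D%:R * L%:R) ^+ 2 = n ^+ 2 * (D%:R * (L%:R ^+ 2 * D%:R)) by ring.
  apply: (le_trans (y := n ^+ 2 * (k' * A * k * n))).
    by rewrite ler_wpM2l // exprn_ge0.
  have -> : (A ^+ 2 * (n1 * Num.sqrt n1)) ^+ 2 = A ^+ 4 * n1 ^+ 3.
    by rewrite !exprMn sqr_sqrtr //; ring.
  have -> : n ^+ 2 * (k' * A * k * n) = (k' * A * k) * n ^+ 3 by ring.
  apply: (le_trans (y := (k' * A * k) * (2 * n1) ^+ 3)).
    by rewrite ler_wpM2l ?lerXn2r ?nnegrE // !mulr_ge0 // ltW.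
  (* The doubling of the nodes, cubed, is the factor 8 in the condition on [A]. *)
  have -> : k' * A * k * (2 * n1) ^+ 3 = 8 * (k' * k) * A * n1 ^+ 3 by ring.
  by rewrite ler_wpM2r // exprn_ge0.
suff h : (#|J| * L)%:R <= 4 * k * c * n1 ^+ 2 / L%:R `^ (2 + s).
  by apply: ler_wpDl => //; rewrite addr_ge0.
rewrite ler_pdivlMr ?powR_gt0 //.
have -> : L%:R `^ (2 + s) = L%:R ^+ 2 * L%:R `^ s.
  by rewrite powRD ?powR_mulrn // (gt_eqF l0) implybT.
apply: (le_trans (y := n * D%:R * (L%:R ^+ 2 * (c * g)))).
  apply: ler_pM => //; first by rewrite mulr_ge0 ?exprn_ge0 ?powR_ge0.
  by rewrite ler_wpM2l // exprn_ge0.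
have -> : n * D%:R * (L%:R ^+ 2 * (c * g)) = c * n * (g * (L%:R ^+ 2 * D%:R)) by ring.
apply: (le_trans (y := c * n * (k * n))).
  by rewrite ler_wpM2l // mulr_ge0 // ltW.
have -> : c * n * (k * n) = c * k * n ^+ 2 by ring.
have -> : 4 * k * c * n1 ^+ 2 = c * k * (2 * n1) ^+ 2 by ring.
by rewrite ler_wpM2l ?lerXn2r ?nnegrE // !mulr_ge0 // ltW.
Qed.

(** The distance to the fixed point is multiplied by (2 - sqrt 2)/(t + 1), which is at most 1/2 for
    t >= 2. *)
Lemma exponent_step (t : R) : 2 <= t -> t <= 1 + Num.sqrt 2 ->
  let t' := 2 + (t - 1) / (t + 1) in
  [/\ 2 <= t', t' <= 1 + Num.sqrt 2
    & 1 + Num.sqrt 2 - t' <= (1 + Num.sqrt 2 - t) / 2].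
Proof.
move=> t2 tr t'.
have r0 : 0 <= Num.sqrt 2 :> R by rewrite sqrtr_ge0.
have r2 : Num.sqrt 2 ^+ 2 = 2 :> R by rewrite sqr_sqrtr.
set r := Num.sqrt 2 in tr r0 r2 *.
have r12 : 1 <= r <= 2 by apply/andP; split; nra.
have t1 : 0 < t + 1 by lra.
have e : 1 + r - t' = (2 - r) * (1 + r - t) / (t + 1).
  have -> : (2 - r) * (1 + r - t) = r - (2 - r) * t.
    have -> : (2 - r) * (1 + r - t) = 2 + r - r ^+ 2 - (2 - r) * t by ring.
    by rewrite r2; ring.
  by rewrite /t'; field; rewrite gt_eqF.
have u0 : 0 <= 1 + r - t by lra.
have [r1 r2'] := andP r12.
split.
- by rewrite lerDl divr_ge0 //; lra.
- rewrite -subr_ge0 e divr_ge0 //; last by lra.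
  by rewrite mulr_ge0 //; lra.
rewrite e ler_pdivrMr //.
apply: (le_trans (y := (1 + r - t) * 1)); first by rewrite mulrC ler_wpM2l //; lra.
by rewrite -mulrA ler_wpM2l //; lra.
Qed.

Lemma sparse_iterate A : 8 <= A -> 8 * (16384 * 3072) * A <= A ^+ 4 ->
  forall k : nat, exists t C : R,
  [/\ 0 < C, sparse A t C, 2 <= t, t <= 1 + Num.sqrt 2
    & 1 + Num.sqrt 2 - t <= 2^-1 ^+ k].
Proof.
move=> A8 A4.
have r2 : Num.sqrt 2 ^+ 2 = 2 :> R by rewrite sqr_sqrtr.
have r0 : 0 <= Num.sqrt 2 :> R by rewrite sqrtr_ge0.
have r16 : 5 * Num.sqrt 2 <= 8 :> R.
  by rewrite leNgt; apply/negP => h; move: r2 r0 h; clear; nra.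
have r1 : 1 <= Num.sqrt 2 :> R.
  by rewrite leNgt; apply/negP => h; move: r2 r0 h; clear; nra.
elim=> [|k [t [C [C0 spA t2 tr tk]]]].
  exists 2, 4; split=> //.
  - by apply: sparse_base; apply: le_trans A8; rewrite ler1n.
  - by move: r1; clear; lra.
  - by rewrite expr0; move: r2 r0 r16; clear; nra.
have t13 : 5 * t <= 13 by move: tr r16; clear; lra.
have [C' C'0 spA'] := sparse_step A8 A4 C0 t2 t13 spA.
have [h1 h2 h3] := exponent_step t2 tr.
exists (2 + (t - 1) / (t + 1)), C'; split=> //.
by apply: (le_trans h3); rewrite exprS mulrC ler_pM2l ?invr_gt0.
Qed.

End Iterate.

From mathcomp Require Import all_classical all_reals all_analysis.
Import numFieldNormedType.Exports.

(** * From the density bound to the exponents *)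

Section Final.
Variable R : realType.
Implicit Types A t C : R.

(** With [L] half the average length, paths shorter than [L] carry at most half of the incidences;
    cutting the others loses at most another half. *)
Lemma system_split (V I : finType) (le : rel V) (S : {set V * I})
    (N : {set V}) (J : {set I}) :
  bridge_free le S -> {in S, forall u, u.1 \in N /\ u.2 \in J} ->
  (0 < #|J|)%N -> (4 * #|J| <= #|S|)%N ->
  exists (I' : finType) (S' : {set V * I'}) (J' : {set I'}) (L : nat),
  [/\ uniform_system le S' N J' L, (2 <= L)%N, (#|S| <= 4 * #|J| * L)%N
    & (#|S| <= 4 * (#|J'| * L))%N].
Proof.
move=> bf supp p0 big; pose L := (#|S| %/ (2 * #|J|))%N.
have pp : (0 < 2 * #|J|)%N by rewrite muln_gt0.
have L2 : (2 <= L)%N by rewrite leq_divRL // mulnA.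
have [|I' [S' [J' [us h]]]] := uniform_split_paths (N := N) bf _ (ltnW L2).
  by move=> u /supp[].
have hL : (L * (2 * #|J|) <= #|S|)%N by exact: leq_divM.
have hL' : (#|S| < L.+1 * (2 * #|J|))%N by exact: ltn_ceil.
exists I', S', J', L; split=> //.
  apply: leq_trans (ltnW hL') _; rewrite (_ : 4 * #|J| * L = (2 * L) * (2 * #|J|))%N.
    by rewrite leq_mul2r; apply/orP; right; lia.
  by rewrite mulnACA -mulnA (mulnC L).
rewrite [leqLHS](@card_sum_nodes _ _ S J); last by move=> u /supp[].
have le1 : (\sum_(i in J) #|nodes S i| <=
    #|J| * L + \sum_(i | L <= #|nodes S i|) #|nodes S i|)%N.
  rewrite -sum_nat_const (big_mkcond (fun i => L <= _)%N) /=.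
  rewrite [X in (_ <= _ + X)%N](bigID (mem J)) /= addnA -big_split /=.
  apply: leq_trans (leq_addr _ _); apply: leq_sum => i _.
  by case: (leqP L #|nodes S i|) => h1; [exact: leq_addl|rewrite addn0 ltnW].
apply: (leq_trans le1).
have h4 : (2 * (#|J| * L) <= \sum_(i in J) #|nodes S i|)%N.
  rewrite -card_sum_nodes; last by move=> u /supp[].
  by move: hL; rewrite mulnC mulnA.
move: le1 h h4; set x := (\sum_(i in J) _)%N; set y := (\sum_(i | _) _)%N; lia.
Qed.

(** One of the three terms is at least m/12, and 1/l <= 4p/m eliminates the length l. *)
Lemma system_trichotomy A t C (n p m l j : R) : 0 <= A -> 0 < C -> 2 <= t ->
  0 <= n -> 0 < p -> 2 <= l -> m <= 4 * p * l -> m <= 4 * j -> 0 < m ->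
  j <= A * n + A ^+ 2 * (n * Num.sqrt n) / l + C * n ^+ 2 / l `^ t ->
  [\/ m <= 12 * A * n, m ^+ 2 <= 48 * A ^+ 2 * (n * Num.sqrt n) * p
    | m `^ (t + 1) <= 12 * 4 `^ t * C * n ^+ 2 * p `^ t].
Proof.
move=> A0 C0 t2 n0 p0 l2 ml mj m0 h.
have l0 : 0 < l by lra.
have [h1|h1] := lerP m (12 * A * n); first by constructor 1.
have [h2|h2] := lerP m (12 * A ^+ 2 * (n * Num.sqrt n) / l).
  constructor 2; rewrite ler_pdivlMr // in h2.
  have h3 : m * m <= m * (4 * p * l) by rewrite ler_pM2l.
  have h4 : m * l * (4 * p) <= 12 * A ^+ 2 * (n * Num.sqrt n) * (4 * p).
    by rewrite ler_pM2r // mulr_gt0.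
  rewrite expr2; lra.
have h3 : m <= 12 * C * n ^+ 2 / l `^ t by rewrite -!mulrA in h h1 h2 *; lra.
constructor 3; rewrite ler_pdivlMr ?powR_gt0 // in h3.
rewrite powRD; last by rewrite (gt_eqF m0) implybT.
rewrite powRr1 ?(ltW m0) // mulrC.
apply: (le_trans (y := m * (4 * p * l) `^ t)).
  rewrite ler_pM2l // ge0_ler_powR ?nnegrE //; [lra|exact: ltW|].
  by rewrite !mulr_ge0 // ltW.
rewrite !powRM ?mulr_ge0 ?(ltW p0) ?(ltW l0) //.
have -> : m * (4 `^ t * p `^ t * l `^ t) = 4 `^ t * p `^ t * (m * l `^ t) by ring.
have -> : 12 * 4 `^ t * C * n ^+ 2 * p `^ t =
  4 `^ t * p `^ t * (12 * C * n ^+ 2) by ring.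
by rewrite ler_wpM2l // mulr_ge0 // powR_ge0.
Qed.

End Final.

Section Final.
Variable R : realType.
Implicit Types A t C : R.
Local Notation r2 := (Num.sqrt (2 : R)).

Lemma sqrt2_facts : [/\ 1 <= r2, r2 <= 2 & r2 * r2 = 2].
Proof.
have e : r2 * r2 = 2 by rewrite -expr2 sqr_sqrtr.
have r0 : 0 <= r2 by rewrite sqrtr_ge0.
split=> //; first by rewrite -[leLHS]sqrtr1 ler_wsqrtr // ler1n.
by rewrite leNgt; apply/negP => h; move: e r0 h; clear; nra.
Qed.

Lemma inv_sqrt2 : 1 / r2 = r2 / 2.
Proof.
have [r1 _ e] := sqrt2_facts; have r0 : r2 != 0 by rewrite gt_eqF //; lra.
by apply: (mulIf r0); rewrite divfK // mulrAC e divff.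
Qed.

Definition target (n : nat) (e p : R) : R :=
  n%:R `^ (3 / 4) * p `^ (1 / 2) + n%:R `^ (2 - r2 + e) * p `^ (1 / r2) + n%:R.

(** Since p <= n^2, p^(1 - 1/sqrt 2) is at most n^(2 - sqrt 2). This disposes of systems with O(p)
    incidences. *)
Lemma demands_le (n p e : R) : 1 <= n -> 1 <= p -> p <= n ^+ 2 -> 0 <= e ->
  p <= n `^ (2 - r2 + e) * p `^ (1 / r2).
Proof.
move=> n1 p1 pn e0; have [r1 r22 re] := sqrt2_facts.
have p0 : 0 < p by lra.
have n0 : 0 < n by lra.
rewrite -{1}(powRr1 (ltW p0)) [in leLHS](_ : 1 = (1 - 1 / r2) + 1 / r2); last first.
  by rewrite subrK.
rewrite powRD; last by rewrite (gt_eqF p0) implybT.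
rewrite ler_wpM2r ?powR_ge0 //.
have h : 0 <= 1 - 1 / r2 by rewrite inv_sqrt2; lra.
apply: (le_trans (y := (n ^+ 2) `^ (1 - 1 / r2))).
  by rewrite ge0_ler_powR ?nnegrE // ?ltW // exprn_gt0.
rewrite -powR_mulrn ?(ltW n0) // -powRrM ler_powR //.
by rewrite inv_sqrt2; lra.
Qed.

Lemma root_power_le (m K n p t : R) : 0 < K -> 0 < m -> 0 < n -> 0 < p -> 2 <= t ->
  m `^ (t + 1) <= K * n ^+ 2 * p `^ t ->
  m <= K `^ ((t + 1)^-1) * (n `^ (2 / (t + 1)) * p `^ (t / (t + 1))).
Proof.
move=> K0 m0 n0 p0 t2 h; have t1 : 0 < t + 1 by lra.
have e : (m `^ (t + 1)) `^ ((t + 1)^-1) = m.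
  by rewrite -powRrM divff ?gt_eqF // powRr1 // ltW.
rewrite -{1}e.
apply: (le_trans (y := (K * n ^+ 2 * p `^ t) `^ ((t + 1)^-1))).
  rewrite ge0_ler_powR ?nnegrE ?invr_ge0 ?powR_ge0 ?(ltW t1) //.
  by rewrite !mulr_ge0 ?powR_ge0 ?exprn_ge0 // ltW.
rewrite -(powR_mulrn 2 (ltW n0)).
rewrite !powRM ?mulr_ge0 ?powR_ge0 ?(ltW K0) //.
by rewrite -!powRrM mulrA.
Qed.

(** With d = 0, both are equalities at t = 1 + sqrt 2. For smaller t the second quotient decreases,
    and the first grows by at most the distance to the limit. *)
Lemma exponent_limit (t d : R) : 2 <= t -> t <= 1 + r2 -> 1 + r2 - t <= d ->
  2 / (t + 1) <= 2 - r2 + d /\ t / (t + 1) <= 1 / r2.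
Proof.
move=> t2 tr td; have [r1 r22 re] := sqrt2_facts.
have t1 : 0 < t + 1 by lra.
rewrite inv_sqrt2; split; rewrite ler_pdivrMr //.
  have h : (2 - r2 + (1 + r2 - t)) * (t + 1) <= (2 - r2 + d) * (t + 1).
    by rewrite ler_pM2r //; lra.
  apply: le_trans h.
  have : 0 <= (1 + r2 - t) * (t - 1 + r2) by rewrite mulr_ge0 //; lra.
  have -> : (1 + r2 - t) * (t - 1 + r2) = - 1 + 2 * t - t ^+ 2 + r2 * r2 by ring.
  have -> : (2 - r2 + (1 + r2 - t)) * (t + 1) = 3 + 2 * t - t ^+ 2 by ring.
  by rewrite re; lra.
have : 0 <= (1 + r2 - t) * (2 - r2) by rewrite mulr_ge0 //; lra.
have -> : (1 + r2 - t) * (2 - r2) = 2 + r2 - r2 * r2 - t * (2 - r2) by ring.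
by rewrite re; lra.
Qed.

Definition size_bound (C0 : R) (n : nat) (e : R) : Prop :=
  forall (S : {set 'I_n * ('I_n * 'I_n)}) (J : {set 'I_n * 'I_n}) (le : rel 'I_n),
    bridge_free le S -> {in S, forall u, u.2 \in J} ->
    #|S|%:R <= C0 * target n e #|J|%:R.

Lemma fourth_power (n p : R) : 0 < n -> 0 < p ->
  (n `^ (3 / 4) * p `^ (1 / 2)) ^+ 2 = n * Num.sqrt n * p.
Proof.
move=> n0 p0; rewrite exprMn -!powR_mulrn ?powR_ge0 // -!powRrM.
rewrite (_ : 1 / 2 * 2 = 1 :> R); last by field.
rewrite powRr1 ?(ltW p0) // -powR12_sqrt ?(ltW n0) //.
rewrite -[X in X * _ `^ _](powRr1 (ltW n0)) -powRD; last first.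
  by rewrite (gt_eqF n0) implybT.
by congr (_ `^ _ * _); field.
Qed.

Lemma target_ge0 n e p : 0 <= target n e p.
Proof. by rewrite !addr_ge0 // mulr_ge0 // powR_ge0. Qed.

Lemma target_ge (n : nat) (e p : R) :
  [/\ n%:R `^ (3 / 4) * p `^ (1 / 2) <= target n e p,
      n%:R `^ (2 - r2 + e) * p `^ (1 / r2) <= target n e p & n%:R <= target n e p].
Proof.
have h1 : 0 <= n%:R `^ (3 / 4) * p `^ (1 / 2) :> R by rewrite mulr_ge0 // powR_ge0.
have h2 : 0 <= n%:R `^ (2 - r2 + e) * p `^ (1 / r2) :> R.
  by rewrite mulr_ge0 // powR_ge0.
have h3 : 0 <= n%:R :> R by [].
by rewrite /target; split; lra.
Qed.

Lemma small_half_power (d : R) : 0 < d -> exists k : nat, 2^-1 ^+ k <= d.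
Proof.
move=> d0; exists (Num.trunc d^-1).+1.
rewrite exprVn -[leRHS]invrK lef_pV2 ?posrE ?invr_gt0 ?exprn_gt0 //.
apply: (le_trans (ltW (truncnS_gt _))).
by rewrite -natrX ler_nat; exact/ltnW/ltn_expl.
Qed.

Lemma eventually_le_power (K d : R) : 0 < K -> 0 < d ->
  exists n0 : nat, forall n : nat, (n0 <= n)%N -> K <= n%:R `^ d.
Proof.
move=> K0 d0; exists (Num.trunc (K `^ d^-1)).+1 => n hn.
have e : (K `^ d^-1) `^ d = K by rewrite -powRrM mulVf ?gt_eqF // powRr1 // ltW.
rewrite -[leLHS]e ge0_ler_powR ?nnegrE ?powR_ge0 // ?ltW //.
by apply: lt_le_trans (truncnS_gt _) _; rewrite ler_nat.
Qed.

Lemma card_pairs_le (n : nat) (J : {set 'I_n * 'I_n}) : (#|J| <= n ^ 2)%N.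
Proof. by apply: leq_trans (max_card _) _; rewrite card_prod card_ord. Qed.

(** Half of [d] pays for the distance of t from its limit, the other half for the constant
    K^(1/(t+1)), which depends on t and so on [d]. Thus [20 * A] is the same for all [d]. *)
Lemma size_bound_eventually A (d : R) : 8 <= A ->
  8 * (16384 * 3072) * A <= A ^+ 4 -> 0 < d ->
  exists n0 : nat, forall n, (n0 <= n)%N -> size_bound (20 * A) n d.
Proof.
move=> A8 A4 d0; have A0 : 0 < A by exact: lt_le_trans A8.
have d20 : 0 < d / 2 by rewrite divr_gt0.
have [k kd] := small_half_power d20.
have [t [C [C0 spA t2 tr tk]]] := sparse_iterate A8 A4 k.
clear A4.
have [e1 e2] := exponent_limit t2 tr (le_trans tk kd).
pose K := 12 * 4 `^ t * C.
have K0 : 0 < K by rewrite !mulr_gt0 // powR_gt0.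
have K10 : 0 < K `^ ((t + 1)^-1) by rewrite powR_gt0.
have [n0 hn0] := eventually_le_power K10 d20.
exists n0 => n nn S J le bf supp.
set p : R := #|J|%:R.
have T0 := target_ge0 n d p; have [T1 T2 T3] := target_ge n d p.
have A20 : 0 <= 20 * A by rewrite mulr_ge0 // ltW.
have [m0|m0] := posnP #|S|; first by rewrite m0 mulr_ge0.
have supp' : {in S, forall u, u.1 \in [set: 'I_n] /\ u.2 \in J}.
  by move=> u /supp; rewrite inE.
have [u uS] : exists u, u \in S by apply/card_gt0P.
have p0 : (0 < #|J|)%N by apply/card_gt0P; exists u.2; exact: supp.
have n1 : (0 < n)%N by apply: leq_ltn_trans (ltn_ord u.1).
have n1R : 1 <= n%:R :> R by rewrite ler1n.
have p1R : 1 <= p by rewrite ler1n.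
have n0R : 0 < n%:R :> R by rewrite ltr0n.
have p0R : 0 < p by rewrite ltr0n.
have mono c x : 0 <= c -> c <= 20 * A -> x <= target n d p ->
    c * x <= 20 * A * target n d p.
  move=> c0 cA xT; apply: (le_trans (y := c * target n d p)).
    by rewrite ler_wpM2l.
  by rewrite ler_wpM2r.
have [small|big] := ltnP #|S| (4 * #|J|).
  apply: (le_trans (y := 4 * p)).
    by rewrite -natrM ler_nat ltnW.
  apply: mono => //; first by move: A8; clear; lra.
  apply: le_trans T2; apply: demands_le => //; last exact: ltW.
  by rewrite -natrX ler_nat card_pairs_le.
have [I' [S' [J' [L [us L2 h1 h2]]]]] := system_split bf supp' p0 big.
have := spA _ _ _ _ _ _ _ us L2.
rewrite cardsT card_ord => h3.
have m0R : 0 < #|S|%:R :> R by rewrite ltr0n.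
have h1R : #|S|%:R <= 4 * p * L%:R :> R by rewrite -!natrM ler_nat.
have h2R : #|S|%:R <= 4 * (#|J'| * L)%:R :> R by rewrite -natrM ler_nat.
have L2R : 2 <= L%:R :> R by rewrite ler_nat.
have [h|h|h] := system_trichotomy (ltW A0) C0 t2 (ltW n0R) p0R L2R h1R h2R m0R h3.
- apply: (le_trans h); apply: mono => //; first by rewrite mulr_ge0 // ltW.
  by rewrite ler_pM2r // ler_nat.
- apply: (le_trans (y := 7 * A * (n%:R `^ (3 / 4) * p `^ (1 / 2)))); last first.
    by apply: mono; rewrite ?mulr_ge0 ?(ltW A0) ?ler_pM2r ?ler_nat.
  rewrite -(ler_pXn2r (n := 2)) // ?nnegrE ?mulr_ge0 ?powR_ge0 ?(ltW A0) //.
  apply: (le_trans h); rewrite [leRHS]exprMn fourth_power //.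
  set z := A ^+ 2 * (n%:R * Num.sqrt n%:R * p).
  have z0 : 0 <= z by rewrite !mulr_ge0 ?exprn_ge0 ?sqrtr_ge0 // ltW.
  have -> : 48 * A ^+ 2 * (n%:R * Num.sqrt n%:R) * p = 48 * z by rewrite /z; ring.
  have -> : (7 * A) ^+ 2 * (n%:R * Num.sqrt n%:R * p) = 49 * z by rewrite /z; ring.
  by rewrite ler_wpM2r // ler_nat.
- rewrite -[12 * 4 `^ t * C]/K in h.
  apply: (le_trans (root_power_le K0 m0R n0R p0R t2 h)).
  rewrite -[leLHS]mul1r; apply: mono => //; first by move: A8; clear; lra.
  apply: le_trans T2; rewrite mulrA; apply: ler_pM.
  + by rewrite mulr_ge0 // powR_ge0.
  + exact: powR_ge0.
  + apply: (le_trans (y := n%:R `^ (d / 2) * n%:R `^ (2 - r2 + d / 2))).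
      apply: ler_pM; rewrite ?powR_ge0 //; first exact: hn0.
      by rewrite ler_powR.
    rewrite -powRD; last by rewrite (gt_eqF n0R) implybT.
    by rewrite ler_powR //; lra.
  + by rewrite ler_powR.
Qed.

(** The crude bound n p holds for every n; it supplies the exponent while n is too small for the
    real one. *)
Lemma size_bound_trivial (C0 : R) (n : nat) : 1 <= C0 -> size_bound C0 n 2.
Proof.
move=> C1 S J le bf supp; set p : R := #|J|%:R.
have T0 := target_ge0 n 2 p; have [T1 T2 T3] := target_ge n 2 p.
have [m0|m0] := posnP #|S|; first by rewrite m0 mulr_ge0 // (le_trans _ C1).
have [u uS] : exists u, u \in S by apply/card_gt0P.
have p0 : (0 < #|J|)%N by apply/card_gt0P; exists u.2; exact: supp.
have n1 : (0 < n)%N by apply: leq_ltn_trans (ltn_ord u.1).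
have n1R : 1 <= n%:R :> R by rewrite ler1n.
have n0R : 0 < n%:R :> R by rewrite ltr0n.
have p1R : 1 <= p by rewrite ler1n.
apply: (le_trans (y := target n 2 p)); last by rewrite ler_peMl.
apply: le_trans T2.
have hS : (#|S| <= n * #|J|)%N.
  rewrite (card_sum_nodes supp) mulnC -sum_nat_const; apply: leq_sum => i _.
  by apply: leq_trans (max_card _) _; rewrite card_ord.
apply: (le_trans (y := n%:R * p)); first by rewrite -natrM ler_nat.
have pn : p <= n%:R ^+ 2 by rewrite -natrX ler_nat card_pairs_le.
have h := demands_le n1R p1R pn (ler01 : (0 : R) <= 1).
apply: (le_trans (y := n%:R * (n%:R `^ (2 - r2 + 1) * p `^ (1 / r2)))).
  by rewrite ler_pM2l.
rewrite mulrA ler_wpM2r ?powR_ge0 //.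
rewrite -{1}(powRr1 (ltW n0R)) -powRD; last by rewrite (gt_eqF n0R) implybT.
by rewrite ler_powR //; lra.
Qed.

(** Take 1/(k+1) for the largest k <= n that is good for n, and [b] if there is none. The cap k <= n
    makes a largest one exist, and every fixed k is good from some n on. *)
Lemma diagonal_exponent (Q : nat -> R -> Prop) (b : R) :
  (forall d, 0 < d -> exists n0 : nat, forall n, (n0 <= n)%N -> Q n d) ->
  (forall n, Q n b) ->
  exists eps : nat -> R, (eps n @[n --> \oo] --> (0 : R))%classic /\ forall n, Q n (eps n).
Proof.
move=> Qev Qb; pose g n k := (k <= n)%N && `[< Q n k.+1%:R^-1 >].
have gb n k : g n k -> (k <= n)%N by case/andP.
pose eps n := match pselect (exists k, g n k) with
  | left ex => (ex_maxn ex (gb n)).+1%:R^-1 | right _ => b end : R.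
exists eps; split=> [|n]; last first.
  rewrite /eps; case: pselect => [ex|_]; last exact: Qb.
  by case: ex_maxnP => k /andP[_ /asboolP].
apply/cvgrPdist_le => e e0.
pose k := Num.trunc e^-1.
have k0 : 0 < k.+1%:R^-1 :> R by rewrite invr_gt0 ltr0n.
have [n0 hn0] := Qev _ k0.
exists (maxn n0 k) => // n; rewrite /= geq_max => /andP[nn0 nk].
have gk : g n k by rewrite /g nk; apply/asboolP; exact: hn0.
rewrite /eps; case: pselect => [ex|]; last by case; exists k.
case: ex_maxnP => j _ /(_ k gk) kj.
rewrite sub0r normrN ger0_norm ?invr_ge0 //.
apply: (le_trans (y := k.+1%:R^-1)).
  by rewrite lef_pV2 ?posrE ?ltr0n // ler_nat.
rewrite -[leRHS]invrK lef_pV2 ?posrE ?invr_gt0 ?ltr0n //.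
exact: ltW (truncnS_gt _).
Qed.

End Final.

Local Open Scope classical_set_scope.
Local Open Scope ring_scope.

Lemma card_minimal_preserver (R : realType) (n : nat) (C0 e : R)
    (P H : {set 'I_n * 'I_n}) :
  size_bound C0 n e -> (forall x, x \in H -> exists i, cuts P H x i) ->
  #|H|%:R <= (C0 + 2) * target n e #|P|%:R.
Proof.
move=> sb minH.
have suppP : {in cut_system P H, forall u, u.2 \in P}.
  move=> [v i] /(cut_systemP minH)[u [_ _ _]].
  by case/and3P.
have h1 := sb _ _ _ (cut_system_bridge_free minH) suppP.
have h2 := card_inner_edges minH; rewrite card_ord in h2.
have [_ _ h3] := target_ge n e (#|P|%:R : R).
have e1 : #|H| = (#|[set x in H | reachable H x.2 x.1]| + #|cut_system P H|)%N.
  rewrite card_cut_system // -(cardsID [set x | reachable H x.2 x.1] H); congr addn.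
    by apply: eq_card => x; rewrite !inE.
  by apply: eq_card => x; rewrite !inE andbC.
have h4 : #|H|%:R <= 2 * n%:R + #|cut_system P H|%:R :> R.
  by rewrite -natrM -natrD ler_nat e1 leq_add2r.
rewrite mulrDl; lra.
Qed.

Theorem theorem5 (R : realType) :
  exists (A : ram_prog) (T : nat -> nat) (C : R) (eps : nat -> R),
    [/\ polynomially_bounded T,
        eps n @[n --> \oo] --> (0 : R) &
        forall (n : nat) (G P : {set 'I_n * 'I_n}),
        exists H : {set 'I_n * 'I_n},
          [/\ ram_outputs_within A (encode_instance G P)
                (T (size (encode_instance G P))) (encode_graph H),
              reachability_preserver G P H &
              #|H|%:R <= C * (n%:R `^ (3 / 4) * #|P|%:R `^ (1 / 2)
                + n%:R `^ (2 - Num.sqrt 2 + eps n)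
                    * #|P|%:R `^ (1 / Num.sqrt 2)
                + n%:R)]].
Proof.
(* The condition on [A] asks for 8 * 16384 * 3072 = 3 * 2^27 <= A^3 = 2^30. *)
pose A : R := 2 ^+ 10.
have A0 : 0 < A by rewrite exprn_gt0.
have A8 : 8 <= A by rewrite /A -natrX ler_nat.
have A4 : 8 * (16384 * 3072) * A <= A ^+ 4.
  have -> : 16384 = 2 ^+ 4 * A :> R by rewrite /A -exprD -natrX.
  have -> : 3072 = 3 * A :> R by rewrite /A -natrX -natrM.
  have -> : 8 * (2 ^+ 4 * A * (3 * A)) * A = 384 * A ^+ 3 by ring.
  by rewrite [leRHS]exprS ler_wpM2r ?exprn_ge0 ?(ltW A0) // /A -natrX ler_nat.
have A20 : 1 <= 20 * A.
  by apply: mulr_ege1; [rewrite ler1n|apply: le_trans A8; rewrite ler1n].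
have [eps [eps0 epsP]] := @diagonal_exponent R (size_bound (20 * A)) 2
  (fun d => size_bound_eventually A8 A4)
  (fun n => @size_bound_trivial R (20 * A) n A20).
exists Greedy, run_time, (20 * A + 2), eps; split.
- by exists 1072%N, 3%N.
- exact: eps0.
move=> n G P; have [H [out pres minH]] := greedy_preserver G P.
by exists H; split=> //; exact: card_minimal_preserver (epsP n) minH.
Qed.
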